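(* Let $T>0$, $\ell>0$, $\alpha\in(0,1)$. Let $a,f\in C^2([0,T]\times[-\ell,\ell]\times\mathbb{R}\times\mathbb{R})$ and let $b(\cdot,\pm\ell,\cdot),\,g(\cdot,\pm\ell,\cdot)\in C^2([0,T]\times\mathbb{R})$ be gradient-independent, all real-valued, with $a>0$ and $b>0$. Let $u^0\in C^{2+\alpha}([-\ell,\ell])$ satisfy the compatibility condition $$\mp b(0,x,u^0)u^0_x+g(0,x,u^0)=a(0,x,u^0,u^0_x)u^0_{xx}+f(0,x,u^0,u^0_x)\quad\text{at }x=\pm\ell,$$ and let $K$ be such that $|u^0(x)-u^0(y)|\le K|x-y|$ for $x,y\in[-\ell,\ell]$. Suppose there is a constant $M>0$ for which there exist $q_0\ge K$ and $\psi\in C^1([0,\infty),[1,\infty))$ with $$\int_{q_0}^\infty\frac{\rho\,d\rho}{\psi(\rho)}>2M$$ such that $$|f(t,x,z,p)|\le a(t,x,z,p)\,\psi(|p|),\qquad (t,x,z,p)\in\overline{\Omega}_T\times[-M,M]\times\mathbb{R},$$ and such that for all $(t,z)\in(0,T]\times[-M,M]$ and all $p\ge q_0$ $$\pm g(t,\ell,z)\le b(t,\ell,z)p,\qquad \mp g(t,-\ell,z)\le b(t,-\ell,z)p$$ (for both choices of sign). Let $u$ be the unique solution, on its maximal interval of existence $[0,\tau_\infty)\subset[0,T]$, to $$u_t-a(t,x,u,u_x)u_{xx}=f(t,x,u,u_x),\qquad t>0,\ x\in(-\ell,\ell),$$ $$u_t\pm b(t,x,u)u_x=g(t,x,u),\qquad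 t>0,\ x=\pm\ell,$$ $$u(0,x)=u^0(x),\qquad x\in[-\ell,\ell].$$ If $|u|_{\Omega_\tau}\le M$ for all $\tau<\tau_\infty$, then $u\in\mathcal{C}^{1+\frac{\alpha}{2},2+\alpha}(\Omega_T)$.
   Context: Conventions. $\Omega=(-\ell,\ell)$, $\Omega_\tau=(0,\tau)\times(-\ell,\ell)$; $|v|_S=\sup_S|v|$. Equations at $x=\pm\ell$ with $\pm$ (or $\mp$) mean two equations: the upper sign at $x=+\ell$, the lower sign at $x=-\ell$. Maximal solution: under the stated regularity, positivity and compatibility assumptions, the problem has a unique solution $u$ on a maximal interval of existence $[0,\tau_\infty)\subset[0,T]$ with $u\in\mathcal{C}^{1+\frac{\alpha}{2},2+\alpha}(\Omega_\tau)$ for every $\tau<\tau_\infty$, and either $\lim_{\tau\nearrow\tau_\infty}|u|^{(1+\frac{\alpha}{2},2+\alpha)}_{\Omega_\tau}=\infty$ or $u\in\mathcal{C}^{1+\frac{\alpha}{2},2+\alpha}(\Omega_T)$. Hölder spaces. For an interval $I$ and $\beta\in(0,1)$: $[v]^{(\beta)}_I=\sup_{x\ne y\in I}|v(x)-v(y)|/|x-y|^\beta$; $C^{2+\alpha}([-\ell,\ell])$ consists of $C^2$ functions with $\alpha$-Hölder continuous second derivative. For $u:\Omega_\tau\to\mathbb{R}$ set $\langle u\rangle^{(\beta)}_{t,\Omega_\tau}=\sup_{x\in\Omega}[u(\cdot,x)]^{(\beta)}_{(0,\tau)}$, $\langle u\rangle^{(\beta)}_{x,\Omega_\tau}=\sup_{t\in(0,\tau)}[u(t,\cdot)]^{(\beta)}_{\Omega}$,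 and $\langle u\rangle^{(\frac{\alpha}{2},\alpha)}_{\Omega_\tau}=\langle u\rangle^{(\alpha/2)}_{t,\Omega_\tau}+\langle u\rangle^{(\alpha)}_{x,\Omega_\tau}$. $\mathcal{C}^{1+\frac{\alpha}{2},2+\alpha}(\Omega_\tau)$ is the set of $u:\Omega_\tau\to\mathbb{R}$ with finite norm $$|u|^{(1+\frac{\alpha}{2},2+\alpha)}_{\Omega_\tau}=|u|_{\Omega_\tau}+|u_x|_{\Omega_\tau}+|u_{xx}|_{\Omega_\tau}+|u_t|_{\Omega_\tau}+\langle u_t\rangle^{(\frac{\alpha}{2},\alpha)}_{\Omega_\tau}+\langle u_{xx}\rangle^{(\frac{\alpha}{2},\alpha)}_{\Omega_\tau}+\langle u_x\rangle^{(\frac{1+\alpha}{2})}_{t,\Omega_\tau}.$$ For such $u$ the functions $u,u_x,u_{xx},u_t$ extend continuously to $\overline{\Omega}_\tau$, so boundary and initial conditions make sense pointwise. *)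

(* Defs.v *)
(* MathComp-Analysis development, over an arbitrary [R : realType]. *)
From HB Require Import structures.
From mathcomp Require Import all_boot all_order all_algebra.
From mathcomp Require Import all_classical all_reals all_analysis.

Set Implicit Arguments.
Unset Strict Implicit.
Unset Printing Implicit Defensive.

Import Order.TTheory GRing.Theory Num.Theory.
Import numFieldNormedType.Exports.

Local Open Scope classical_set_scope.
Local Open Scope ring_scope.

Section ContinuousExtension.
Context {R : realType} {V : normedModType R}.
Implicit Types (D S : set V) (h : V -> R).

(* Value at [p] (in the closure of [D]) of the continuous extension of [h|_D];
   it does not depend on the values of [h] outside [D]. *)
Definition cext D h (p : V) : R := lim (h y @[y --> within D (nbhs p)]).

Definition extends_continuously S h : Prop :=
  exists2 k : V -> R, {within S, continuous k} & forall y, S° y -> h y = k y.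

(* All (iterated, directional) derivatives of order at most [n] exist in the
   interior of [S] and extend continuously to [S]. *)
Fixpoint diff_upto (n : nat) S h : Prop :=
  extends_continuously S h /\
  if n is m.+1 then
    forall v : V, (forall y, S° y -> derivable h y v) /\ diff_upto m S ('D_v h)
  else True.

(* [h] is of class C^n on [S]; meant for [S] convex, closed, with nonempty
   interior.  Only the values of [h] on [S] matter. *)
Definition class_C (n : nat) S h : Prop :=
  {within S, continuous h} /\ diff_upto n S h.

End ContinuousExtension.

Section HolderSpaces.
Context {R : realType}.
Implicit Types (I : set R) (u : R -> R -> R) (v : R -> R) (alpha beta l tau : R).

Definition holder_seminorm beta I v : \bar R :=
  ereal_sup [set r | exists x y, [/\ I x, I y, x != y &
    r = (`|v x - v y| / (`|x - y| `^ beta))%:E]].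

(* Membership in C^{2+alpha}(I): C^2 on [I], and the second derivative
   (extended continuously from the interior to [I]) is alpha-Hoelder. *)
Definition class_C2_holder alpha I v : Prop :=
  class_C 2 I v /\
  (holder_seminorm alpha I (cext I° (derive1 (derive1 v))) < +oo)%E.

Definition Omega l : set R := `]- l, l[.

Definition cylinder l tau : set (R * R) := `]0, tau[ `*` Omega l.

(* Throughout, the first argument of [u] is time and the second is space. *)
Definition d_t u : R -> R -> R := fun t x => derive1 (fun s => u s x) t.
Definition d_x u : R -> R -> R := fun t x => derive1 (u t) x.
Definition d_xx u : R -> R -> R := d_x (d_x u).

Definition sup_norm l tau u : \bar R :=
  ereal_sup [set `|u z.1 z.2|%:E | z in cylinder l tau].

Definition holder_t beta l tau u : \bar R :=
  ereal_sup [set holder_seminorm beta `]0, tau[ (fun t => u t x) | x in Omega l].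

Definition holder_x beta l tau u : \bar R :=
  ereal_sup [set holder_seminorm beta (Omega l) (u t) | t in `]0, tau[].

Definition holder_tx alpha l tau u : \bar R :=
  (holder_t (alpha / 2)%R l tau u + holder_x alpha l tau u)%E.

Definition parabolic_norm alpha l tau u : \bar R :=
  (sup_norm l tau u + sup_norm l tau (d_x u) + sup_norm l tau (d_xx u)
  + sup_norm l tau (d_t u)
  + holder_tx alpha l tau (d_t u) + holder_tx alpha l tau (d_xx u)
  + holder_t ((1 + alpha) / 2)%R l tau (d_x u))%E.

(* Since [derive1] is total, the existence of the derivatives occurring in the
   norm has to be required separately. *)
Definition parabolic_holder alpha l tau u : Prop :=
  (forall t x, cylinder l tau (t, x) ->
     [/\ derivable (fun s => u s x) t 1, derivable (u t) x 1
       & derivable (d_x u t) x 1]) /\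
  (parabolic_norm alpha l tau u < +oo)%E.

End HolderSpaces.

Section Problem.
Context {R : realType}.
Variables (alpha l T : R).
Variables (a f : R -> R -> R -> R -> R) (b g : R -> R -> R -> R).
Variable u0 : R -> R.

Definition uncurry4 (h : R -> R -> R -> R -> R) (q : R * R * R * R) : R :=
  h q.1.1.1 q.1.1.2 q.1.2 q.2.

Definition coef_domain : set (R * R * R * R) :=
  `[0, T] `*` `[- l, l] `*` setT `*` setT.

Definition bdry_domain : set (R * R) := `[0, T] `*` setT.

Definition compatibility : Prop :=
  let u0x := cext (Omega l) (derive1 u0) in
  let u0xx := cext (Omega l) (derive1 (derive1 u0)) in
  (- b 0 l (u0 l) * u0x l + g 0 l (u0 l)
     = a 0 l (u0 l) (u0x l) * u0xx l + f 0 l (u0 l) (u0x l)) /\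
  (b 0 (- l) (u0 (- l)) * u0x (- l) + g 0 (- l) (u0 (- l))
     = a 0 (- l) (u0 (- l)) (u0x (- l)) * u0xx (- l)
       + f 0 (- l) (u0 (- l)) (u0x (- l))).

(* [u] solves the initial-boundary value problem on [0, tau) x [-l, l].  Only
   the values of [u] on the open set (0, tau) x (-l, l) are used: on the
   parabolic boundary, u, u_t and u_x are the continuous extensions. *)
Definition solves (tau : R) (u : R -> R -> R) : Prop :=
  let bar (w : R -> R -> R) : R -> R -> R :=
    fun t x => cext (cylinder l tau) (fun z => w z.1 z.2) (t, x) in
  [/\ forall t x, 0 < t < tau -> - l < x < l ->
        d_t u t x - a t x (u t x) (d_x u t x) * d_xx u t x
          = f t x (u t x) (d_x u t x),
      forall t, 0 < t < tau ->
        bar (d_t u) t l + b t l (bar u t l) * bar (d_x u) t l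
          = g t l (bar u t l),
      forall t, 0 < t < tau ->
        bar (d_t u) t (- l) - b t (- l) (bar u t (- l)) * bar (d_x u) t (- l)
          = g t (- l) (bar u t (- l))
    & forall x, - l <= x <= l -> bar u 0 x = u0 x].

(* [u] is the solution on its maximal interval of existence [0, tau_inf).
   In the second alternative "u belongs to C^{1+alpha/2,2+alpha}(Omega_T)"
   includes [tau_inf = T]: [u] is a total function, whose values for times
   after [tau_inf] are meaningless. *)
Definition maximal_solution (tau_inf : R) (u : R -> R -> R) : Prop :=
  [/\ 0 < tau_inf <= T,
      forall tau, 0 < tau < tau_inf -> parabolic_holder alpha l tau u,
      solves tau_inf u
    & parabolic_norm alpha l tau u @[tau --> tau_inf^'-] --> +oo%E \/
      (tau_inf = T /\ parabolic_holder alpha l T u)].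

End Problem.

(* Main.v *)
Require Import Defs.
From HB Require Import structures.
From mathcomp Require Import all_boot all_order all_algebra.
From mathcomp Require Import all_classical all_reals all_analysis.
From mathcomp Require Import ring lra.

Set Implicit Arguments.
Unset Strict Implicit.
Unset Printing Implicit Defensive.

Import Order.TTheory GRing.Theory Num.Theory.
Import numFieldNormedType.Exports.

Local Open Scope classical_set_scope.
Local Open Scope ring_scope.

(** The maximum principle bounds the parabolic Hoelder norm of [u] uniformly up to [tau_inf], which
    excludes the blow-up alternative.

    Gradient.  The integral condition allows solving [om'' = - psi (om')], [om 0 = 0] on some
    [[0, d0]] with [q0 <= om'] and [2 * M <= om d0].  Then [u(t,x) - u(t,y) <= om (x - y)]: where
    this would first fail, [u_x = om'] at both points, and [|f| <= a psi] (or the condition on [g]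
    on the lateral boundary) gives [u_t] the wrong sign.

    Time derivative.  For large [lam] and [L],
    [u(s,y) - u(s-h,x) - (y-x)^2 / (4 lam h) <= L h]: on the lateral boundary [u_t = g -+ b u_x] is
    bounded, and at an interior maximum the Hessian condition in [(x,y)] contradicts the
    equation.  The case [x = y] bounds [u_t], hence also [u_xx].

    Hoelder norms.  The difference quotients of [u] in time solve linear problems with
    bounded coefficients.  Comparing them with [K d^alpha] shows that [u_t] is
    alpha-Hoelder in space, and a parabola barrier turns this into alpha/2-Hoelder in time.  The
    equation transfers these bounds to [u_xx], and interpolation gives the
    (1+alpha)/2-Hoelder bound in time for [u_x]. *)

(** * Peano expansions *)

(** The obstacle is that no bound on $u_{xx}$ is available before one on $u_t$: the difference
    quotient of $u$ in time at a fixed point solves a linear equation whose drift contains $a_p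
    u_{xx}$, and by the equation $u_{xx}$ is as large as $u_t$. The penalty $(y-x)^2/(4\lambda h)$
    breaks this circle. At a maximum both points have the same slope $p=(y-x)/(2\lambda h)$, so the
    coefficients differ only through $t$, $x$ and $u$, that is by $O(Lh)$. The Hessian condition
    then opposes a term of size $\lambda hL^2$ to an error of size $hL^2$ times a Lipschitz
    constant, which fixes $\lambda$.

    The dynamic boundary condition fits maximum arguments because it too turns a one-sided
    inequality for $u_x$ into a sign of $u_t$.

    Only the gradient bound starts at $t=0$. On $(0,\frac34\tau_\infty]$ the solution already lies
    in the Hoelder space, so the other bounds are propagated from $\tau_\infty/2$ and glued to what
    is known before. The constants may depend on $u$ itself; only their finiteness up to
    $\tau_\infty$ counts. *)

Section Taylor.
Context {R : realType}.
Implicit Types (D : set R) (f g : R -> R) (a b c d e p q r s x y : R).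

Definition taylor1 D f x p : Prop := forall e, 0 < e ->
  exists2 d, 0 < d & forall y, D y -> `|y - x| < d ->
    `|f y - f x - p * (y - x)| <= e * `|y - x|.

(** Involves no derivative of [f] at points other than [x]; this is exactly the information that the
    second-order test at a maximum consumes. *)
Definition taylor2 D f x p q : Prop := forall e, 0 < e ->
  exists2 d, 0 < d & forall y, D y -> `|y - x| < d ->
    `|f y - f x - p * (y - x) - q / 2 * (y - x) ^+ 2| <= e * (y - x) ^+ 2.

Lemma taylor1_sub D E f x p : E `<=` D -> taylor1 D f x p -> taylor1 E f x p.
Proof.
move=> ED h e /h[d d0 H]; exists d => // y /ED; exact: H.
Qed.

Lemma taylor2_sub D E f x p q :
  E `<=` D -> taylor2 D f x p q -> taylor2 E f x p q.
Proof.
move=> ED h e /h[d d0 H]; exists d => // y /ED; exact: H.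
Qed.

Lemma taylor1_eq D f g x p : (forall y, D y -> f y = g y) -> D x ->
  taylor1 D f x p -> taylor1 D g x p.
Proof.
move=> fg Dx h e /h[d d0 H]; exists d => // y Dy; rewrite -!fg//; exact: H.
Qed.

Lemma taylor2_eq D f g x p q : (forall y, D y -> f y = g y) -> D x ->
  taylor2 D f x p q -> taylor2 D g x p q.
Proof.
move=> fg Dx h e /h[d d0 H]; exists d => // y Dy; rewrite -!fg//; exact: H.
Qed.

Lemma taylor1D D f g x p q : taylor1 D f x p -> taylor1 D g x q ->
  taylor1 D (fun y => f y + g y) x (p + q).
Proof.
move=> hf hg e e0; have e20 : 0 < e / 2 by lra.
have [d d0 H] := hf _ e20; have [c c0 G] := hg _ e20.
exists (Num.min d c); first by rewrite lt_min d0.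
move=> y Dy; rewrite lt_min => /andP[/(H y Dy) H1 /(G y Dy) G1].
have -> : f y + g y - (f x + g x) - (p + q) * (y - x) =
  (f y - f x - p * (y - x)) + (g y - g x - q * (y - x)) by ring.
apply: le_trans (ler_normD _ _) _; lra.
Qed.

Lemma taylor2D D f g x p q p' q' : taylor2 D f x p q -> taylor2 D g x p' q' ->
  taylor2 D (fun y => f y + g y) x (p + p') (q + q').
Proof.
move=> hf hg e e0; have e20 : 0 < e / 2 by lra.
have [d d0 H] := hf _ e20; have [c c0 G] := hg _ e20.
exists (Num.min d c); first by rewrite lt_min d0.
move=> y Dy; rewrite lt_min => /andP[/(H y Dy) H1 /(G y Dy) G1].
have -> : f y + g y - (f x + g x) - (p + p') * (y - x)
   - (q + q') / 2 * (y - x) ^+ 2 =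
  (f y - f x - p * (y - x) - q / 2 * (y - x) ^+ 2) +
  (g y - g x - p' * (y - x) - q' / 2 * (y - x) ^+ 2) by field.
apply: le_trans (ler_normD _ _) _; lra.
Qed.

Lemma taylor1Z D f x p k : taylor1 D f x p ->
  taylor1 D (fun y => k * f y) x (k * p).
Proof.
move=> hf e e0; have k0 : 0 < `|k| + 1 by rewrite ltr_wpDl.
have [|d d0 H] := hf (e / (`|k| + 1)); first by rewrite divr_gt0.
exists d => // y Dy yx; have {}H := H y Dy yx.
have -> : k * f y - k * f x - k * p * (y - x) =
  k * (f y - f x - p * (y - x)) by ring.
rewrite normrM; apply: (@le_trans _ _ ((`|k| + 1) * (e / (`|k| + 1) * `|y - x|))).
  apply: ler_pM => //; lra.
by rewrite !mulrA [_ * e]mulrC mulfK// gt_eqF.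
Qed.

Lemma taylor2Z D f x p q k : taylor2 D f x p q ->
  taylor2 D (fun y => k * f y) x (k * p) (k * q).
Proof.
move=> hf e e0; have k0 : 0 < `|k| + 1 by rewrite ltr_wpDl.
have [|d d0 H] := hf (e / (`|k| + 1)); first by rewrite divr_gt0.
exists d => // y Dy yx; have {}H := H y Dy yx.
have -> : k * f y - k * f x - k * p * (y - x) - k * q / 2 * (y - x) ^+ 2 =
  k * (f y - f x - p * (y - x) - q / 2 * (y - x) ^+ 2) by field.
rewrite normrM.
apply: (@le_trans _ _ ((`|k| + 1) * (e / (`|k| + 1) * (y - x) ^+ 2))).
  apply: ler_pM => //; lra.
by rewrite !mulrA [_ * e]mulrC mulfK// gt_eqF.
Qed.

Lemma taylor2_quadratic D (f : R -> R) x p q :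
  (forall y, D y -> f y = f x + p * (y - x) + q / 2 * (y - x) ^+ 2) ->
  taylor2 D f x p q.
Proof.
move=> H e e0; exists 1 => // y Dy _; rewrite H//.
rewrite [X in `|X|](_ : _ = 0); last by ring.
by rewrite normr0 mulr_ge0 ?sqr_ge0// ltW.
Qed.

Lemma taylor1_affine D (f : R -> R) x p :
  (forall y, D y -> f y = f x + p * (y - x)) -> taylor1 D f x p.
Proof.
move=> H e e0; exists 1 => // y Dy _; rewrite H//.
rewrite [X in `|X|](_ : _ = 0); last by ring.
by rewrite normr0 mulr_ge0 ?normr_ge0// ltW.
Qed.

(** [s] is a sign. The case $s=-1$ exchanges the two ends of the space interval and reverses time;
    [c] is a translation. The second coefficient does not see the sign. *)
Lemma taylor2_reparam D E f x p q s c : s ^+ 2 = 1 ->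
  (forall y, E y -> D (s * y + c)) ->
  taylor2 D f (s * x + c) p q ->
  taylor2 E (fun y => f (s * y + c)) x (s * p) q.
Proof.
move=> s1 ED h e /h[d d0 H]; exists d => // y Ey yx.
have n1 : `|s| = 1.
  by move/eqP: s1; rewrite sqrf_eq1 => /orP[] /eqP ->; rewrite ?normrN normr1.
have E1 : s * y + c - (s * x + c) = s * (y - x) by ring.
move: (H _ (ED y Ey)); rewrite E1 normrM n1 mul1r => /(_ yx).
rewrite exprMn s1 mul1r.
by have -> : p * (s * (y - x)) = s * p * (y - x) by ring.
Qed.

Lemma taylor1_reparam D E f x p s c : s ^+ 2 = 1 ->
  (forall y, E y -> D (s * y + c)) ->
  taylor1 D f (s * x + c) p ->
  taylor1 E (fun y => f (s * y + c)) x (s * p).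
Proof.
move=> s1 ED h e /h[d d0 H]; exists d => // y Ey yx.
have n1 : `|s| = 1.
  by move/eqP: s1; rewrite sqrf_eq1 => /orP[] /eqP ->; rewrite ?normrN normr1.
have E1 : s * y + c - (s * x + c) = s * (y - x) by ring.
move: (H _ (ED y Ey)); rewrite E1 normrM n1 mul1r => /(_ yx).
by have -> : p * (s * (y - x)) = s * p * (y - x) by ring.
Qed.

Lemma taylor2_taylor1 D f x p q : taylor2 D f x p q -> taylor1 D f x p.
Proof.
move=> h e e0; have [d d0 H] := h 1 ltr01.
have q1 : 0 < `|q / 2| + 1 by rewrite ltr_wpDl.
exists (Num.min d (e / (`|q / 2| + 1))); first by rewrite lt_min d0 divr_gt0.
move=> y Dy; rewrite lt_min => /andP[/(H y Dy)].
rewrite mul1r ltr_pdivlMr// => H1 H2.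
have E1 : f y - f x - p * (y - x) =
  (f y - f x - p * (y - x) - q / 2 * (y - x) ^+ 2) + q / 2 * (y - x) ^+ 2 by ring.
rewrite E1; apply: le_trans (ler_normD _ _) _.
have S : (y - x) ^+ 2 = `|y - x| * `|y - x| by rewrite -expr2 real_normK ?num_real.
rewrite [X in _ + X]normrM [X in _ + _ * `|X|]S !normrM !normr_id.
move: H1; rewrite S => H1.
apply: (@le_trans _ _ ((`|y - x| * (`|q / 2| + 1)) * `|y - x|)).
  rewrite -normrM; lra.
by apply: ler_wpM2r; rewrite ?normr_ge0// ltW.
Qed.

Lemma taylor1_max_left D f x p a : a < x ->
  (forall y, a <= y <= x -> D y /\ f y <= f x) -> taylor1 D f x p -> 0 <= p.
Proof.
move=> ax H h; rewrite leNgt; apply/negP => p0.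
have [|d d0 G] := h (- p / 2); first by lra.
pose y := Num.max a (x - d / 2).
have [ya yx] : a <= y /\ y < x by rewrite /y le_max lexx gt_max ax; split=> //=; lra.
have yd : x - d / 2 <= y by rewrite /y le_max lexx orbT.
have [|Dy fy] := H y; first by rewrite ya ltW.
have N : `|y - x| = x - y by rewrite ltr0_norm; lra.
have := G y Dy; rewrite N => /(_ ltac:(lra)).
rewrite ler_norml => /andP[H1 H2]; nra.
Qed.

Lemma taylor1_max_right D f x p b : x < b ->
  (forall y, x <= y <= b -> D y /\ f y <= f x) -> taylor1 D f x p -> p <= 0.
Proof.
move=> ax H h; rewrite leNgt; apply/negP => p0.
have [|d d0 G] := h (p / 2); first by lra.
pose y := Num.min b (x + d / 2).
have [ya yx] : y <= b /\ x < y by rewrite /y ge_min lexx lt_min ax; split=> //=; lra.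
have yd : y <= x + d / 2 by rewrite /y ge_min lexx orbT.
have [|Dy fy] := H y; first by rewrite ya ltW.
have N : `|y - x| = y - x by rewrite gtr0_norm; lra.
have := G y Dy; rewrite N => /(_ ltac:(lra)).
rewrite ler_norml => /andP[H1 H2]; nra.
Qed.

Lemma taylor2_max D f x p q a b : a < x < b ->
  (forall y, a <= y <= b -> D y /\ f y <= f x) -> taylor2 D f x p q ->
  p = 0 /\ q <= 0.
Proof.
move=> /andP[ax xb] H h.
have p0 : p = 0.
  apply/eqP; rewrite eq_le; apply/andP; split.
    apply: (@taylor1_max_right D f x p b) => //; last exact: taylor2_taylor1 h.
    by move=> y /andP[y1 y2]; apply: H; lra.
  apply: (@taylor1_max_left D f x p a) => //; last exact: taylor2_taylor1 h.
  by move=> y /andP[y1 y2]; apply: H; lra.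
split=> //; rewrite leNgt; apply/negP => q0.
have [|d d0 G] := h (q / 4); first by lra.
pose y := Num.min b (x + d / 2).
have [ya yx] : y <= b /\ x < y by rewrite /y ge_min lexx lt_min xb; split=> //=; lra.
have yd : y <= x + d / 2 by rewrite /y ge_min lexx orbT.
have [|Dy fy] := H y; first by apply/andP; split; lra.
have N : `|y - x| = y - x by rewrite gtr0_norm; lra.
have := G y Dy; rewrite N => /(_ ltac:(lra)).
rewrite p0 ler_norml => /andP[H1 H2].
have : 0 < (y - x) ^+ 2 by rewrite exprn_gt0; lra.
move: H1 H2; set z := (y - x) ^+ 2 => H1 H2 z0; nra.
Qed.

Lemma is_derive_taylor1 D f x p : is_derive x 1 f p -> taylor1 D f x p.
Proof.
move=> [df fp] e e0.
move: df; rewrite /derivable => /cvg_ex[/= l dl].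
have lp : l = p by rewrite -fp /derive; apply/esym/cvg_lim.
move: dl; rewrite lp => /cvgrPdist_le /(_ e e0).
rewrite near_withinE => /nbhs_ballP[d /= d0 H].
exists d => // y Dy yx.
have [->|yNx] := eqVneq y x; first by rewrite !subrr mulr0 subr0 normr0 mulr0.
have h0 : y - x != 0 by rewrite subr_eq0.
have := H (y - x); rewrite /ball/= sub0r normrN => /(_ yx h0).
rewrite scaler1 [y - x + x]subrK /GRing.scale/=.
move=> H1; have -> : f y - f x - p * (y - x) =
  - ((p - (y - x)^-1 * (f y - f x)) * (y - x)) by field.
by rewrite normrN normrM ler_wpM2r.
Qed.

Lemma is_derive_continuous f x p : is_derive x 1 f p -> {for x, continuous f}.
Proof. by case=> df _; exact/differentiable_continuous/derivable1_diffP. Qed.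

Lemma MVT_le f g a b C : a <= b -> {within `[a, b], continuous f} ->
  (forall x, a < x < b -> is_derive x 1 f (g x)) ->
  (forall x, a < x < b -> `|g x| <= C) -> `|f b - f a| <= C * (b - a).
Proof.
rewrite le_eqVlt => /predU1P[<-|ab] cf df gC.
  by rewrite !subrr normr0 mulr0.
have df' x : x \in `]a, b[%R -> is_derive x 1 f (g x).
  by rewrite in_itv/=; exact: df.
have [x xab ->] := MVT ab df' cf; move: xab; rewrite in_itv/= => /gC xC.
by rewrite normrM [X in _ * X]gtr0_norm ?subr_gt0// ler_wpM2r// subr_ge0 ltW.
Qed.

(* The remainder is controlled through the mean value theorem applied to
   [f - (p * + q / 2 *^2)], whose derivative is [o(y - x)]. *)
Lemma is_derive_taylor2 D f g x q r : 0 < r ->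
  (forall y, `|y - x| < r -> is_derive y 1 f (g y)) -> is_derive x 1 g q ->
  taylor2 D f x (g x) q.
Proof.
move=> r0 df dg e e0.
have [d d0 G] := @is_derive_taylor1 setT g x q dg e e0.
exists (Num.min d r); first by rewrite lt_min d0.
move=> y _; rewrite lt_min => /andP[yd yr].
pose phi z := f z - g x * (z - x) - q / 2 * (z - x) ^+ 2.
have dphi z : `|z - x| < r -> is_derive z 1 phi (g z - g x - q * (z - x)).
  move=> zr; have fz := df z zr.
  rewrite (_ : phi = (f - (g x) *: (id - cst x)) - (q / 2) *: (id - cst x) ^+ 2); last first.
    by apply/funext => w; rewrite /phi !fctE.
  apply: is_derive_eq.
  rewrite /GRing.scale/= !(mulr1, expr1, addr0, mul0r, mulr0, add0r, oppr0, subr0).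
  have -> : (id - cst x) z = z - x by [].
  by field.
have phiE : f y - f x - g x * (y - x) - q / 2 * (y - x) ^+ 2 = phi y - phi x.
  by rewrite /phi; ring.
have cphi a b : `|a - x| < r -> `|b - x| < r -> {within `[a, b], continuous phi}.
  move=> ar br; apply: continuous_in_subspaceT => z; rewrite inE/= in_itv/= => /andP[az zb].
  apply: is_derive_continuous; apply: dphi.
  by move: ar br; rewrite !ltr_norml => /andP[? ?] /andP[? ?]; apply/andP; split; lra.
rewrite phiE -[X in _ * X]real_normK ?num_real// expr2 mulrA.
have x0 : `|x - x| < r by rewrite subrr normr0.
have bd a b : `|a - x| < r -> `|b - x| < r -> (forall z, a < z < b -> `|z - x| <= `|y - x|) ->
    a <= b -> `|phi b - phi a| <= (e * `|y - x|) * (b - a).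
  move=> ar br zy ab; apply: (@MVT_le phi (fun z => g z - g x - q * (z - x))) => //.
  - exact: cphi.
  - by move=> z /zy H; apply: dphi; apply: le_lt_trans yr.
  - move=> z /zy H; apply: le_trans (G z I _) _; first exact: le_lt_trans yd.
    by rewrite ler_wpM2l// ltW.
have [xy|yx] := leP x y.
  rewrite [X in _ <= _ * X](_ : _ = y - x); last by rewrite ger0_norm// subr_ge0.
  apply: bd => // z /andP[xz zy].
  by rewrite !ger0_norm; lra.
rewrite distrC [X in _ <= _ * X](_ : _ = x - y); last by rewrite ltr0_norm; lra.
apply: bd => //; last exact: ltW.
move=> z /andP[xz zy].
by rewrite !ltr0_norm; lra.
Qed.

End Taylor.

(** * Two-point comparison *)

Section Clamp.
Context {R : realType}.
Implicit Types (a b x y : R).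

(** Composition with this projection makes a function that is continuous on a closed box continuous
    everywhere, so that maxima over products of intervals are found without subspace topologies. *)
Definition clamp a b x : R := Num.max a (Num.min b x).

Lemma clamp_bounds a b x : a <= b -> a <= clamp a b x <= b.
Proof. by move=> ab; rewrite /clamp le_max lexx/= ge_max ab ge_min lexx. Qed.

Lemma clamp_id a b x : a <= x <= b -> clamp a b x = x.
Proof. by move=> /andP[ax xb]; rewrite /clamp min_r// max_r. Qed.

Lemma clamp_lip a b x y : `|clamp a b x - clamp a b y| <= `|x - y|.
Proof.
rewrite /clamp; have n := ler_norm (x - y); have n' := ler_norm (y - x).
rewrite distrC in n'.
rewrite ler_norml; apply/andP; split;
 case: (leP b x) => bx; case: (leP b y) => by_;
 rewrite /Num.max /Num.min; repeat case: ifP; lra.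
Qed.

Lemma clamp_continuous a b : continuous (clamp a b).
Proof.
move=> x; apply/cvgrPdist_le => e e0; apply/nbhs_ballP; exists e => //= y.
by rewrite /ball/= => /ltW; exact: le_trans (clamp_lip _ _ _ _).
Qed.

Lemma within_continuous_clamp a b (f : R -> R) : a <= b ->
  {within `[a, b], continuous f} -> continuous (fun x => f (clamp a b x)).
Proof.
move=> ab /subspace_continuousP cf x.
have ci y : `[a, b]%classic (clamp a b y) by rewrite /= in_itv/= clamp_bounds.
have H : clamp a b y @[y --> x] --> within `[a, b] (nbhs (clamp a b x)).
  move=> A HA.
  have {HA} /nbhs_ballP[e e0 He] :
    \forall y \near clamp a b x, `[a, b]%classic y -> A y by exact: HA.
  apply/nbhs_ballP; exists e => // y xy; apply: He => //.
  by move: xy; rewrite /ball/=; exact: le_lt_trans (clamp_lip _ _ _ _).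
exact: (cvg_comp _ _ H (cf _ (ci x))).
Qed.

End Clamp.

Section Classical.
Context {R : realType}.
Implicit Types (w wt wx wxx : R -> R -> R) (l t s x y : R).

Definition lip2 l (t0 t1 : R) w (C : R) := forall t s x y, t0 <= t <= t1 -> t0 <= s <= t1 ->
  - l <= x <= l -> - l <= y <= l -> `|w t x - w s y| <= C * (`|t - s| + `|x - y|).

(* Derivatives are encoded by Peano expansions relative to the closed rectangle, so that they are
   one-sided on the lateral boundary and pass to continuous extensions. *)
Record classical l (t0 t1 : R) w wt wx wxx : Prop := Classical {
  classical_lip : exists2 C : R, 0 <= C & lip2 l t0 t1 w C ;
  classical_t : forall t x, t0 < t <= t1 -> - l <= x <= l ->
    taylor1 `[t0, t1] (w ^~ x) t (wt t x) ;
  classical_x : forall t x, t0 < t <= t1 -> - l <= x <= l ->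
    taylor1 `[- l, l] (w t) x (wx t x) ;
  classical_xx : forall t x, t0 < t <= t1 -> - l < x < l ->
    taylor2 `[- l, l] (w t) x (wx t x) (wxx t x) }.

Lemma classicalN l (t0 t1 : R) w wt wx wxx : classical l t0 t1 w wt wx wxx ->
  classical l t0 t1 (fun t x => - w t x) (fun t x => - wt t x)
    (fun t x => - wx t x) (fun t x => - wxx t x).
Proof.
case=> -[C C0 wC] ht hx hxx; split.
- by exists C => // t s x y *; rewrite -opprD normrN; exact: wC.
- move=> t x tt xl; have := taylor1Z (-1) (ht t x tt xl); rewrite mulN1r.
  by apply: taylor1_eq => [y _|]; rewrite ?mulN1r//= in_itv/=; lra.
- move=> t x tt xl; have := taylor1Z (-1) (hx t x tt xl); rewrite mulN1r.
  by apply: taylor1_eq => [y _|]; rewrite ?mulN1r//= in_itv/=; lra.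
- move=> t x tt xl; have := taylor2Z (-1) (hxx t x tt xl); rewrite !mulN1r.
  by apply: taylor2_eq => [y _|]; rewrite ?mulN1r//= in_itv/=; lra.
Qed.

Lemma classical_sub l (ta tb ta' tb' : R) U Ut Ux Uxx : ta <= ta' -> tb' <= tb ->
  classical l ta tb U Ut Ux Uxx -> classical l ta' tb' U Ut Ux Uxx.
Proof.
move=> aa bb [[C C0 UC] Ht Hx Hxx].
have sub t : ta' <= t <= tb' -> ta <= t <= tb.
  by move=> /andP[h1 h2]; rewrite (le_trans aa h1) (le_trans h2 bb).
have sub' t : ta' < t <= tb' -> ta < t <= tb.
  by move=> /andP[h1 h2]; rewrite (le_lt_trans aa h1) (le_trans h2 bb).
split.
- by exists C => // t s x y /sub tt /sub ss; exact: UC.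
- move=> t x /sub' tt xl; apply: taylor1_sub (Ht _ _ tt xl) => z.
  by rewrite /= !in_itv/=; exact: sub.
- by move=> t x /sub'; exact: Hx.
- by move=> t x /sub'; exact: Hxx.
Qed.

Lemma lip2_continuous l (t0 t1 : R) w (C : R) : t0 <= t1 -> 0 <= l -> 0 <= C ->
  lip2 l t0 t1 w C ->
  continuous (fun p : R * R => w (clamp t0 t1 p.1) (clamp (- l) l p.2)).
Proof.
move=> t01 l0 C0 wC p; apply/cvgrPdist_le => e e0.
have C20 : 0 < 2 * C + 1 by lra.
have d0 : 0 < e / (2 * C + 1) by rewrite divr_gt0.
exists (ball p.1 (e / (2 * C + 1)), ball p.2 (e / (2 * C + 1))).
  by split; exact: nbhsx_ballx.
have ll : - l <= l by lra.
move=> q [/= + +]; rewrite /ball/= => q1 q2.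
apply: le_trans (wC _ _ _ _ _ _ _ _) _; try exact: clamp_bounds.
have := clamp_lip t0 t1 p.1 q.1; have := clamp_lip (- l) l p.2 q.2 => h1 h2.
apply: (@le_trans _ _ (C * (e / (2 * C + 1) + e / (2 * C + 1)))).
  by apply: ler_wpM2l => //; lra.
rewrite -[leRHS](@divfK _ (2 * C + 1)) ?gt_eqF//; move: q1.
set z := e / _; move=> q1; have z0 : 0 < z by rewrite divr_gt0.
nra.
Qed.

Lemma compact_max (T : topologicalType) (B : set T) (F : T -> R) :
  B !=set0 -> compact B -> continuous F ->
  exists2 p, B p & forall q, B q -> F q <= F p.
Proof.
move=> B0 cB cF.
have cFB : {within B, continuous F} by exact: continuous_subspaceT.
have [p pB H] := compact_EVT_max B0 cB cFB.
by exists p; [rewrite inE in pB|move=> q qB; apply: H; rewrite inE].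
Qed.

Lemma space_max_upper l (d0 x y p q p' q' : R) (W om : R -> R) :
  - l <= y -> x <= l -> 0 < x - y < d0 ->
  taylor2 `[0, d0] om (x - y) p' q' ->
  (forall z, y <= z <= l -> z - y <= d0 -> W z - om (z - y) <= W x - om (x - y)) ->
  (x < l -> taylor2 `[- l, l] W x p q -> p = p' /\ q <= q') /\
  (x = l -> taylor1 `[- l, l] W x p -> p' <= p).
Proof.
move=> ly xl /andP[d_gt0 d_lt] tom Wmax.
pose D : set R := `[y, Num.min l (y + d0)]%classic.
have DP z : D z -> y <= z <= l /\ z - y <= d0.
  rewrite /D/= in_itv/= le_min => /andP[-> /andP[-> h]].
  by split=> //; rewrite lerBlDl.
pose f z := W z + (-1) * om (1 * z + (- y)).
have fle z : D z -> f z <= f x.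
  by move=> /DP[z1 z2]; rewrite /f !mul1r !mulN1r; exact: Wmax.
have Dl z : D z -> `[- l, l]%classic z.
  by move=> /DP[/andP[z1 z2] _]; rewrite /= in_itv/= z2 (le_trans ly z1).
have Tom : taylor2 D (fun z => om (1 * z + (- y))) x (1 * p') q'.
  apply: (@taylor2_reparam _ `[0, d0]); first by rewrite expr1n.
    by move=> z /DP[/andP[z1 _] z2]; rewrite /= in_itv/= mul1r subr_ge0 z1.
  by rewrite mul1r.
split=> xl' T.
  have T2 : taylor2 D f x (p + (-1) * (1 * p')) (q + (-1) * q').
    by apply: taylor2D; [exact: taylor2_sub T|exact: taylor2Z].
  have [||h1 h2] := @taylor2_max _ D f x _ _ y (Num.min l (y + d0)) _ _ T2.
  - rewrite lt_min xl' -subr_gt0 d_gt0/=; clear -d_lt; lra.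
  - by move=> z zD; split; [|apply: fle]; rewrite /D/= in_itv.
  by clear -h1 h2; split; lra.
have T1 : taylor1 D f x (p + (-1) * (1 * p')).
  apply: taylor1D; last by apply: taylor1Z; exact: taylor2_taylor1 Tom.
  exact: taylor1_sub T.
suff : 0 <= p + (-1) * (1 * p') by clear; lra.
apply: (@taylor1_max_left _ D f x _ y _ _ T1); first by rewrite -subr_gt0.
move=> z yz; have Dz : D z.
  by rewrite /D/= in_itv/= le_min -xl'; clear -yz d_lt; lra.
by split=> //; exact: fle.
Qed.

Lemma space_max_lower l (d0 x y p q p' q' : R) (W om : R -> R) :
  - l <= y -> x <= l -> 0 < x - y < d0 ->
  taylor2 `[0, d0] om (x - y) p' q' ->
  (forall z, - l <= z <= x -> x - z <= d0 ->
    - W z - om (x - z) <= - W y - om (x - y)) ->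
  (- l < y -> taylor2 `[- l, l] W y p q -> p = p' /\ - q' <= q) /\
  (y = - l -> taylor1 `[- l, l] W y p -> p' <= p).
Proof.
move=> ly xl d01 tom Wmax.
pose V z := - W (- z).
have rf D E : (forall z, E z -> D (- z)) ->
    (taylor2 D W y p q -> taylor2 E V (- y) p (- q)) /\
    (taylor1 D W y p -> taylor1 E V (- y) p).
  move=> DE; have DE' z : E z -> D ((-1) * z + 0) by rewrite mulN1r addr0; exact: DE.
  have s1 : (-1 : R) ^+ 2 = 1 by rewrite sqrrN expr1n.
  have yE : (-1) * (- y) + 0 = y by rewrite mulN1r addr0 opprK.
  have VE : V = (fun z => (-1) * W ((-1) * z + 0)).
    by apply/funext => z; rewrite /V !mulN1r addr0.
  rewrite VE; split=> T.
    have -> : p = (-1) * ((-1) * p) by ring.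
    rewrite -(mulN1r q); apply: taylor2Z; apply: (@taylor2_reparam _ D) => //.
    by rewrite yE.
  have -> : p = (-1) * ((-1) * p) by ring.
  by apply: taylor1Z; apply: (@taylor1_reparam _ D) => //; rewrite yE.
have ll z : `[- l, l]%classic z -> `[- l, l]%classic (- z).
  by rewrite /= !in_itv/= => /andP[? ?]; rewrite lerN2 lerNl; apply/andP.
have [rf2 rf1] := rf _ _ ll.
have E : - y - - x = x - y by rewrite opprK addrC.
have H := @space_max_upper l d0 (- y) (- x) p (- q) p' q' V om.
have [|||||h1 h2] := H _ _ _ _ _; clear H.
- by rewrite lerN2.
- by rewrite lerNl.
- by rewrite E.
- by rewrite E.
- move=> z /andP[z1 z2]; rewrite !opprK => z3.
  have W1 : - l <= - z <= x by rewrite lerN2 z2 lerNl.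
  have W2 : x - - z <= d0 by rewrite opprK addrC.
  by have := Wmax _ W1 W2; rewrite /V !opprK [x + z]addrC [- y + x]addrC.
split=> [yl /rf2 T|yl /rf1 T].
  have yl' : - y < l by rewrite ltrNl.
  by have [-> qq] := h1 yl' T; split=> //; rewrite lerNl.
by apply: h2 => //; rewrite yl opprK.
Qed.

(** At a positive maximum of $w(t,x)-w(t,y)-om(x-y)$ neither the initial time, nor the diagonal, nor
    the distance [d0] can occur, so both points satisfy the conditions of [space_max_upper] and
    [space_max_lower]. These force $w_t(x)\le 0\le w_t(y)$, while time wants the opposite. The
    equation enters only through sign conditions at matching slopes, so that nonlinear and linear
    equations, with their boundary conditions, are treated at once. *)
Lemma two_point_comparison l (t0 t1 d0 : R) w wt wx wxx (om om1 om2 : R -> R) :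
  0 < l -> t0 <= t1 -> 0 < d0 ->
  classical l t0 t1 w wt wx wxx ->
  0 <= om 0 ->
  {within `[0, d0], continuous om} ->
  (forall d : R, 0 < d < d0 -> taylor2 `[0, d0] om d (om1 d) (om2 d)) ->
  (forall x y, - l <= x <= l -> - l <= y <= l -> 0 <= x - y <= d0 ->
     w t0 x - w t0 y <= om (x - y)) ->
  (forall t x y, t0 <= t <= t1 -> - l <= x <= l -> - l <= y <= l -> x - y = d0 ->
     w t x - w t y <= om d0) ->
  (forall (t x d : R), t0 < t <= t1 -> - l < x < l -> 0 < d < d0 ->
     wx t x = om1 d -> wxx t x <= om2 d -> wt t x <= 0) ->
  (forall (t x d : R), t0 < t <= t1 -> - l < x < l -> 0 < d < d0 ->
     wx t x = om1 d -> - om2 d <= wxx t x -> 0 <= wt t x) ->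
  (forall (t d : R), t0 < t <= t1 -> 0 < d < d0 -> om1 d <= wx t l -> wt t l <= 0) ->
  (forall (t d : R), t0 < t <= t1 -> 0 < d < d0 -> om1 d <= wx t (- l) ->
     0 <= wt t (- l)) ->
  forall t x y, t0 <= t <= t1 -> - l <= x <= l -> - l <= y <= l ->
    0 <= x - y <= d0 -> w t x - w t y <= om (x - y).
Proof.
move=> l0 t01 d00 [[C C0 wC] Wt Wx Wxx] om0 com tom init far int1 int2 bdr bdl.
(* The sign conditions on [wt] are not strict; the extra term $e(t-t_0)$ makes the inequality in
   time strict, and [e] tends to 0 afterwards. *)
suff key e : 0 < e -> forall t x y, t0 <= t <= t1 -> - l <= x <= l ->
    - l <= y <= l -> 0 <= x - y <= d0 ->
    w t x - w t y - om (x - y) <= e * (t - t0).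
  move=> t x y tt xl yl xy; rewrite -subr_le0; apply/ler_addgt0Pr => e e0.
  have tt0 : 0 < t1 - t0 + 1 by lra.
  have ez : 0 < e / (t1 - t0 + 1) by rewrite divr_gt0.
  have := key _ ez t x y tt xl yl xy.
  have : e / (t1 - t0 + 1) * (t - t0) <= e; last by lra.
  rewrite mulrAC ler_pdivrMr//; nra.
move=> e0 ts xs ys tts xls yls xys; rewrite leNgt; apply/negP => gts.
pose cw (p : R * R) := w (clamp t0 t1 p.1) (clamp (- l) l p.2).
pose F (p : R * R * R) := cw (p.1.1, p.1.2) - cw (p.1.1, p.2) -
  om (clamp 0 d0 (p.1.2 - p.2)) - e * (p.1.1 - t0).
pose A : set (R * R * R) := [set p | 0 <= p.1.2 - p.2 <= d0].
have c11 : continuous (fun p : R * R * R => p.1.1).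
  by move=> p; exact: (continuous_comp (@cvg_fst _ _ _ _ _) (@cvg_fst _ _ _ _ _)).
have c12 : continuous (fun p : R * R * R => p.1.2).
  by move=> p; exact: (continuous_comp (@cvg_fst _ _ _ _ _) (@cvg_snd _ _ _ _ _)).
have c2 : continuous (fun p : R * R * R => p.2) by move=> p; exact: cvg_snd.
have cd : continuous (fun p : R * R * R => p.1.2 - p.2).
  by move=> p; apply: cvgB; [exact: c12|exact: c2].
have ccw : continuous cw by apply: (lip2_continuous t01 (ltW l0) C0 wC).
have com' : continuous (fun d => om (clamp 0 d0 d)).
  exact: within_continuous_clamp (ltW d00) com.
have cF : continuous F.
  move=> p; rewrite /F; apply: cvgB; last first.
    by apply: cvgM; [exact: cvg_cst|apply: cvgB; [exact: c11|exact: cvg_cst]].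
  apply: cvgB; last exact: (continuous_comp (cd p) (com' _)).
  apply: cvgB.
    exact: (@continuous_comp _ _ _ (fun p : R * R * R => (p.1.1, p.1.2)) cw p
      (cvg_pair (c11 p) (c12 p)) (ccw _)).
  exact: (@continuous_comp _ _ _ (fun p : R * R * R => (p.1.1, p.2)) cw p
      (cvg_pair (c11 p) (c2 p)) (ccw _)).
have cA : closed A.
  have -> : A = (fun p : R * R * R => p.1.2 - p.2) @^-1` `[0, d0].
    by apply/seteqP; split => p /=; rewrite in_itv.
  by apply: preimage_closed; [move=> ? _; exact: cd|exact: interval_closed].
pose B := (`[t0, t1] `*` `[- l, l] `*` `[- l, l]) `&` A.
have inB t x y : t0 <= t <= t1 -> - l <= x <= l -> - l <= y <= l ->
    0 <= x - y <= d0 -> B (t, x, y).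
  by move=> *; rewrite /B/=; split=> //; rewrite !in_itv.
have cB : compact B.
  apply: compact_closedI cA.
  exact: (compact_setX (compact_setX (@segment_compact _ _ _) (@segment_compact _ _ _))
    (@segment_compact _ _ _)).
have FE t x y : t0 <= t <= t1 -> - l <= x <= l -> - l <= y <= l ->
    0 <= x - y <= d0 -> F (t, x, y) = w t x - w t y - om (x - y) - e * (t - t0).
  by move=> *; rewrite /F/cw/= !clamp_id.
have [[[t x] y] [[[/= tt xl] yl] xy] Fmax] :=
  compact_max (ex_intro _ _ (inB _ _ _ tts xls yls xys)) cB cF.
rewrite /= !in_itv/= in tt xl yl; rewrite /A/= in xy.
have Fpos : 0 < w t x - w t y - om (x - y) - e * (t - t0).
  rewrite -FE//; apply: lt_le_trans (Fmax _ (inB _ _ _ tts xls yls xys)).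
  by rewrite FE// subr_gt0.
have {}Fmax t' x' y' : t0 <= t' <= t1 -> - l <= x' <= l -> - l <= y' <= l ->
    0 <= x' - y' <= d0 -> w t' x' - w t' y' - om (x' - y') - e * (t' - t0) <=
    w t x - w t y - om (x - y) - e * (t - t0).
  move=> h1 h2 h3 h4; rewrite -!FE//; exact: Fmax (inB _ _ _ h1 h2 h3 h4).
have t0t : t0 < t.
  rewrite lt_neqAle; apply/andP; split; last by case/andP: tt.
  apply/eqP => t0E; have := init x y xl yl xy; rewrite t0E; move: Fpos.
  by rewrite t0E subrr mulr0; clear; lra.
have etp : 0 <= e * (t - t0) by apply: mulr_ge0; rewrite ?subr_ge0 ltW.
have d_gt0 : 0 < x - y.
  rewrite lt_neqAle; apply/andP; split; last by case/andP: xy.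
  apply/eqP => E; move: Fpos; rewrite -E.
  have -> : x = y by apply/eqP; rewrite -subr_eq0 -E.
  by rewrite subrr sub0r subr_gt0 ltNge (le_trans _ etp)// oppr_le0.
have d_lt : x - y < d0.
  rewrite lt_neqAle; apply/andP; split; last by case/andP: xy.
  apply/eqP => E; have := far t x y tt xl yl E; move: Fpos; rewrite E.
  by clear -etp; lra.
have tt1 : t0 < t <= t1 by rewrite t0t; case/andP: tt.
have dd : 0 < x - y < d0 by rewrite d_gt0.
(* Only earlier times are compared, so the maximum may sit at the final time [t1]. *)
have time : 0 <= wt t x - wt t y - e.
  apply: (@taylor1_max_left _ `[t0, t1] (fun s => w s x + (-1) * w s y +
      (-1) * (e * (s - t0))) t _ t0) => //.
    move=> s /andP[s1 s2].
    have ss : t0 <= s <= t1 by rewrite s1 (le_trans s2)//; case/andP: tt.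
    split; first by rewrite /= in_itv.
    by have := Fmax s x y ss xl yl xy; clear; lra.
  have -> : wt t x - wt t y - e = wt t x + (-1) * wt t y + (-1) * e.
    by rewrite !mulN1r.
  apply: taylor1D; first apply: taylor1D; [exact: Wt|apply: taylor1Z; exact: Wt|].
  by apply: taylor1Z; apply: taylor1_affine => s _; ring.
have /andP[lx xl'] := xl; have /andP[ly yl'] := yl; have /andP[d1 d2] := dd.
have wtx : wt t x <= 0.
  have [h1 h2] : (x < l -> taylor2 `[- l, l] (w t) x (wx t x) (wxx t x) ->
      wx t x = om1 (x - y) /\ wxx t x <= om2 (x - y)) /\
      (x = l -> taylor1 `[- l, l] (w t) x (wx t x) -> om1 (x - y) <= wx t x).
    apply: (@space_max_upper l d0 x y) (tom _ dd) _ => // z /andP[z1 z2] z3.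
    have := Fmax t z y tt _ yl; rewrite z2 (le_trans ly z1) subr_ge0 z1 z3.
    by move=> /(_ isT isT); clear; lra.
  have [xl1|lx1] := ltP x l.
    have yx : y < x by rewrite -subr_gt0.
    have x_in : - l < x < l by rewrite xl1 (le_lt_trans ly yx).
    by have [e1 e2] := h1 xl1 (Wxx _ _ tt1 x_in); exact: (int1 t x (x - y)).
  have xE : x = l by apply/eqP; rewrite eq_le xl'.
  have e1 := h2 xE (Wx _ _ tt1 xl); rewrite xE; apply: (bdr t (x - y)) => //.
  by rewrite -[in leRHS]xE.
have wty : 0 <= wt t y.
  have [h1 h2] : (- l < y -> taylor2 `[- l, l] (w t) y (wx t y) (wxx t y) ->
      wx t y = om1 (x - y) /\ - om2 (x - y) <= wxx t y) /\
      (y = - l -> taylor1 `[- l, l] (w t) y (wx t y) -> om1 (x - y) <= wx t y).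
    apply: (@space_max_lower l d0 x y) (tom _ dd) _ => // z /andP[z1 z2] z3.
    have := Fmax t x z tt xl; rewrite z1 (le_trans z2 xl') subr_ge0 z2 z3.
    by move=> /(_ isT isT); clear; lra.
  have [yl1|ly1] := ltP (- l) y.
    have yx : y < x by rewrite -subr_gt0.
    have y_in : - l < y < l by rewrite yl1 (lt_le_trans yx).
    by have [e1 e2] := h1 yl1 (Wxx _ _ tt1 y_in); exact: (int2 t y (x - y)).
  have yE : y = - l by apply/eqP; rewrite eq_le ly1.
  have e1 := h2 yE (Wx _ _ tt1 yl); rewrite yE; apply: (bdl t (x - y)) => //.
  by rewrite -[in leRHS]yE.
clear -time wtx wty e0; lra.
Qed.

End Classical.

(** * Lipschitz bound in time by doubling of variables *)

Section TimeLipschitz.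
Context {R : realType}.

Lemma taylor2_dilate (D E : set R) (f : R -> R) (x p q c : R) :
  (forall z, E z -> D (x + c * z)) -> taylor2 D f x p q ->
  taylor2 E (fun z => f (x + c * z)) 0 (c * p) (c ^+ 2 * q).
Proof.
move=> ED T e e0.
have c1 : 0 < c ^+ 2 + 1 by rewrite ltr_wpDl// sqr_ge0.
have c2 : 0 < `|c| + 1 by rewrite ltr_wpDl.
have [|d d0 H] := T (e / (c ^+ 2 + 1)); first by rewrite divr_gt0.
exists (d / (`|c| + 1)); first by rewrite divr_gt0.
move=> z Ez; rewrite subr0 mulr0 addr0 ltr_pdivlMr// => zd.
have zc : x + c * z - x = c * z by ring.
have cz : `|c * z| < d.
  by apply: le_lt_trans zd; rewrite normrM mulrC ler_wpM2l//; clear; lra.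
have := H _ (ED z Ez); rewrite zc => /(_ cz).
have -> : f (x + c * z) - f x - p * (c * z) - q / 2 * (c * z) ^+ 2 =
  f (x + c * z) - f x - c * p * z - c ^+ 2 * q / 2 * z ^+ 2 by ring.
move=> h; apply: le_trans h _; rewrite exprMn mulrA ler_wpM2r ?sqr_ge0//.
by rewrite mulrAC ler_pdivrMr// ler_wpM2l ?ltW//; clear; lra.
Qed.

(* The second-order information at a maximum of [U y - V x - k (y - x)^2 / h]:
   the Hessian is tested on the vector [(kappa, kappa + Y)]. *)
Lemma doubled_max_hessian l (U V : R -> R) (x y p P X Y kappa : R) :
  - l < x < l -> - l < y < l ->
  taylor2 `[- l, l] V x P Y -> taylor2 `[- l, l] U y p X ->
  (forall x' y', - l <= x' <= l -> - l <= y' <= l ->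
    U y' - V x' - kappa / 2 * (y' - x') ^+ 2 <=
    U y - V x - kappa / 2 * (y - x) ^+ 2) ->
  [/\ p = kappa * (y - x), P = kappa * (y - x) &
    X * (kappa + Y) ^+ 2 <= kappa * Y * (kappa + Y)].
Proof.
move=> xl yl TV TU H.
(* One-variable conditions along the line $z\mapsto(x+cz,\,y+c'z)$; [r / m] keeps both points inside
   the interval. *)
have test c c' : 0 = c' * p - c * P - kappa * (c' - c) * (y - x) /\
    c' ^+ 2 * X - c ^+ 2 * Y - kappa * (c' - c) ^+ 2 <= 0.
  pose r := Num.min (Num.min (l - x) (x + l)) (Num.min (l - y) (y + l)).
  have r0 : 0 < r by rewrite /r !lt_min; clear -xl yl; lra.
  have [[r1 r2] [r3 r4]] : (r <= l - x /\ r <= x + l) /\ (r <= l - y /\ r <= y + l).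
    by rewrite /r !ge_min !lexx ?orbT.
  pose m := `|c| + `|c'| + 1.
  have m0 : 0 < m by rewrite /m; have := normr_ge0 c; have := normr_ge0 c'; clear; lra.
  pose E : set R := `[- (r / m), r / m]%classic.
  have rm : 0 < r / m by rewrite divr_gt0.
  have bnd c1 z : `|c1| <= m -> E z -> `|c1 * z| <= r.
    rewrite /E/= in_itv/= -ler_norml => cm zE; rewrite normrM.
    by rewrite -[leRHS](@divfK _ m) ?gt_eqF// mulrC ler_pM.
  have Ex z : E z -> - l <= x + c * z <= l.
    have cm : `|c| <= m by rewrite /m -addrA lerDl addr_ge0.
    by move=> /(bnd _ _ cm); rewrite ler_norml; clear -r1 r2; lra.
  have Ey z : E z -> - l <= y + c' * z <= l.
    have cm : `|c'| <= m by rewrite /m; have := normr_ge0 c; clear; lra.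
    by move=> /(bnd _ _ cm); rewrite ler_norml; clear -r3 r4; lra.
  pose phi z := U (y + c' * z) + ((-1) * V (x + c * z) +
    (- (kappa / 2)) * (y + c' * z - (x + c * z)) ^+ 2).
  have T : taylor2 E phi 0 (c' * p + ((-1) * (c * P) + (- kappa * (c' - c) * (y - x))))
     (c' ^+ 2 * X + ((-1) * (c ^+ 2 * Y) + (- kappa * (c' - c) ^+ 2))).
    apply: taylor2D; first by apply: taylor2_dilate TU => z /Ey; rewrite /= in_itv.
    apply: taylor2D.
      by apply: taylor2Z; apply: taylor2_dilate TV => z /Ex; rewrite /= in_itv.
    by apply: taylor2_quadratic => z _; field.
  have [||e1 e2] := @taylor2_max _ E phi 0 _ _ (- (r / m)) (r / m) _ _ T.
  - by rewrite oppr_lt0 rm.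
  - move=> z zE; have {}zE : E z by rewrite /E/= in_itv.
    split=> //; rewrite /phi !mulr0 !addr0.
    by have := H _ _ (Ex _ zE) (Ey _ zE); clear; lra.
  by split; [rewrite -e1; ring|move: e2; clear; lra].
have [p1 _] := test 0 1; have [P1 _] := test 1 0.
split; [by move: p1; clear; lra|by move: P1; clear; lra|].
(* When $\kappa+Y>0$ the quadratic form with $c'$ fixed is largest at $c=\kappa c'/(\kappa+Y)$, so
   this direction is optimal: it gives $X\le\kappa Y/(\kappa+Y)$. *)
have [_] := test kappa (kappa + Y).
have -> : kappa + Y - kappa = Y by ring.
have -> : (kappa + Y) ^+ 2 * X - kappa ^+ 2 * Y - kappa * Y ^+ 2 =
  X * (kappa + Y) ^+ 2 - kappa * Y * (kappa + Y) by ring.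
by rewrite subr_le0.
Qed.

(** Since $A_1Y=v-F_1$ and $A_2X\ge v-F_2$ are at least $L/2$, the Hessian condition reads $2\lambda
    hXY\le Y-X$. After multiplication by $A_1A_2$ the left side is at least $\lambda hL^2/2$,
    whereas the right side, a difference of coefficients, is at most $6\,Lam\,hL^2$. Both scale like
    $hL^2$, so the threshold [12 * Lam < lam] does not depend on [L] or [h]. *)
Lemma doubling_contradiction (lam h L Lam AM A1 A2 F1 F2 v X Y : R) :
  0 < h -> 0 < L -> 12 * Lam < lam -> 0 <= Lam -> 0 < A1 <= AM -> 0 < A2 -> AM <= L ->
  L / 2 <= v - F1 <= 2 * L -> L / 2 <= v - F2 ->
  `|A1 - A2| <= 2 * Lam * L * h -> `|F1 - F2| <= 2 * Lam * L * h ->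
  v = A1 * Y + F1 -> v <= A2 * X + F2 ->
  X * ((2 * lam * h)^-1 + Y) ^+ 2 <= (2 * lam * h)^-1 * Y * ((2 * lam * h)^-1 + Y) ->
  False.
Proof.
move=> h0 L0 lamL Lam0 /andP[A10 A1M] A20 AML /andP[v1 v1'] v2 dA dF vY vX H.
have lam0 : 0 < lam by clear -lamL Lam0; lra.
have Y0 : 0 < Y.
  rewrite -(pmulr_rgt0 _ A10); clear -vY v1 L0; lra.
set kappa := _^-1 in H.
have k0 : 0 < kappa by rewrite invr_gt0 !mulr_gt0.
have {}H : X * (kappa + Y) <= kappa * Y.
  rewrite -(@ler_pM2r _ (kappa + Y)) ?addr_gt0// -mulrA -expr2//.
have kE : kappa * (2 * lam * h) = 1 by rewrite mulVf// gt_eqF// !mulr_gt0.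
have H2 : 2 * lam * h * X * Y <= Y - X.
  have : (X * (kappa + Y)) * (2 * lam * h) <= (kappa * Y) * (2 * lam * h).
    by rewrite ler_wpM2r// ltW// !mulr_gt0.
  have -> : kappa * Y * (2 * lam * h) = (kappa * (2 * lam * h)) * Y by ring.
  have -> : X * (kappa + Y) * (2 * lam * h) = X * (kappa * (2 * lam * h)) + 2 * lam * h * X * Y by ring.
  by rewrite kE; clear; lra.
have W1 : v - F1 = A1 * Y by rewrite vY; ring.
have X2 : v - F2 <= A2 * X by rewrite lerBlDr.
have c0 : 0 < 2 * lam * h by rewrite !mulr_gt0.
(* multiply [H2] by [A1 * A2] *)
have H3 : (2 * lam * h) * (v - F1) * (A2 * X) <= A2 * (v - F1) - A1 * (A2 * X).
  rewrite W1.
  have -> : (2 * lam * h) * (A1 * Y) * (A2 * X) = (A1 * A2) * (2 * lam * h * X * Y) by ring.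
  have -> : A2 * (A1 * Y) - A1 * (A2 * X) = (A1 * A2) * (Y - X) by ring.
  by rewrite ler_wpM2l// ltW// mulr_gt0.
have v1p : 0 < v - F1 by clear -v1 L0; lra.
have H4 : (2 * lam * h) * (v - F1) * (v - F2) <= A2 * (v - F1) - A1 * (v - F2).
  have : (2 * lam * h) * (v - F1) * (v - F2) <= (2 * lam * h) * (v - F1) * (A2 * X).
    by rewrite ler_wpM2l// ltW// mulr_gt0.
  have : A1 * (v - F2) <= A1 * (A2 * X) by rewrite ler_wpM2l// ltW.
  move: H3; clear; lra.
have H5 : A2 * (v - F1) - A1 * (v - F2) <= 6 * Lam * L ^+ 2 * h.
  have -> : A2 * (v - F1) - A1 * (v - F2) = (A2 - A1) * (v - F1) + A1 * (F2 - F1) by ring.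
  have i1 : (A2 - A1) * (v - F1) <= (2 * Lam * L * h) * (2 * L).
    apply: le_trans (ler_norm _) _; rewrite normrM distrC.
    by apply: ler_pM => //; rewrite gtr0_norm.
  have i2 : A1 * (F2 - F1) <= L * (2 * Lam * L * h).
    apply: le_trans (ler_norm _) _; rewrite normrM (distrC F2).
    by apply: ler_pM => //; rewrite gtr0_norm// (le_trans A1M).
  rewrite (_ : 6 * Lam * L ^+ 2 * h = (2 * Lam * L * h) * (2 * L) + L * (2 * Lam * L * h)).
    exact: lerD.
  by ring.
have H6 : lam * h * L ^+ 2 / 2 <= (2 * lam * h) * (v - F1) * (v - F2).
  rewrite -[leRHS]mulrA (_ : lam * h * L ^+ 2 / 2 = (2 * lam * h) * ((L / 2) * (L / 2))).
    2: by field.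
  by apply: ler_wpM2l; [exact: ltW|apply: ler_pM => //; clear -L0; lra].
have : (lam / 2 - 6 * Lam) * (h * L ^+ 2) <= 0.
  move: (le_trans H6 (le_trans H4 H5)); rewrite -subr_le0; congr (_ <= 0); by field.
rewrite leNgt mulr_gt0//; first by clear -lamL; lra.
by rewrite mulr_gt0 ?exprn_gt0.
Qed.

(** The left side is largest at $|d|=2\lambda hN$: the penalty absorbs a displacement with slope [N]
    at a cost proportional to [h]. *)
Lemma young_slope (lam N h d : R) : 0 < lam -> 0 < h ->
  N * `|d| - (2 * lam * h)^-1 / 2 * d ^+ 2 <= lam * N ^+ 2 * h.
Proof.
move=> lam0 h0; have c0 : 0 < 4 * lam * h by rewrite !mulr_gt0.
rewrite -subr_ge0 -(pmulr_rge0 _ c0).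
have -> : 4 * lam * h * (lam * N ^+ 2 * h - (N * `|d| - (2 * lam * h)^-1 / 2 * d ^+ 2)) =
    (2 * lam * h * N - `|d|) ^+ 2 + (d ^+ 2 - `|d| ^+ 2).
  by field; rewrite !gt_eqF.
by rewrite real_normK ?num_real// subrr addr0 sqr_ge0.
Qed.

(** The penalty is $(y-x)^2/(4\lambda h)$, the Hopf-Lax kernel of the Hamiltonian $\lambda p^2$. It
    is of order [h] when the points are at distance of order [h], and minus its derivative in [h] is
    $\lambda p^2$ with $p=(y-x)/(2\lambda h)$. *)
Definition doubled (lam : R) (U : R -> R -> R) (s h x y : R) : R :=
  U s y - U (s - h) x - (2 * lam * h)^-1 / 2 * (y - x) ^+ 2.

Lemma doubled_continuous l (ta tau eps del lam : R) (U : R -> R -> R) C :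
  ta <= tau -> 0 <= l -> 0 <= C -> lip2 l ta tau U C -> 0 < lam ->
  0 < eps -> eps <= del ->
  continuous (fun p : R * R * R * R =>
    U (clamp ta tau p.1.1.1) (clamp (- l) l p.2)
    - U (clamp ta tau (p.1.1.1 - p.1.1.2)) (clamp (- l) l p.1.2)
    - (2 * lam * clamp eps del p.1.1.2)^-1 / 2 * (p.2 - p.1.2) ^+ 2).
Proof.
move=> t01 l0 C0 UC lam0 eps0 epsdel.
pose cU (p : R * R) := U (clamp ta tau p.1) (clamp (- l) l p.2).
have ccU : continuous cU := lip2_continuous t01 l0 C0 UC.
have c1 : continuous (fun p : R * R * R * R => p.1) by move=> p; exact: cvg_fst.
have c2 : continuous (fun p : R * R * R * R => p.2) by move=> p; exact: cvg_snd.
have c11 : continuous (fun p : R * R * R * R => p.1.1).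
  by move=> p; apply: (continuous_comp (c1 p)); exact: cvg_fst.
have c12 : continuous (fun p : R * R * R * R => p.1.2).
  by move=> p; apply: (continuous_comp (c1 p)); exact: cvg_snd.
have c111 : continuous (fun p : R * R * R * R => p.1.1.1).
  by move=> p; apply: (continuous_comp (c11 p)); exact: cvg_fst.
have c112 : continuous (fun p : R * R * R * R => p.1.1.2).
  by move=> p; apply: (continuous_comp (c11 p)); exact: cvg_snd.
have ct : continuous (fun p : R * R * R * R => p.1.1.1 - p.1.1.2).
  by move=> p; apply: cvgB; [exact: c111|exact: c112].
have cd : continuous (fun p : R * R * R * R => p.2 - p.1.2).
  by move=> p; apply: cvgB; [exact: c2|exact: c12].
move=> p; apply: cvgB; first apply: cvgB.
- exact: (@continuous_comp _ _ _ (fun p : R * R * R * R => (p.1.1.1, p.2)) cU p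
      (cvg_pair (c111 p) (c2 p)) (ccU _)).
- exact: (@continuous_comp _ _ _
      (fun p : R * R * R * R => (p.1.1.1 - p.1.1.2, p.1.2)) cU p
      (cvg_pair (ct p) (c12 p)) (ccU _)).
- apply: cvgM; last exact: (continuous_comp (cd p) (@exprn_continuous _ 2 _)).
  apply: cvgM; last exact: cvg_cst.
  apply: cvgV.
    have /andP[h _] := clamp_bounds p.1.1.2 epsdel.
    by rewrite gt_eqF// !mulr_gt0// (lt_le_trans eps0).
  apply: cvgM; first exact: cvg_cst.
  exact: (continuous_comp (c112 p) (@clamp_continuous _ _ _ _)).
Qed.

End TimeLipschitz.

(** * The maximum of the doubled function and the descent on its constant *)

Section TimeLipschitzStep.
Context {R : realType}.
Implicit Types (U Ut Ux Uxx A F : R -> R -> R) (h s t x y : R).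

(** [dd_lip] compares the coefficients only at points of equal slope, which is what a maximum of
    [doubled] provides; their dependence on the gradient therefore never appears. [dd_t1] leaves
    room for the shifted time $s-h$ above [ta]. *)
Record doubling_data (l ta t1 tau del N M Cb C0 Lam AM FM : R) U Ut Ux Uxx A F : Prop :=
  DoublingData {
  dd_l : 0 < l ;
  dd_del : 0 < del ;
  dd_t1 : ta + del < t1 <= tau ;
  dd_N : 0 <= N ;
  dd_Lam : 0 <= Lam ;
  dd_cl : classical l ta tau U Ut Ux Uxx ;
  dd_M : forall t x, ta <= t <= tau -> - l <= x <= l -> `|U t x| <= M ;
  dd_slope : forall t x y, ta <= t <= tau -> - l <= x <= l -> - l <= y <= l ->
    `|U t x - U t y| <= N * `|x - y| ;
  dd_Ux : forall t x, ta < t <= tau -> - l < x < l -> `|Ux t x| <= N ;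
  dd_bdry : forall s t, ta <= s <= tau -> ta <= t <= tau ->
    `|U s l - U t l| <= Cb * `|s - t| /\ `|U s (- l) - U t (- l)| <= Cb * `|s - t| ;
  dd_init : forall s t x, ta <= s <= t1 -> ta <= t <= t1 -> - l <= x <= l ->
    `|U s x - U t x| <= C0 * `|s - t| ;
  dd_eq : forall t x, ta < t <= tau -> - l < x < l ->
    [/\ Ut t x = A t x * Uxx t x + F t x, 0 < A t x <= AM & `|F t x| <= FM] ;
  dd_lip : forall t s x y, ta < t <= tau -> ta < s <= tau -> - l < x < l -> - l < y < l ->
    Ux t x = Ux s y ->
    `|A t x - A s y| <= Lam * (`|t - s| + `|x - y| + `|U t x - U s y|) /\
    `|F t x - F s y| <= Lam * (`|t - s| + `|x - y| + `|U t x - U s y|) }.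

(** On each face a Lipschitz bound in time is already known: from $|U|\le M$ when $h=del$, from
    [dd_init] when $s=t_1$, from [dd_bdry] when one point lies on the lateral boundary. In the last
    two cases the slope bound [N] first brings the two points together, and [young_slope] pays for
    it. *)
Lemma doubling_lateral l (ta t1 tau del N M Cb C0 Lam AM FM : R) U Ut Ux Uxx A F
    (lam L s h x y : R) :
  doubling_data l ta t1 tau del N M Cb C0 Lam AM FM U Ut Ux Uxx A F ->
  0 < lam -> Cb + lam * N ^+ 2 <= L -> C0 + lam * N ^+ 2 <= L -> 2 * M <= L * del ->
  t1 <= s <= tau -> 0 < h <= del -> - l <= x <= l -> - l <= y <= l ->
  [|| h == del, s == t1, x == l, x == - l, y == l | y == - l] ->
  doubled lam U s h x y <= L * h.
Proof.
move=> [l0 del0 /andP[tad t1tau] N0 _ _ UM Us _ Ub U0 _ _] lam0 LCb LC0 LM.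
move=> /andP[t1s stau] /andP[h0 hdel] xl yl bd.
have ss : ta <= s <= tau.
  by rewrite stau andbT; clear -tad t1s del0; lra.
have tt : ta <= s - h <= tau by clear -t1s stau tad hdel h0; lra.
have hE : `|s - (s - h)| = h by rewrite opprB addrC subrK gtr0_norm.
have ll : - l <= l <= l by clear -l0; lra.
have ll' : - l <= - l <= l by clear -l0; lra.
have core C : C + lam * N ^+ 2 <= L ->
    U s y - U (s - h) x <= C * h + N * `|y - x| -> doubled lam U s h x y <= L * h.
  move=> CL H; have := young_slope N (y - x) lam0 h0.
  have : (C + lam * N ^+ 2) * h <= L * h by rewrite ler_wpM2r// ltW.
  by rewrite /doubled; move: H; set k := _ / 2 * _; clear; lra.
have viax C : `|U s x - U (s - h) x| <= C * h ->
    U s y - U (s - h) x <= C * h + N * `|y - x|.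
  have := Us s y x ss yl xl; rewrite !ler_norml.
  by clear; lra.
have viay C : `|U s y - U (s - h) y| <= C * h ->
    U s y - U (s - h) x <= C * h + N * `|y - x|.
  have := Us (s - h) y x tt yl xl; rewrite !ler_norml.
  by clear; lra.
have [bl bl'] := Ub s (s - h) ss tt; rewrite hE in bl bl'.
have /orP[/eqP hd|/or4P[/eqP st|/eqP xE|/eqP xE|/orP[] /eqP yE]] := bd.
- have k0 : 0 <= (2 * lam * h)^-1 / 2 * (y - x) ^+ 2.
    by rewrite mulr_ge0 ?sqr_ge0// divr_ge0 ?invr_ge0// ltW// !mulr_gt0.
  have := UM s y ss yl; have := UM (s - h) x tt xl; rewrite /doubled !ler_norml.
  by move: k0 LM; rewrite hd; set k := _ / 2 * _; clear; lra.
- apply: (core C0) => //; apply: viax; rewrite -[in leRHS]hE; apply: U0 => //.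
    by rewrite st lexx andbT; clear -tad del0; lra.
  by rewrite st; clear -tad hdel h0; lra.
- by apply: (core Cb) => //; apply: viax; rewrite xE.
- by apply: (core Cb) => //; apply: viax; rewrite xE.
- by apply: (core Cb) => //; apply: viay; rewrite yE.
- by apply: (core Cb) => //; apply: viay; rewrite yE.
Qed.

(* One step of a descent on the constant: the bound with [L + 1] controls the oscillation of [U]
   between the two points where [doubled - L h] is maximal. *)
Lemma doubling_step l (ta t1 tau del N M Cb C0 Lam AM FM : R) U Ut Ux Uxx A F
    (lam L : R) :
  doubling_data l ta t1 tau del N M Cb C0 Lam AM FM U Ut Ux Uxx A F ->
  12 * Lam < lam -> 0 < L -> Cb + lam * N ^+ 2 <= L -> C0 + lam * N ^+ 2 <= L ->
  2 * M <= L * del -> 2 + 2 * lam * N + lam * N ^+ 2 <= L ->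
  lam * N ^+ 2 + FM <= L / 2 -> AM <= L ->
  (forall s h x y, t1 <= s <= tau -> 0 < h <= del -> - l <= x <= l -> - l <= y <= l ->
    doubled lam U s h x y <= (L + 1) * h) ->
  forall s h x y, t1 <= s <= tau -> 0 < h <= del -> - l <= x <= l -> - l <= y <= l ->
    doubled lam U s h x y <= L * h.
Proof.
move=> dd lamL L0 LCb LC0 LM Lp LF LA IH s1 h1 x1 y1 ss1 hh1 xx1 yy1.
have [l0 del0 /andP[tad t1tau] N0 Lam0 [[C Cp UC] Ht Hx Hxx] UM Us HUx Ub U0 Heq Hlip] := dd.
have lam0 : 0 < lam by clear -lamL Lam0; lra.
rewrite leNgt; apply/negP => gt1.
pose eta := doubled lam U s1 h1 x1 y1 - L * h1.
have eta0 : 0 < eta by rewrite subr_gt0.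
have etah : eta <= h1 by have := IH _ _ _ _ ss1 hh1 xx1 yy1; rewrite /eta; clear; lra.
(* The penalty is singular at $h=0$. By [IH] the excess [doubled - L * h] is at most [h], so
   wherever it reaches [eta] one has $h\ge eta>eps$; restricting to $h\ge eps$ thus loses nothing
   and creates no maximum at the new end. *)
pose eps := eta / 2.
have eps0 : 0 < eps by rewrite divr_gt0.
have epsh : eps < h1 by rewrite /eps; clear -etah eta0; lra.
have hh1' : eps <= h1 <= del by rewrite ltW//; case/andP: hh1.
have epsdel : eps <= del by case/andP: hh1' => a b; exact: le_trans b.
pose G (p : R * R * R * R) := U (clamp ta tau p.1.1.1) (clamp (- l) l p.2)
    - U (clamp ta tau (p.1.1.1 - p.1.1.2)) (clamp (- l) l p.1.2)
    - (2 * lam * clamp eps del p.1.1.2)^-1 / 2 * (p.2 - p.1.2) ^+ 2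
    - L * clamp eps del p.1.1.2.
have tatau : ta <= tau by clear -tad t1tau del0; lra.
have cG : continuous G.
  move=> p; apply: cvgB; first exact: (doubled_continuous tatau (ltW l0) Cp UC lam0 eps0 epsdel).
  apply: cvgM; first exact: cvg_cst.
  have c1 : continuous (fun p : R * R * R * R => p.1) by move=> q; exact: cvg_fst.
  have c11 : continuous (fun p : R * R * R * R => p.1.1).
    by move=> q; apply: (continuous_comp (c1 q)); exact: cvg_fst.
  have c112 : continuous (fun p : R * R * R * R => p.1.1.2).
    by move=> q; apply: (continuous_comp (c11 q)); exact: cvg_snd.
  exact: (continuous_comp (c112 p) (@clamp_continuous _ _ _ _)).
have tin s h : t1 <= s <= tau -> eps <= h <= del -> ta <= s <= tau /\ ta <= s - h <= tau.
  by move=> /andP[a b] /andP[c d]; split; apply/andP; split; clear -a b c d tad del0 eps0; lra.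
have GE s h x y : t1 <= s <= tau -> eps <= h <= del -> - l <= x <= l -> - l <= y <= l ->
    G (s, h, x, y) = doubled lam U s h x y - L * h.
  by move=> ss hh xx yy; have [a b] := tin s h ss hh; rewrite /G/doubled/= !clamp_id.
pose B := `[t1, tau] `*` `[eps, del] `*` `[- l, l] `*` `[- l, l].
have inB s h x y : t1 <= s <= tau -> eps <= h <= del -> - l <= x <= l -> - l <= y <= l ->
    B (s, h, x, y).
  by move=> *; rewrite /B/= !in_itv.
have cB : compact B.
  exact: (compact_setX (compact_setX (compact_setX (@segment_compact _ _ _)
    (@segment_compact _ _ _)) (@segment_compact _ _ _)) (@segment_compact _ _ _)).
have [[[[s h] x] y] [[[/= ss hh] xl] yl] Gmax] :=
  compact_max (ex_intro _ _ (inB _ _ _ _ ss1 hh1' xx1 yy1)) cB cG.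
rewrite /= !in_itv/= in ss hh xl yl.
have pos : eta <= doubled lam U s h x y - L * h.
  by rewrite -GE// /eta -GE//; apply: Gmax; exact: inB.
have {}Gmax s' h' x' y' : t1 <= s' <= tau -> eps <= h' <= del -> - l <= x' <= l ->
    - l <= y' <= l -> doubled lam U s' h' x' y' - L * h' <= doubled lam U s h x y - L * h.
  by move=> *; rewrite -!GE//; apply: Gmax; exact: inB.
clear cG GE inB cB G B.
have h0 : 0 < h by case/andP: hh => a _; exact: lt_le_trans a.
have hh' : 0 < h <= del by rewrite h0; case/andP: hh.
have interior : ~~ [|| h == del, s == t1, x == l, x == - l, y == l | y == - l].
  apply/negP => /(doubling_lateral dd lam0 LCb LC0 LM ss hh' xl yl).
  by move: pos eta0; clear; lra.
move: interior; rewrite !negb_or => /and5P[hd st xl1 xl2 /andP[yl1 yl2]].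
have Th : doubled lam U s h x y <= (L + 1) * h by exact: IH.
have epslt : eps < h.
  by move: pos Th eta0; rewrite /eps; clear; lra.
have hlt : h < del by rewrite lt_neqAle hd; case/andP: hh.
have t1s : t1 < s by rewrite lt_neqAle eq_sym st; case/andP: ss.
have xI : - l < x < l by rewrite !lt_neqAle eq_sym xl1 xl2.
have yI : - l < y < l by rewrite !lt_neqAle eq_sym yl1 yl2.
have [ssa tta] := tin s h ss hh.
have sI : ta < s <= tau by case/andP: ss => _ ->; rewrite andbT; clear -tad t1s del0; lra.
have tI : ta < s - h <= tau by case/andP: tta => _ ->; rewrite andbT; clear -tad t1s hlt; lra.
clear xl1 xl2 yl1 yl2 hd st.
have [p1 p2 hess] : [/\ Ux s y = (2 * lam * h)^-1 * (y - x),
    Ux (s - h) x = (2 * lam * h)^-1 * (y - x) &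
    Uxx s y * ((2 * lam * h)^-1 + Uxx (s - h) x) ^+ 2 <=
    (2 * lam * h)^-1 * Uxx (s - h) x * ((2 * lam * h)^-1 + Uxx (s - h) x)].
  apply: (@doubled_max_hessian _ l (U s) (U (s - h))) => //; try exact: Hxx.
  by move=> x' y' xx yy; have := Gmax s h x' y' ss hh xx yy; rewrite /doubled; clear; lra.
pose v := Ut (s - h) x.
(* Variation of [s] with [h] fixed. Since [s] may be the final time, only an inequality results. *)
have vs : v <= Ut s y.
  have T1 : taylor1 `[t1, tau] (U ^~ y) s (Ut s y).
    by apply: taylor1_sub (Ht _ _ sI yl) => z; rewrite /= !in_itv/= => /andP[a ->];
      rewrite andbT; clear -a tad del0; lra.
  have T2 : taylor1 `[t1, tau] (fun z => U (1 * z + (- h)) x) s (1 * v).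
    apply: (@taylor1_reparam _ `[ta, tau] _ (U ^~ x)); first by rewrite expr1n.
      by move=> z; rewrite /= !in_itv/= mul1r => zz; have [_] := tin z h zz hh.
    by rewrite mul1r; exact: Ht.
  have T := taylor1D T1 (taylor1Z (-1) T2).
  have : 0 <= Ut s y + (-1) * (1 * v).
    apply: (@taylor1_max_left _ _ _ _ _ t1 t1s _ T) => z /andP[z1 z2].
    have zz : t1 <= z <= tau by rewrite z1 (le_trans z2)//; case/andP: ss.
    split; first by rewrite /= in_itv.
    by have := Gmax z h x y zz hh xl yl; rewrite !mul1r /doubled; clear; lra.
  by clear; lra.
(* Variation of [h], which is interior on both sides: the derivative in [h] vanishes and determines
   [v] exactly. This places [v] at the scale of [L]. *)
have vh : v = L - lam * (Ux s y) ^+ 2.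
  have T1 : taylor1 `[eps, del] (fun z => U ((-1) * z + s) x) h ((-1) * v).
    apply: (@taylor1_reparam _ `[ta, tau] _ (U ^~ x)); first by rewrite sqrrN expr1n.
      move=> z; rewrite /= !in_itv/= mulN1r addrC => zz.
      by have [_] := tin s z ss zz.
    by rewrite mulN1r addrC; exact: Ht.
  pose k := (y - x) ^+ 2 / (4 * lam).
  have T2 : taylor1 `[eps, del] (fun z => k * z^-1) h (k * (- (h ^- 2) *: 1)).
    apply: taylor1Z; apply: is_derive_taylor1.
    by apply: is_deriveV; rewrite gt_eqF.
  have T3 : taylor1 `[eps, del] (fun z => L * z) h L.
    by apply: taylor1_affine => z _; ring.
  have T := taylor1D (taylor1D (taylor1Z (-1) T1) (taylor1Z (-1) T2)) (taylor1Z (-1) T3).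
  have le_h z : eps <= z <= del -> (-1) * U ((-1) * z + s) x + (-1) * (k * z^-1) + (-1) * (L * z)
     <= (-1) * U ((-1) * h + s) x + (-1) * (k * h^-1) + (-1) * (L * h).
    move=> zz; have := Gmax s z x y ss zz xl yl; rewrite /doubled.
    have E w : 0 < w -> (2 * lam * w)^-1 / 2 * (y - x) ^+ 2 = k * w^-1.
      by move=> w0; rewrite /k; field; rewrite !gt_eqF.
    rewrite !E//; last by case/andP: zz => a _; exact: lt_le_trans a.
    by rewrite !mulN1r ![- _ + s]addrC; clear; lra.
  have D0 : (-1) * ((-1) * v) + (-1) * (k * (- (h ^- 2) *: 1)) + (-1) * L = 0.
    apply/eqP; rewrite eq_le; apply/andP; split.
      apply: (@taylor1_max_right _ _ _ _ _ del hlt _ T) => z /andP[z1 z2].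
      have zz : eps <= z <= del by rewrite z2 andbT (le_trans _ z1)// ltW.
      by split; [rewrite /= in_itv|exact: le_h].
    apply: (@taylor1_max_left _ _ _ _ _ eps epslt _ T) => z /andP[z1 z2].
    have zz : eps <= z <= del by rewrite z1 (le_trans z2)// ltW.
    by split; [rewrite /= in_itv|exact: le_h].
  have -> : lam * Ux s y ^+ 2 = k / h ^+ 2.
    by rewrite p1 /k; field; rewrite !gt_eqF.
  by move: D0; rewrite /GRing.scale/= mulr1; clear; lra.
have pN : `|Ux s y| <= N by exact: HUx.
have p2N : lam * Ux s y ^+ 2 <= lam * N ^+ 2.
  rewrite ler_wpM2l ?(ltW lam0)// -[X in X <= _]real_normK ?num_real//.
  by rewrite ler_pXn2r// ?nnegrE.
have Up : Ux (s - h) x = Ux s y by rewrite p1 p2.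
have [lA lF] := Hlip _ _ _ _ tI sI xI yI Up.
(* The slope formula gives $|x-y|=2\lambda h|p|$, and the bound with [L + 1] controls the increment
   of [U]; the lower bound on [L] in [Lp] absorbs all terms that are not multiples of [L]. *)
have dist : `|s - h - s| + `|x - y| + `|U (s - h) x - U s y| <= 2 * L * h.
  have d1 : `|s - h - s| = h by rewrite addrAC subrr sub0r normrN gtr0_norm.
  have d2 : `|x - y| <= 2 * lam * N * h.
    have -> : x - y = - (2 * lam * h * Ux s y) by rewrite p1; field; rewrite !gt_eqF.
    rewrite normrN normrM gtr0_norm ?mulr_gt0// -!mulrA ler_wpM2l// ler_wpM2l ?(ltW lam0)//.
    by rewrite mulrC ler_wpM2r// ltW.
  have d3 : U s y - U (s - h) x <= (1 + L + lam * N ^+ 2) * h.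
    have : (2 * lam * h)^-1 / 2 * (y - x) ^+ 2 <= lam * N ^+ 2 * h.
      have -> : (2 * lam * h)^-1 / 2 * (y - x) ^+ 2 = lam * Ux s y ^+ 2 * h.
        by rewrite p1; field; rewrite !gt_eqF.
      by rewrite ler_wpM2r// ltW.
    by move: Th; rewrite /doubled; set k := _ / 2 * _; clear; lra.
  have d4 : 0 <= U s y - U (s - h) x.
    have : 0 <= (2 * lam * h)^-1 / 2 * (y - x) ^+ 2.
      by rewrite mulr_ge0 ?sqr_ge0// divr_ge0// invr_ge0 ltW// !mulr_gt0.
    have : 0 < L * h by rewrite mulr_gt0.
    by move: pos eta0; rewrite /doubled; set k := _ / 2 * _; clear; lra.
  rewrite d1 (distrC (U _ _)) (ger0_norm d4).
  have : (2 + 2 * lam * N + lam * N ^+ 2) * h <= L * h by rewrite ler_wpM2r// ltW.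
  by move: d2 d3; clear; lra.
have [e1 /andP[A1 A1M] F1] := Heq _ _ tI xI.
have [e2 /andP[A2 A2M] F2] := Heq _ _ sI yI.
have bnd f : f <= Lam * (`|s - h - s| + `|x - y| + `|U (s - h) x - U s y|) ->
    f <= 2 * Lam * L * h.
  move=> fl; apply: le_trans fl _; rewrite -mulrA.
  rewrite (_ : 2 * Lam * (L * h) = Lam * (2 * L * h)); last by ring.
  by rewrite ler_wpM2l.
have {}Fv f : `|f| <= FM -> L / 2 <= v - f <= 2 * L.
  rewrite vh ler_norml; have := sqr_ge0 (Ux s y) => q /andP[f1 f2].
  have q' : 0 <= lam * Ux s y ^+ 2 by rewrite mulr_ge0// ltW.
  have q2 : 0 <= lam * N ^+ 2 by rewrite mulr_ge0 ?sqr_ge0// ltW.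
  by apply/andP; split; clear -f1 f2 q' q2 p2N LF L0; lra.
have /andP[g1 g2] := Fv _ F1; have /andP[g3 _] := Fv _ F2.
apply: (@doubling_contradiction _ lam h L Lam AM (A (s - h) x) (A s y) (F (s - h) x)
  (F s y) v (Uxx s y) (Uxx (s - h) x)) => //.
- by rewrite A1.
- by rewrite g1.
- exact: bnd.
- exact: bnd.
- by rewrite -e2.
Qed.

(** The Lipschitz constant of [U] in [dd_cl] is finite but uncontrolled. It yields the bound with
    $L+n$ for some [n], and $n$ applications of [doubling_step] bring it down to [L], in which that
    constant does not occur. The conclusion is the case $x=y$. *)
Lemma time_lipschitz_above l (ta t1 tau del N M Cb C0 Lam AM FM : R) U Ut Ux Uxx A F
    (lam L : R) :
  doubling_data l ta t1 tau del N M Cb C0 Lam AM FM U Ut Ux Uxx A F ->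
  12 * Lam < lam -> 0 < L -> Cb + lam * N ^+ 2 <= L -> C0 + lam * N ^+ 2 <= L ->
  2 * M <= L * del -> 2 + 2 * lam * N + lam * N ^+ 2 <= L ->
  lam * N ^+ 2 + FM <= L / 2 -> AM <= L ->
  forall s h x, t1 <= s <= tau -> 0 < h <= del -> - l <= x <= l ->
    U s x - U (s - h) x <= L * h.
Proof.
move=> dd lamL L0 LCb LC0 LM Lp LF LA.
have [l0 del0 /andP[tad t1tau] N0 Lam0 [[C Cp UC] _ _ _] _ Us _ _ _ _ _] := dd.
have lam0 : 0 < lam by clear -lamL Lam0; lra.
pose P (k : R) := forall s h x y, t1 <= s <= tau -> 0 < h <= del -> - l <= x <= l ->
  - l <= y <= l -> doubled lam U s h x y <= k * h.
suff PL : P L.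
  move=> s h x ss hh xl; have := PL s h x x ss hh xl xl.
  by rewrite /doubled subrr expr0n/= mulr0 subr0.
have step n : P (L + n%:R + 1) -> P (L + n%:R).
  move=> H; have n0 : 0 <= n%:R :> R by rewrite ler0n.
  apply: (doubling_step dd lamL) => //; try (by clear -L0 n0 LCb LC0 Lp LF LA; lra).
  by rewrite [leRHS]mulrDl; apply: (le_trans LM); rewrite lerDl mulr_ge0// ltW.
(* [young_slope] turns the Lipschitz constant [C] in time and the slope [N] into $C+\lambda N^2$. *)
have base : exists n, P (L + n%:R).
  pose m := (Num.bound (C + lam * N ^+ 2)).
  exists m => s h x y ss /andP[h0 hdel] xl yl.
  have ssa : ta <= s <= tau by case/andP: ss => a ->; rewrite andbT; clear -a tad del0; lra.
  have tta : ta <= s - h <= tau by move: ss => /andP[a b]; clear -a b tad hdel h0; lra.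
  have hE : `|s - (s - h)| = h by rewrite opprB addrC subrK gtr0_norm.
  have := UC s (s - h) x x ssa tta xl xl; rewrite hE subrr normr0 addr0 => H1.
  have H2 := Us s y x ssa yl xl.
  have := young_slope N (y - x) lam0 h0.
  have : (C + lam * N ^+ 2) * h <= (L + m%:R) * h.
    apply: ler_wpM2r; first exact: ltW.
    apply/ltW/(lt_le_trans (archi_boundP _)).
      by rewrite addr_ge0// mulr_ge0 ?sqr_ge0// ltW.
    by rewrite lerDr ltW.
  rewrite /doubled; set k := _ / 2 * _; move: H1 H2; rewrite !ler_norml.
  by clear; lra.
have [n] := base; elim: n => [|n IH]; first by rewrite addr0.
by rewrite -natr1 addrA => /step.
Qed.

End TimeLipschitzStep.

(** * Hoelder estimates for linear evolutions *)

Section HolderBarriers.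
Context {R : realType}.
Implicit Types (al d p x y z : R).

Lemma powR_within_continuous (K al d0 : R) : 0 < al -> 0 < d0 ->
  {within `[0, d0], continuous (fun d => K * d `^ al)}.
Proof.
move=> al0 d00.
have c d : 0 < d -> {for d, continuous (fun d : R => K * d `^ al)}.
  move=> dgt; apply: cvgM; first exact: cvg_cst.
  exact: is_derive_continuous (is_derive1_powR al dgt).
apply/continuous_within_itvP => //; split.
- by move=> d; rewrite in_itv/= => /andP[? _]; exact: c.
- rewrite powR0 ?gt_eqF// mulr0; have := cvgM (@cvg_cst _ K _ _ _) (powR_cvg0 al0).
  by rewrite mulr0; apply.
- exact: cvg_at_left_filter (c _ d00).
Qed.

Lemma powR_taylor2 (K al d0 d : R) : 0 < d ->
  taylor2 `[0, d0] (fun d => K * d `^ al) d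
    (K * al * d `^ (al - 1)) (- (K * al * d `^ (al - 1) * (1 - al) / d)).
Proof.
move=> dgt; pose g x := K * al * x `^ (al - 1).
have dg : is_derive d 1 g (- (K * al * d `^ (al - 1) * (1 - al) / d)).
  have D := is_derive1_powR (al - 1) dgt.
  rewrite /g (_ : (fun _ => _) = (K * al) *: ((@powR R) ^~ (al - 1))); last exact/funext.
  apply: is_derive_eq; rewrite /GRing.scale/=.
  have -> : d `^ (al - 1 - 1) = d `^ (al - 1) / d.
    rewrite powRB; first by rewrite powRr1// ltW.
    by apply/implyP => _; rewrite gt_eqF.
  by field; rewrite gt_eqF.
apply: (@is_derive_taylor2 _ _ _ g d _ d dgt _ dg) => y yd.
have y0 : 0 < y by move: yd; rewrite ltr_norml; clear; lra.
have D := is_derive1_powR al y0.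
rewrite /g (_ : (fun _ => _) = K *: ((@powR R) ^~ al)); last exact/funext.
by apply: is_derive_eq; rewrite /GRing.scale/= mulrA.
Qed.

(* [v] behaves like a solution of v_t = A v_xx + B v_x + F with bounded B, F,
   and of v_t = -+ b v_x + F at [x = +-l]. *)
Record linear_evolution (l t0 t1 c AM B M : R) (v vt vx vxx : R -> R -> R) : Prop :=
  LinearEvolution {
  lev_cl : classical l t0 t1 v vt vx vxx ;
  lev_bnd : forall t x, t0 <= t <= t1 -> - l <= x <= l -> `|v t x| <= M ;
  lev_int : forall t x, t0 < t <= t1 -> - l < x < l ->
    exists2 A, c <= A <= AM & `|vt t x - A * vxx t x| <= B * (1 + `|vx t x|) ;
  lev_bdr : forall t, t0 < t <= t1 ->
    exists2 b, c <= b & `|vt t l + b * vx t l| <= B ;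
  lev_bdl : forall t, t0 < t <= t1 ->
    exists2 b, c <= b & `|vt t (- l) - b * vx t (- l)| <= B }.

Lemma linear_evolutionN l t0 t1 c AM B M (v vt vx vxx : R -> R -> R) :
  linear_evolution l t0 t1 c AM B M v vt vx vxx ->
  linear_evolution l t0 t1 c AM B M (fun t x => - v t x) (fun t x => - vt t x)
    (fun t x => - vx t x) (fun t x => - vxx t x).
Proof.
case=> cl bnd int bdr bdl; split.
- exact: classicalN.
- by move=> t x *; rewrite normrN; exact: bnd.
- move=> t x tt xl; have [A Ac H] := int t x tt xl; exists A => //.
  by rewrite normrN mulrN -opprD normrN.
- move=> t tt; have [b bc H] := bdr t tt; exists b => //.
  by rewrite mulrN -opprD normrN.
- move=> t tt; have [b bc H] := bdl t tt; exists b => //.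
  by rewrite mulrN -opprD normrN.
Qed.

(** For $om(d)=Kd^{al}$ with slope [p], the concavity $-om''=p(1-al)/d$ beats the lower-order terms
    $B(1+p)$ at short distance: this is the smallness of [d0]. At the ends, $p\ge K\,al\ge B/c$
    makes the boundary condition give [vt] the right sign. Beyond [d0] the sup bound [M]
    suffices. *)
Lemma space_holder_above l (t0 t1 c AM B M H al K d0 : R) (v vt vx vxx : R -> R -> R) :
  0 < l -> t0 <= t1 -> 0 < c -> 0 <= B -> 0 < al < 1 -> 0 < d0 <= 1 ->
  2 * B * d0 <= c * (1 - al) -> 1 <= K * al -> B <= c * (K * al) ->
  2 * M <= K * d0 `^ al -> H <= K ->
  linear_evolution l t0 t1 c AM B M v vt vx vxx ->
  (forall x y, - l <= x <= l -> - l <= y <= l ->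
     `|v t0 x - v t0 y| <= H * `|x - y| `^ al) ->
  forall t x y, t0 <= t <= t1 -> - l <= x <= l -> - l <= y <= l ->
    y <= x -> v t x - v t y <= K * (x - y) `^ al.
Proof.
move=> l0 t01 c0 B0 /andP[al0 al1] /andP[d00 d01] Bd0 Kal BK MK HK [cl bnd int bdr bdl] init.
have K0 : 0 <= K by rewrite -(pmulr_lge0 _ al0) (le_trans ler01).
have far t x y : t0 <= t <= t1 -> - l <= x <= l -> - l <= y <= l ->
    v t x - v t y <= K * d0 `^ al.
  move=> tt xl yl; have := bnd t x tt xl; have := bnd t y tt yl.
  by rewrite !ler_norml; clear -MK; lra.
move=> t x y tt xl yl yx.
have [d0xy|xyd0] := leP d0 (x - y).
  apply: (le_trans (far _ _ _ tt xl yl)); rewrite ler_wpM2l//.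
  by apply: ge0_ler_powR => //; rewrite ?nnegrE ?subr_ge0// ltW.
pose p d := K * al * d `^ (al - 1).
have p1 d : 0 < d < d0 -> K * al <= p d.
  move=> /andP[dgt dlt]; rewrite /p ler_peMr// ?(le_trans ler01)//.
  rewrite -[leLHS](powRr0 d); apply: ger_powR; last by clear -al1; lra.
  by rewrite dgt (le_trans (ltW dlt)).
(* As $d<1$ and $K\,al\ge1$, the slope is at least 1, so $1+p\le 2p$ and [Bd0] applies. *)
have key d : 0 < d < d0 -> B * (1 + p d) <= c * (p d * (1 - al) / d).
  move=> dd; have h := p1 d dd; have /andP[dgt dlt] := dd.
  have pd1 : 1 <= p d by exact: le_trans h.
  rewrite 2!mulrA ler_pdivlMr//.
  apply: (@le_trans _ _ (2 * B * d0 * p d)).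
    have -> : 2 * B * d0 * p d = B * (2 * p d) * d0 by ring.
    have pd0 : 0 <= p d by exact: le_trans pd1.
    apply: ler_pM; [by rewrite mulr_ge0// addr_ge0|exact: ltW| |exact: ltW].
    by apply: ler_wpM2l => //; clear -pd1; lra.
  have pd0 : 0 <= p d by exact: le_trans pd1.
  by have := ler_wpM2r pd0 Bd0; clear; lra.
apply: (@two_point_comparison _ l t0 t1 d0 v vt vx vxx (fun d => K * d `^ al) p
  (fun d => - (p d * (1 - al) / d))) => //.
- by rewrite powR0 ?gt_eqF// mulr0.
- exact: powR_within_continuous.
- by move=> d /andP[dgt _]; exact: powR_taylor2.
- move=> x' y' xl' yl' /andP[xy0 _]; apply: le_trans (ler_norm _) _.
  by apply: (le_trans (init _ _ xl' yl')); rewrite ger0_norm// ler_wpM2r// powR_ge0.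
- by move=> *; exact: far.
- move=> t' x' d tt' xl' dd vxE vxxE; have [A /andP[Ac _] I] := int _ _ tt' xl'.
  have pd : 0 <= p d by apply: le_trans (p1 d dd); exact: le_trans ler01 _.
  move: I; rewrite ler_norml vxE (ger0_norm pd) => /andP[_ I].
  have k := key d dd; set q := p d * (1 - al) / d in vxxE k *.
  have q0 : 0 <= q.
    by have /andP[/ltW dgt _] := dd; apply: divr_ge0 => //; apply: mulr_ge0; rewrite // subr_ge0 ltW.
  have a1 : A * vxx t' x' <= A * (- q) by rewrite ler_wpM2l// (le_trans (ltW c0)).
  have a2 : c * q <= A * q by rewrite ler_wpM2r.
  by clear -a1 a2 k I; lra.
- move=> t' x' d tt' xl' dd vxE; rewrite opprK => vxxE.
  have [A /andP[Ac _] I] := int _ _ tt' xl'.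
  have pd : 0 <= p d by apply: le_trans (p1 d dd); exact: le_trans ler01 _.
  move: I; rewrite ler_norml vxE (ger0_norm pd) => /andP[I _].
  have k := key d dd; set q := p d * (1 - al) / d in vxxE k *.
  have q0 : 0 <= q.
    by have /andP[/ltW dgt _] := dd; apply: divr_ge0 => //; apply: mulr_ge0; rewrite // subr_ge0 ltW.
  have a1 : A * q <= A * vxx t' x' by rewrite ler_wpM2l// (le_trans (ltW c0)).
  have a2 : c * q <= A * q by rewrite ler_wpM2r.
  by clear -a1 a2 k I; lra.
- move=> t' d tt' dd vxE; have [b bc] := bdr _ tt'; rewrite ler_norml => /andP[_ I].
  have h := p1 d dd; have a1 : c * (K * al) <= b * vx t' l.
    apply: ler_pM => //; [exact: ltW|exact: le_trans ler01 _|exact: le_trans vxE].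
  by clear -a1 I BK; lra.
- move=> t' d tt' dd vxE; have [b bc] := bdl _ tt'; rewrite ler_norml => /andP[I _].
  have h := p1 d dd; have a1 : c * (K * al) <= b * vx t' (- l).
    apply: ler_pM => //; [exact: ltW|exact: le_trans ler01 _|exact: le_trans vxE].
  by clear -a1 I BK; lra.
- by rewrite subr_ge0 yx ltW.
Qed.

(** [K] is quantified before the evolution and its time interval, so that one constant serves all
    difference quotients, whatever their step. *)
Lemma space_holder (l c AM B M H al : R) :
  0 < l -> 0 < c -> 0 <= B -> 0 < al < 1 ->
  exists K, forall (t0 t1 : R) (v vt vx vxx : R -> R -> R), t0 <= t1 ->
  linear_evolution l t0 t1 c AM B M v vt vx vxx ->
  (forall x y, - l <= x <= l -> - l <= y <= l ->
     `|v t0 x - v t0 y| <= H * `|x - y| `^ al) ->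
  forall t x y, t0 <= t <= t1 -> - l <= x <= l -> - l <= y <= l ->
    `|v t x - v t y| <= K * `|x - y| `^ al.
Proof.
move=> l0 c0 B0 al01; have /andP[al0 al1] := al01.
have B1 : 0 < 2 * B + 1 by clear -B0; lra.
(* The summand 1 in the denominator covers $B=0$. *)
pose d0 := Num.min 1 (c * (1 - al) / (2 * B + 1)).
have d00 : 0 < d0.
  by rewrite lt_min ltr01/= divr_gt0// mulr_gt0//; clear -al1; lra.
have d01 : d0 <= 1 by rewrite ge_min lexx.
have dB : 2 * B * d0 <= c * (1 - al).
  apply: (@le_trans _ _ ((2 * B + 1) * d0)).
    by rewrite ler_wpM2r ?ltW//; clear; lra.
  by rewrite mulrC -ler_pdivlMr// ge_min lexx orbT.
have dal : 0 < d0 `^ al by rewrite powR_gt0.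
pose K := Num.max (Num.max (1 / al) (B / c / al)) (Num.max (2 * M / d0 `^ al) H).
have [[K1 K2] [K3 K4]] : (1 / al <= K /\ B / c / al <= K) /\
   (2 * M / d0 `^ al <= K /\ H <= K).
  by rewrite /K !le_max !lexx ?orbT.
rewrite ler_pdivrMr// in K1; rewrite ler_pdivrMr// ler_pdivrMr// mulrC in K2.
rewrite ler_pdivrMr// in K3.
exists K => t0 t1 v vt vx vxx t01 le init.
have dd : 0 < d0 <= 1 by rewrite d00.
have up := space_holder_above l0 t01 c0 B0 al01 dd dB K1 K2 K3 K4 le init.
have initN x y : - l <= x <= l -> - l <= y <= l ->
     `|- v t0 x - - v t0 y| <= H * `|x - y| `^ al.
  by move=> xl yl; rewrite -opprD normrN; exact: init.
have dn := space_holder_above l0 t01 c0 B0 al01 dd dB K1 K2 K3 K4 (linear_evolutionN le) initN.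
move=> t x y tt.
wlog yx : x y / y <= x.
  move=> W; have [|/ltW xy xl yl] := leP y x; first exact: W.
  by rewrite distrC [`|x - y|]distrC; exact: W.
move=> xl yl; rewrite [`|x - y|]ger0_norm ?subr_ge0// ler_norml.
have := up t x y tt xl yl yx; have := dn t x y tt xl yl yx.
by clear; lra.
Qed.

(** In the variable $z/r$ the constant dominates up to 1 and the square dominates beyond. This
    converts a Hoelder bound into a smooth barrier at scale [r]. *)
Lemma powR_le_parabola (al r z : R) : 0 < al < 2 -> 0 < r -> 0 <= z ->
  z `^ al <= r `^ al * (1 + (z / r) ^+ 2).
Proof.
move=> /andP[al0 al2] r0 z0.
have zr : z = r * (z / r) by rewrite mulrC divfK// gt_eqF.
have q0 : 0 <= z / r by rewrite divr_ge0// ltW.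
rewrite {1}zr (powRM _ (ltW r0) q0); apply: ler_wpM2l; first exact: powR_ge0.
have [q1|q1] := leP (z / r) 1.
  apply: (@le_trans _ _ 1); last by rewrite lerDl sqr_ge0.
  have <- : 1 `^ al = 1 :> R by rewrite powR1.
  by apply: ge0_ler_powR => //; rewrite ?nnegrE// ltW.
apply: (@le_trans _ _ ((z / r) ^+ 2)); last by rewrite lerDr.
by rewrite -powR_mulrn// ler_powR// ltW.
Qed.

(** The barrier is a strict supersolution. Inside, its diffusion costs at most $2\,AM\,Kq$ and its
    slope at most $4Klq$, and $q\ge1$ lets [Lam * q] absorb both. As [x0] lies in the interval, the
    parabola does not decrease towards either end, so at a boundary maximum the term [b * vx] has
    the favourable sign and [vt] is at most [B]. *)
Lemma parabola_barrier l (s t1 c AM B M K q r2 x0 Lam : R) (v vt vx vxx : R -> R -> R) :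
  0 < l -> s <= t1 -> 0 < c -> 0 <= B -> 0 <= K -> 1 <= q ->
  - l <= x0 <= l ->
  linear_evolution l s t1 c AM B M v vt vx vxx ->
  2 * AM * K + B * (1 + 4 * K * l) < Lam ->
  (forall x, - l <= x <= l -> v s x - v s x0 <= r2 + K * q * (x - x0) ^+ 2) ->
  forall t x, s <= t <= t1 -> - l <= x <= l ->
    v t x - v s x0 <= r2 + K * q * (x - x0) ^+ 2 + Lam * q * (t - s).
Proof.
move=> l0 st1 c0 B0 K0 q1 x0l [[[C C0 vC] Vt Vx Vxx] bnd int bdr bdl] LamB init.
have q0 : 0 < q by exact: lt_le_trans q1.
move=> t' x' tt' xl'; rewrite leNgt; apply/negP => gt'.
pose W t x := v t x - K * q * (x - x0) ^+ 2 - Lam * q * (t - s).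
pose F (p : R * R) := v (clamp s t1 p.1) (clamp (- l) l p.2)
   - K * q * (p.2 - x0) ^+ 2 - Lam * q * (p.1 - s).
have cF : continuous F.
  move=> p; apply: cvgB; first apply: cvgB.
  - exact: (lip2_continuous st1 (ltW l0) C0 vC).
  - apply: cvgM; first exact: cvg_cst.
    have c2 : continuous (fun p : R * R => p.2 - x0).
      by move=> w; apply: cvgB; [exact: cvg_snd|exact: cvg_cst].
    exact: (continuous_comp (c2 p) (@exprn_continuous _ 2 _)).
  - apply: cvgM; first exact: cvg_cst.
    by apply: cvgB; [exact: cvg_fst|exact: cvg_cst].
have FE t x : s <= t <= t1 -> - l <= x <= l -> F (t, x) = W t x.
  by move=> ? ?; rewrite /F/W/= !clamp_id.
pose Bx := `[s, t1] `*` `[- l, l].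
have inB t x : s <= t <= t1 -> - l <= x <= l -> Bx (t, x).
  by move=> *; rewrite /Bx/= !in_itv.
have cB : compact Bx.
  exact: (compact_setX (@segment_compact _ _ _) (@segment_compact _ _ _)).
have [[t x] [/= tt xl] Fmax] := compact_max (ex_intro _ _ (inB _ _ tt' xl')) cB cF.
rewrite /= !in_itv/= in tt xl.
have {}Fmax t2 x2 : s <= t2 <= t1 -> - l <= x2 <= l -> W t2 x2 <= W t x.
  by move=> *; rewrite -!FE//; apply: Fmax; exact: inB.
clear cF FE inB cB Bx F.
have pos : v s x0 + r2 < W t x.
  by apply: lt_le_trans (Fmax _ _ tt' xl'); rewrite /W; clear -gt'; lra.
have st : s < t.
  rewrite lt_neqAle; apply/andP; split; last by case/andP: tt.
  apply/eqP => sE; have := init x xl; move: pos; rewrite /W -sE subrr mulr0.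
  by clear; lra.
have tI : s < t <= t1 by rewrite st; case/andP: tt.
have vt_ge : Lam * q <= vt t x.
  rewrite -subr_ge0.
  have T : taylor1 `[s, t1] (fun z => v z x + (-1) * (Lam * q * z)) t (vt t x + (-1) * (Lam * q)).
    apply: taylor1D; first exact: Vt.
    by apply: taylor1Z; apply: taylor1_affine => z _; ring.
  have : 0 <= vt t x + (-1) * (Lam * q).
    apply: (@taylor1_max_left _ _ _ _ _ s st _ T) => z /andP[z1 z2].
    have zz : s <= z <= t1 by rewrite z1 (le_trans z2)//; case/andP: tt.
    split; first by rewrite /= in_itv.
    by have := Fmax z x zz xl; rewrite /W; clear; lra.
  by clear; lra.
have LamB' : B < Lam.
  (* An interior point is consulted only to learn that [AM] is positive. *)
  have [A /andP[cA AAM] _] : exists2 A, c <= A <= AM & True.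
    have l00 : - l < 0 < l by rewrite oppr_lt0 l0.
    by have [A Ac _] := int t 0 tI l00; exists A.
  apply: le_lt_trans LamB.
  have : 0 <= AM * K by rewrite mulr_ge0// (le_trans _ AAM)// (le_trans _ cA)// ltW.
  have : 0 <= B * (K * l) by rewrite !mulr_ge0// ltW.
  by clear; lra.
have Lq : Lam <= Lam * q by rewrite ler_peMr// (le_trans B0)// ltW.
have Kq0 : 0 <= K * q by rewrite mulr_ge0// ltW.
pose f z := v t z + (-1) * (K * q * (z - x0) ^+ 2).
have fmax z : - l <= z <= l -> f z <= f x.
  by move=> zl; have := Fmax t z tt zl; rewrite /f/W; clear; lra.
have Tq : taylor2 `[- l, l] (fun z => K * q * (z - x0) ^+ 2) x (2 * K * q * (x - x0)) (2 * K * q).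
  by apply: taylor2_quadratic => z _; field.
have [xL|xL] := ltP x l; last first.
  have xE : x = l by apply/eqP; rewrite eq_le xL; case/andP: xl => _ ->.
  have T1 : taylor1 `[- l, l] f x (vx t x + (-1) * (2 * K * q * (x - x0))).
    apply: taylor1D; first exact: Vx.
    by apply: taylor1Z; exact: taylor2_taylor1 Tq.
  have g0 : 0 <= vx t x + (-1) * (2 * K * q * (x - x0)).
    apply: (@taylor1_max_left _ _ _ _ _ (- l) _ _ T1).
      by rewrite xE; clear -l0; lra.
    move=> z /andP[z1 z2]; have zl : - l <= z <= l by rewrite z1 (le_trans z2)// xE.
    by split; [rewrite /= in_itv|exact: fmax].
  have [b bc] := bdr t tI; rewrite ler_norml => /andP[_ I].
  have : 0 <= vx t l.
    rewrite -xE; have : 0 <= K * q * (x - x0) by rewrite mulr_ge0// xE subr_ge0; case/andP: x0l.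
    by move: g0; clear; lra.
  move=> vx0; have : 0 <= b * vx t l by rewrite mulr_ge0// (le_trans (ltW c0)).
  by move: vt_ge; rewrite xE; clear -I Lq LamB'; lra.
have [xR|xR] := ltP (- l) x; last first.
  have xE : x = - l by apply/eqP; rewrite eq_le xR; case/andP: xl => ->.
  have T1 : taylor1 `[- l, l] f x (vx t x + (-1) * (2 * K * q * (x - x0))).
    apply: taylor1D; first exact: Vx.
    by apply: taylor1Z; exact: taylor2_taylor1 Tq.
  have g0 : vx t x + (-1) * (2 * K * q * (x - x0)) <= 0.
    apply: (@taylor1_max_right _ _ _ _ _ l _ _ T1).
      by rewrite xE; clear -l0; lra.
    move=> z /andP[z1 z2]; have zl : - l <= z <= l by rewrite z2 (le_trans _ z1)// xE.
    by split; [rewrite /= in_itv|exact: fmax].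
  have [b bc] := bdl t tI; rewrite ler_norml => /andP[_ I].
  have : vx t (- l) <= 0.
    rewrite -xE; have : K * q * (x - x0) <= 0.
      by apply: mulr_ge0_le0 => //; rewrite xE subr_le0; case/andP: x0l.
    by move: g0; clear; lra.
  move=> vx0; have : b * vx t (- l) <= 0 by apply: mulr_ge0_le0 => //; exact: le_trans (ltW c0) bc.
  by move: vt_ge; rewrite xE; clear -I Lq LamB'; lra.
have xI : - l < x < l by rewrite xL xR.
have T2 : taylor2 `[- l, l] f x (vx t x + (-1) * (2 * K * q * (x - x0)))
    (vxx t x + (-1) * (2 * K * q)).
  by apply: taylor2D; [exact: Vxx|exact: taylor2Z].
have [|h1 h2] := @taylor2_max _ _ f x _ _ (- l) l xI _ T2.
  by move=> z zl; split; [rewrite /= in_itv|exact: fmax].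
have [A /andP[cA AAM] I] := int t x tI xI.
have A0 : 0 < A by exact: lt_le_trans cA.
move: I; rewrite ler_norml => /andP[_ I].
have vxE : `|vx t x| <= 4 * K * l * q.
  have -> : vx t x = (2 * K * q) * (x - x0) by move: h1; clear; lra.
  have p0 : 0 <= 2 * K * q by rewrite -mulrA mulr_ge0.
  rewrite normrM (ger0_norm p0).
  have : `|x - x0| <= 2 * l by rewrite ler_norml; clear -xl x0l; lra.
  by move/(ler_wpM2l p0); clear; lra.
have i1 : A * vxx t x <= AM * (2 * K * q).
  apply: (@le_trans _ _ (A * (2 * K * q))).
    by apply: (ler_wpM2l (ltW A0)); move: h2; clear; lra.
  by rewrite ler_wpM2r// -mulrA mulr_ge0.
have i2 : B * (1 + `|vx t x|) <= B * (1 + 4 * K * l) * q.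
  rewrite -mulrA ler_wpM2l//; move: vxE q1; clear; lra.
have i3 : (2 * AM * K + B * (1 + 4 * K * l)) * q < Lam * q by rewrite ltr_pM2r.
by move: i1 i2 i3 I vt_ge; clear; lra.
Qed.

(** At the parabolic scale $r=\sqrt{t-s}$ the Hoelder bound in space lies below the parabola
    $Kr^{al}(1+((y-x)/r)^2)$. In time $r^2$ this barrier rises by a multiple of
    $r^{al}=(t-s)^{al/2}$. Time differences above 1 are covered by the bound [M]. *)
Lemma time_holder (l c AM B M al K : R) :
  0 < l -> 0 < c -> 0 <= B -> 0 < al < 1 ->
  exists K', forall (t0 t1 : R) (v vt vx vxx : R -> R -> R), t0 <= t1 ->
  linear_evolution l t0 t1 c AM B M v vt vx vxx ->
  (forall t x y, t0 <= t <= t1 -> - l <= x <= l -> - l <= y <= l ->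
     `|v t x - v t y| <= K * `|x - y| `^ al) ->
  forall t s x, t0 <= t <= t1 -> t0 <= s <= t1 -> - l <= x <= l ->
    `|v t x - v s x| <= K' * `|t - s| `^ (al / 2).
Proof.
move=> l0 c0 B0 al01; have /andP[al0 al1] := al01.
pose Kp := Num.max K 0.
have [KKp Kp0] : K <= Kp /\ 0 <= Kp by rewrite /Kp !le_max !lexx ?orbT.
pose Lam := 2 * AM * Kp + B * (1 + 4 * Kp * l) + 1.
pose K' := Num.max (Kp + Lam) (2 * M).
have [K1 K2] : Kp + Lam <= K' /\ 2 * M <= K' by rewrite /K' !le_max !lexx ?orbT.
exists K' => t0 t1.
(* one-sided bound, to be applied to [v] and [-v] *)
have up (v vt vx vxx : R -> R -> R) : linear_evolution l t0 t1 c AM B M v vt vx vxx ->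
    (forall t x y, t0 <= t <= t1 -> - l <= x <= l -> - l <= y <= l ->
     `|v t x - v t y| <= K * `|x - y| `^ al) ->
    forall t s x, t0 <= s -> s < t <= t1 -> t - s <= 1 -> - l <= x <= l ->
    v t x - v s x <= (Kp + Lam) * (t - s) `^ (al / 2).
  move=> [cl bnd int bdr bdl] vK t s x t0s /andP[st tt1] ts1 xl.
  have ts0 : 0 < t - s by rewrite subr_gt0.
  pose r := Num.sqrt (t - s).
  have r0 : 0 < r by rewrite sqrtr_gt0.
  have r2 : r ^+ 2 = t - s by rewrite sqr_sqrtr// ltW.
  have ral : r `^ al = (t - s) `^ (al / 2).
    by rewrite /r -powR12_sqrt ?ltW// -powRrM mulrC.
  (* The curvature $r^{al-2}$ of the parabola; it is at least 1 because $r\le1$, as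
     [parabola_barrier] requires. *)
  pose q := r `^ al / r ^+ 2.
  have q1 : 1 <= q.
    rewrite /q ler_pdivlMr ?exprn_gt0// mul1r -(powR_mulrn 2 (ltW r0)).
    apply: ger_powR; last by clear -al1; lra.
    by rewrite r0 -(@expr_le1 _ 2)// ?(ltW r0)// r2.
  have sub z : s <= z <= t1 -> t0 <= z <= t1.
    by move=> /andP[a ->]; rewrite (le_trans t0s a).
  have sub' z : s < z <= t1 -> t0 < z <= t1.
    by move=> /andP[a ->]; rewrite (le_lt_trans t0s a).
  have le' : linear_evolution l s t1 c AM B M v vt vx vxx.
    split.
    - exact: classical_sub t0s (lexx t1) cl.
    - by move=> z y /sub; exact: bnd.
    - by move=> z y /sub'; exact: int.
    - by move=> z /sub'; exact: bdr.
    - by move=> z /sub'; exact: bdl.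
  have s_in : t0 <= s <= t1 by rewrite t0s (le_trans (ltW st)).
  have init y : - l <= y <= l ->
      v s y - v s x <= Kp * r `^ al + Kp * q * (y - x) ^+ 2.
    move=> yl; apply: le_trans (ler_norm _) _; apply: (le_trans (vK _ _ _ s_in yl xl)).
    apply: (@le_trans _ _ (Kp * `|y - x| `^ al)).
      by rewrite ler_wpM2r// powR_ge0.
    have -> : Kp * r `^ al + Kp * q * (y - x) ^+ 2 =
        Kp * (r `^ al * (1 + (`|y - x| / r) ^+ 2)).
      rewrite expr_div_n real_normK ?num_real// /q; field.
      by rewrite gt_eqF.
    by apply: ler_wpM2l => //; apply: powR_le_parabola; rewrite // al0/=; clear -al1; lra.
  have st1 : s <= t1 by exact: le_trans (ltW st) tt1.
  have LamB : 2 * AM * Kp + B * (1 + 4 * Kp * l) < Lam by rewrite /Lam ltrDl.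
  have t_in : s <= t <= t1 by rewrite ltW.
  have := parabola_barrier l0 st1 c0 B0 Kp0 q1 xl le' LamB init t_in xl.
  rewrite subrr expr0n/= mulr0 addr0 -ral => H; apply: le_trans H _.
  rewrite -r2 /q -mulrA divfK ?expf_eq0 ?gt_eqF//.
  by rewrite [leRHS]mulrDl lexx.
move=> v vt vx vxx t01 le vK t s x tt ss xl.
wlog st : t s tt ss / s < t.
  move=> W; have [|/W|->] := ltgtP s t; first exact: W.
    by rewrite distrC [`|t - s|]distrC; exact.
  rewrite !subrr !normr0 powR0 ?mulr0// gt_eqF// divr_gt0//.
have ts0 : 0 < t - s by rewrite subr_gt0.
rewrite (gtr0_norm ts0).
have pw : 0 <= (t - s) `^ (al / 2) by exact: powR_ge0.
have [ts1|ts1] := leP (t - s) 1.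
  apply: (@le_trans _ _ ((Kp + Lam) * (t - s) `^ (al / 2))); last by rewrite ler_wpM2r.
  have st' : s < t <= t1 by rewrite st; case/andP: tt.
  have t0s : t0 <= s by case/andP: ss.
  have := up _ _ _ _ le vK t s x t0s st' ts1 xl.
  have vKN z y w : t0 <= z <= t1 -> - l <= y <= l -> - l <= w <= l ->
     `|- v z y - - v z w| <= K * `|y - w| `^ al.
    by move=> *; rewrite -opprD normrN; exact: vK.
  have := up _ _ _ _ (linear_evolutionN le) vKN t s x t0s st' ts1 xl.
  by rewrite ler_norml; clear; lra.
have := lev_bnd le tt xl; have := lev_bnd le ss xl; rewrite !ler_norml => h1 h2.
have M0 : 0 <= 2 * M by clear -h1; lra.
have h3 : 2 * M <= K' * (t - s) `^ (al / 2).
  apply: (@le_trans _ _ (K' * 1)); first by rewrite mulr1.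
  apply: ler_wpM2l; first exact: le_trans K2.
  rewrite -[leLHS](powRr0 (t - s)); apply: ler_powR; first exact: ltW.
  by rewrite divr_ge0// ltW.
by clear -h1 h2 h3; lra.
Qed.

End HolderBarriers.

(** * Parabolic norms *)

Section NormBounds.
Context {R : realType}.
Implicit Types (u : R -> R -> R) (al l tau C t s x y : R) (I : set R).

(** Finiteness of [parabolic_norm] in real-valued form, with a single constant for its nine terms;
    going back to the norm costs a factor 9. *)
Record holder_bounds al l I u C : Prop := HolderBounds {
  hb_u : forall t x, I t -> Omega l x -> `|u t x| <= C ;
  hb_x : forall t x, I t -> Omega l x -> `|d_x u t x| <= C ;
  hb_xx : forall t x, I t -> Omega l x -> `|d_xx u t x| <= C ;
  hb_t : forall t x, I t -> Omega l x -> `|d_t u t x| <= C ;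
  hb_t_t : forall t s x, I t -> I s -> Omega l x ->
    `|d_t u t x - d_t u s x| <= C * `|t - s| `^ (al / 2) ;
  hb_t_x : forall t x y, I t -> Omega l x -> Omega l y ->
    `|d_t u t x - d_t u t y| <= C * `|x - y| `^ al ;
  hb_xx_t : forall t s x, I t -> I s -> Omega l x ->
    `|d_xx u t x - d_xx u s x| <= C * `|t - s| `^ (al / 2) ;
  hb_xx_x : forall t x y, I t -> Omega l x -> Omega l y ->
    `|d_xx u t x - d_xx u t y| <= C * `|x - y| `^ al ;
  hb_x_t : forall t s x, I t -> I s -> Omega l x ->
    `|d_x u t x - d_x u s x| <= C * `|t - s| `^ ((1 + al) / 2) }.

Lemma sup_norm_leP l tau u C :
  (sup_norm l tau u <= C%:E)%E <->
  (forall t x, 0 < t < tau -> - l < x < l -> `|u t x| <= C).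
Proof.
split=> [H t x tt xl|H].
  rewrite -lee_fin; apply: le_trans H; apply: ereal_sup_ubound.
  by exists (t, x) => //; split; rewrite /= in_itv.
apply: ge_ereal_sup => _ [[t x] [/= tt xl] <-]; rewrite lee_fin; apply: H.
  by move: tt; rewrite in_itv.
by move: xl; rewrite /Omega/= in_itv.
Qed.

Lemma holder_seminorm_leP (beta : R) I (v : R -> R) C :
  (holder_seminorm beta I v <= C%:E)%E <->
  (forall x y, I x -> I y -> x != y -> `|v x - v y| <= C * `|x - y| `^ beta).
Proof.
have pos x y : x != y -> 0 < `|x - y| `^ beta.
  by move=> xy; rewrite powR_gt0// normr_gt0 subr_eq0.
split=> [H x y Ix Iy xy|H].
  rewrite -ler_pdivrMr ?pos// -lee_fin; apply: le_trans H.
  by apply: ereal_sup_ubound; exists x, y.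
apply: ge_ereal_sup => _ [x [y [Ix Iy xy ->]]].
by rewrite lee_fin ler_pdivrMr ?pos//; exact: H.
Qed.

Lemma holder_t_leP (beta : R) l tau u C : beta != 0 -> 0 <= C ->
  (holder_t beta l tau u <= C%:E)%E <->
  (forall t s x, 0 < t < tau -> 0 < s < tau -> - l < x < l ->
     `|u t x - u s x| <= C * `|t - s| `^ beta).
Proof.
move=> b0 C0; split=> [H t s x tt ss xl|H].
  have [->|ts] := eqVneq t s; first by rewrite !subrr normr0 powR0// mulr0.
  have /holder_seminorm_leP : (holder_seminorm beta `]0%R, tau[ (fun t => u t x) <= C%:E)%E.
    by apply: le_trans H; apply: ereal_sup_ubound; exists x => //; rewrite /Omega/= in_itv.
  by apply; rewrite //= in_itv.
apply: ge_ereal_sup => _ [x xl <-]; apply/holder_seminorm_leP => t s.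
by rewrite /= !in_itv/= => tt ss _; apply: H.
Qed.

Lemma holder_x_leP (beta : R) l tau u C : beta != 0 -> 0 <= C ->
  (holder_x beta l tau u <= C%:E)%E <->
  (forall t x y, 0 < t < tau -> - l < x < l -> - l < y < l ->
     `|u t x - u t y| <= C * `|x - y| `^ beta).
Proof.
move=> b0 C0; split=> [H t x y tt xl yl|H].
  have [->|xy] := eqVneq x y; first by rewrite !subrr normr0 powR0// mulr0.
  have /holder_seminorm_leP : (holder_seminorm beta (Omega l) (u t) <= C%:E)%E.
    by apply: le_trans H; apply: ereal_sup_ubound; exists t => //; rewrite /= in_itv.
  by apply; rewrite //= /Omega/= in_itv.
apply: ge_ereal_sup => _ [t tt <-]; apply/holder_seminorm_leP => x y.
by rewrite /Omega/= !in_itv/= => xl yl _; apply: H.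
Qed.

(** The cylinder must be nonempty, since the supremum of the empty set is [-oo]. *)
Lemma sup_norm_ge0 l tau u : 0 < l -> 0 < tau -> (0 <= sup_norm l tau u)%E.
Proof.
move=> l0 tau0; apply: (@le_trans _ _ `|u (tau / 2) 0|%:E); first by rewrite lee_fin.
apply: ereal_sup_ubound; exists (tau / 2, 0) => //; split; rewrite /= /Omega/= in_itv/=.
  by clear -tau0; lra.
by rewrite oppr_lt0 l0.
Qed.

Lemma holder_seminorm_ge0 (beta : R) I (v : R -> R) x y : I x -> I y -> x != y ->
  (0 <= holder_seminorm beta I v)%E.
Proof.
move=> Ix Iy xy; apply: (@le_trans _ _ (`|v x - v y| / (`|x - y| `^ beta))%:E).
  by rewrite lee_fin divr_ge0// powR_ge0.
by apply: ereal_sup_ubound; exists x, y.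
Qed.

Lemma holder_t_ge0 (beta : R) l tau u : 0 < l -> 0 < tau -> (0 <= holder_t beta l tau u)%E.
Proof.
move=> l0 tau0.
apply: (@le_trans _ _ (holder_seminorm beta `]0%R, tau[ (fun t => u t 0))); last first.
  by apply: ereal_sup_ubound; exists 0 => //; rewrite /Omega/= in_itv/= oppr_lt0 l0.
apply: (@holder_seminorm_ge0 _ _ _ (tau / 2) (tau / 3)).
- by rewrite /= in_itv/=; clear -tau0; lra.
- by rewrite /= in_itv/=; clear -tau0; lra.
- by rewrite gt_eqF//; clear -tau0; lra.
Qed.

Lemma holder_x_ge0 (beta : R) l tau u : 0 < l -> 0 < tau -> (0 <= holder_x beta l tau u)%E.
Proof.
move=> l0 tau0.
apply: (@le_trans _ _ (holder_seminorm beta (Omega l) (u (tau / 2)))); last first.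
  by apply: ereal_sup_ubound; exists (tau / 2) => //; rewrite /= in_itv/=; clear -tau0; lra.
apply: (@holder_seminorm_ge0 _ _ _ (l / 2) (l / 3)).
- by rewrite /Omega/= in_itv/=; clear -l0; lra.
- by rewrite /Omega/= in_itv/=; clear -l0; lra.
- by rewrite gt_eqF//; clear -l0; lra.
Qed.

(** The signs matter: in [\bar R] a summand [-oo] would absorb [+oo]. *)
Lemma adde_ge0_lty (A B : \bar R) : (0 <= A)%E -> (0 <= B)%E -> (A + B < +oo)%E ->
  (A < +oo)%E /\ (B < +oo)%E.
Proof. by move: A B => [A||] [B||] //= _ _ _; split; exact: ltry. Qed.

Lemma ge0_lty_le (A : \bar R) : (0 <= A)%E -> (A < +oo)%E -> exists2 c, 0 <= c & (A <= c%:E)%E.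
Proof. by case: A => [c||]// c0 _; exists c; rewrite // -lee_fin. Qed.

Lemma adde9_bounds (A1 A2 A3 A4 A5 A6 A7 A8 A9 : \bar R) :
  (0 <= A1 -> 0 <= A2 -> 0 <= A3 -> 0 <= A4 -> 0 <= A5 -> 0 <= A6 -> 0 <= A7 ->
   0 <= A8 -> 0 <= A9 ->
   A1 + A2 + A3 + A4 + (A5 + A6) + (A7 + A8) + A9 < +oo ->
   exists2 C : R, (0 <= C)%R & [/\ [/\ A1 <= C%:E, A2 <= C%:E & A3 <= C%:E],
     [/\ A4 <= C%:E, A5 <= C%:E & A6 <= C%:E] &
     [/\ A7 <= C%:E, A8 <= C%:E & A9 <= C%:E]])%E.
Proof.
move=> n1 n2 n3 n4 n5 n6 n7 n8 n9.
have m2 := adde_ge0 n1 n2; have m3 := adde_ge0 m2 n3; have m4 := adde_ge0 m3 n4.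
have m6 := adde_ge0 n5 n6; have m8 := adde_ge0 n7 n8.
have q6 := adde_ge0 m4 m6; have q8 := adde_ge0 q6 m8.
move=> /(adde_ge0_lty q8 n9)[] /(adde_ge0_lty q6 m8)[] /(adde_ge0_lty m4 m6)[].
move=> /(adde_ge0_lty m3 n4)[] /(adde_ge0_lty m2 n3)[] /(adde_ge0_lty n1 n2)[].
move=> /(ge0_lty_le n1)[c1 p1 h1] /(ge0_lty_le n2)[c2 p2 h2].
move=> /(ge0_lty_le n3)[c3 p3 h3] /(ge0_lty_le n4)[c4 p4 h4].
move=> /(adde_ge0_lty n5 n6)[] /(ge0_lty_le n5)[c5 p5 h5] /(ge0_lty_le n6)[c6 p6 h6].
move=> /(adde_ge0_lty n7 n8)[] /(ge0_lty_le n7)[c7 p7 h7] /(ge0_lty_le n8)[c8 p8 h8].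
move=> /(ge0_lty_le n9)[c9 p9 h9].
pose C := c1 + c2 + c3 + c4 + c5 + c6 + c7 + c8 + c9.
have up (A : \bar R) c : (A <= c%:E)%E -> c <= C -> (A <= C%:E)%E.
  by move=> Ac cC; apply: (le_trans Ac); rewrite lee_fin.
clear n1 n2 n3 n4 n5 n6 n7 n8 n9 m2 m3 m4 m6 m8 q6 q8.
exists C; first by rewrite /C !addr_ge0.
split; split; [apply: up h1 _|apply: up h2 _|apply: up h3 _|apply: up h4 _
  |apply: up h5 _|apply: up h6 _|apply: up h7 _|apply: up h8 _|apply: up h9 _];
  by clear -p1 p2 p3 p4 p5 p6 p7 p8 p9; rewrite /C; lra.
Qed.

Lemma parabolic_norm_bounds al l tau u : 0 < al < 1 -> 0 < l -> 0 < tau ->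
  (parabolic_norm al l tau u < +oo)%E ->
  exists2 C, 0 <= C & holder_bounds al l `]0, tau[ u C.
Proof.
move=> /andP[al0 al1] l0 tau0.
have a2 : al / 2 != 0 by rewrite gt_eqF// divr_gt0.
have a1 : al != 0 by rewrite gt_eqF.
have a3 : (1 + al) / 2 != 0 by rewrite gt_eqF// divr_gt0// addr_gt0.
move/(adde9_bounds (sup_norm_ge0 u l0 tau0) (sup_norm_ge0 (d_x u) l0 tau0)
  (sup_norm_ge0 (d_xx u) l0 tau0) (sup_norm_ge0 (d_t u) l0 tau0)
  (holder_t_ge0 (al / 2) (d_t u) l0 tau0) (holder_x_ge0 al (d_t u) l0 tau0)
  (holder_t_ge0 (al / 2) (d_xx u) l0 tau0) (holder_x_ge0 al (d_xx u) l0 tau0)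
  (holder_t_ge0 ((1 + al) / 2) (d_x u) l0 tau0)).
move=> [C C0 [[h1 h2 h3] [h4 h5 h6] [h7 h8 h9]]].
exists C => //; split.
- move=> t x; rewrite /Omega/= !in_itv/=; exact: (proj1 (sup_norm_leP _ _ _ _) h1).
- move=> t x; rewrite /Omega/= !in_itv/=; exact: (proj1 (sup_norm_leP _ _ _ _) h2).
- move=> t x; rewrite /Omega/= !in_itv/=; exact: (proj1 (sup_norm_leP _ _ _ _) h3).
- move=> t x; rewrite /Omega/= !in_itv/=; exact: (proj1 (sup_norm_leP _ _ _ _) h4).
- move=> t s x; rewrite /Omega/= !in_itv/=; exact: (proj1 (holder_t_leP _ _ _ a2 C0) h5).
- move=> t x y; rewrite /Omega/= !in_itv/=; exact: (proj1 (holder_x_leP _ _ _ a1 C0) h6).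
- move=> t s x; rewrite /Omega/= !in_itv/=; exact: (proj1 (holder_t_leP _ _ _ a2 C0) h7).
- move=> t x y; rewrite /Omega/= !in_itv/=; exact: (proj1 (holder_x_leP _ _ _ a1 C0) h8).
- move=> t s x; rewrite /Omega/= !in_itv/=; exact: (proj1 (holder_t_leP _ _ _ a3 C0) h9).
Qed.

Lemma bounds_parabolic_norm al l tau u C : 0 < al < 1 -> 0 <= C ->
  holder_bounds al l `]0, tau[ u C -> (parabolic_norm al l tau u <= (9 * C)%:E)%E.
Proof.
move=> /andP[al0 al1] C0 [h1 h2 h3 h4 h5 h6 h7 h8 h9].
have a2 : al / 2 != 0 by rewrite gt_eqF// divr_gt0.
have a1 : al != 0 by rewrite gt_eqF.
have a3 : (1 + al) / 2 != 0 by rewrite gt_eqF// divr_gt0// addr_gt0.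
have it t : 0 < t < tau -> `]0, tau[%classic t by rewrite /= in_itv.
have ix x : - l < x < l -> Omega l x by rewrite /Omega/= in_itv.
have -> : (9 * C)%:E = (C%:E + C%:E + C%:E + C%:E + (C%:E + C%:E) + (C%:E + C%:E) + C%:E)%E.
  by rewrite -!EFinD; congr EFin; ring.
rewrite /parabolic_norm /holder_tx; do !apply: leeD.
- by apply/sup_norm_leP => t x /it ? /ix ?; exact: h1.
- by apply/sup_norm_leP => t x /it ? /ix ?; exact: h2.
- by apply/sup_norm_leP => t x /it ? /ix ?; exact: h3.
- by apply/sup_norm_leP => t x /it ? /ix ?; exact: h4.
- by apply/holder_t_leP => // t s x /it ? /it ? /ix ?; exact: h5.
- by apply/holder_x_leP => // t x y /it ? /ix ? /ix ?; exact: h6.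
- by apply/holder_t_leP => // t s x /it ? /it ? /ix ?; exact: h7.
- by apply/holder_x_leP => // t x y /it ? /ix ? /ix ?; exact: h8.
- by apply/holder_t_leP => // t s x /it ? /it ? /ix ?; exact: h9.
Qed.

End NormBounds.

(** * Continuous extension to the closed cylinder *)

Section Extension.
Context {R : realType}.
Implicit Types (u w : R -> R -> R) (l c eps eta t s x y : R).

(** The extension that [solves] builds locally. It refers to the whole cylinder of height [T],
    whereas regularity is known only on lower ones of height [tau]; hence the two heights in the
    lemmas below. *)
Definition bar l (T : R) w t x : R := cext (cylinder l T) (fun z => w z.1 z.2) (t, x).

Definition unif_cont l (tau : R) w := forall eps, 0 < eps -> exists2 eta, 0 < eta &
  forall t s x y, 0 < t < tau -> 0 < s < tau -> - l < x < l -> - l < y < l ->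
    `|t - s| < eta -> `|x - y| < eta -> `|w t x - w s y| <= eps.

(** A path from a boundary point into the open interval. For fixed [th] it contracts distances, so
    estimates between interior points pass to the boundary as [th] tends to 0 with the same
    constants. *)
Definition inward c (z th : R) : R := z + th * (c - z).

Lemma inward_cvg c (z : R) : inward c z th @[th --> 0^'+] --> z.
Proof.
have : inward c z th @[th --> (0 : R)] --> z + 0 * (c - z).
  by apply: cvgD; [exact: cvg_cst|apply: cvgMl; exact: cvg_id].
by rewrite mul0r addr0; exact: cvg_at_right_filter.
Qed.

Lemma inward_dist c (z z' th : R) : 0 < th < 1 ->
  `|inward c z th - inward c z' th| <= `|z - z'|.
Proof.
move=> /andP[t0 t1]; have -> : inward c z th - inward c z' th = (1 - th) * (z - z').
  by rewrite /inward; ring.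
rewrite normrM ler_piMl// ger0_norm; clear -t0 t1; lra.
Qed.

Lemma inward_in c (z a b th : R) : a < c < b -> a <= z <= b -> 0 < th < 1 ->
  a < inward c z th < b.
Proof.
move=> /andP[ac cb] /andP[az zb] /andP[t0 t1].
have -> : inward c z th = (1 - th) * z + th * c by rewrite /inward; ring.
have t1' : 0 <= 1 - th by rewrite subr_ge0 ltW.
have h1 := ler_wpM2l t1' az; have h2 := ler_wpM2l t1' zb.
have h3 : th * a < th * c by rewrite ltr_pM2l.
have h4 : th * c < th * b by rewrite ltr_pM2l.
by apply/andP; split; clear -h1 h2 h3 h4; lra.
Qed.

Lemma near_unit : \forall th \near (0 : R)^'+, 0 < th < 1.
Proof.
near=> th; apply/andP; split; [near: th; exact: nbhs_right_gt|near: th].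
exact: nbhs_right_lt.
Unshelve. all: by end_near. Qed.

Lemma inward_within l (T c t x : R) : 0 < l -> 0 < c < T -> 0 <= t <= T -> - l <= x <= l ->
  (inward c t th, inward 0 x th) @[th --> 0^'+] --> within (cylinder l T) (nbhs (t, x)).
Proof.
move=> l0 cT tT xl A.
have l00 : - l < 0 < l by rewrite oppr_lt0 l0.
move=> [[P Q] [/= PN QN] PQ].
have cP : \forall th \near (0:R)^'+, P (inward c t th) := @inward_cvg c t P PN.
have cQ : \forall th \near (0:R)^'+, Q (inward 0 x th) := @inward_cvg 0 x Q QN.
have : \forall th \near (0:R)^'+, A (inward c t th, inward 0 x th); last by [].
near=> th; have th1 : 0 < th < 1 by near: th; exact: near_unit.
apply: PQ; first by split; near: th.
split; rewrite /= /Omega/= in_itv/=; first exact: inward_in cT tT th1.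
exact: inward_in l00 xl th1.
Unshelve. all: by end_near. Qed.

Lemma within_cylinder_proper l (T t x : R) : 0 < l -> 0 < T -> 0 <= t <= T ->
  - l <= x <= l -> ProperFilter (within (cylinder l T) (nbhs (t, x))).
Proof.
move=> l0 T0 tT xl; apply: Build_ProperFilter_ex => A HA.
have c0 : 0 < T / 2 < T by clear -T0; lra.
have /(_ A HA) : _ := inward_within l0 c0 tT xl.
by move=> /filter_ex[z Az]; exists z.
Qed.

(** Because $t<\tau$, points of the tall cylinder close enough to $(t,x)$ belong to the one of
    height [tau], where uniform continuity makes the image filter Cauchy. *)
Lemma bar_cvg l (tau T t x : R) w : 0 < l -> tau <= T -> 0 <= t < tau -> - l <= x <= l ->
  unif_cont l tau w ->
  w z.1 z.2 @[z --> within (cylinder l T) (nbhs (t, x))] --> bar l T w t x.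
Proof.
move=> l0 tauT /andP[t0 ttau] xl uc.
have tau0 : 0 < tau by exact: le_lt_trans ttau.
have T0 : 0 < T by exact: lt_le_trans tauT.
have tT : 0 <= t <= T by rewrite t0 (le_trans (ltW ttau)).
have PF := within_cylinder_proper l0 T0 tT xl.
apply: cauchy_cvg; apply: cauchy_exP => eps eps0.
have [|eta eta0 H] := uc (eps / 2); first by rewrite divr_gt0.
pose r := Num.min (eta / 2) (tau - t).
have r0 : 0 < r by rewrite lt_min divr_gt0//= subr_gt0.
have [r1 r2] : r <= eta / 2 /\ r <= tau - t by rewrite /r !ge_min !lexx ?orbT.
pose N := [set z | cylinder l T z /\ `|t - z.1| < r /\ `|x - z.2| < r].
have NF : within (cylinder l T) (nbhs (t, x)) N.
  exists (ball t r, ball x r); first by split; exact: nbhsx_ballx.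
  by move=> z [/= z1 z2] zc.
have zin z : N z -> 0 < z.1 < tau /\ - l < z.2 < l.
  move=> [[/=]]; rewrite /Omega/= !in_itv/= => /andP[z1 _] zl [+ _].
  by rewrite ltr_norml z1 => zt; split=> //; clear -zt r2; lra.
have [z0 Nz0] := filter_ex NF.
exists (w z0.1 z0.2); apply: filterS NF => z Nz.
have [a1 a2] := zin _ Nz; have [b1 b2] := zin _ Nz0.
rewrite /ball/=; apply: (@le_lt_trans _ _ (eps / 2)); last by clear -eps0; lra.
have [_ [c1 c2]] := Nz; have [_ [d1 d2]] := Nz0.
apply: H => //; move: c1 c2 d1 d2; rewrite !ltr_norml; clear -r1; lra.
Qed.

Lemma bar_path l (tau T c t x : R) w : 0 < l -> tau <= T -> 0 < c < T ->
  0 <= t < tau -> - l <= x <= l -> unif_cont l tau w ->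
  w (inward c t th) (inward 0 x th) @[th --> 0^'+] --> bar l T w t x.
Proof.
move=> l0 tauT cT tt xl uc.
have tT : 0 <= t <= T by case/andP: tt => -> ttau; exact: le_trans (ltW ttau) tauT.
exact: (cvg_comp _ _ (inward_within l0 cT tT xl) (bar_cvg l0 tauT tt xl uc)).
Qed.

Lemma bar_interior l (tau T t x : R) w : 0 < l -> tau <= T -> 0 < t < tau -> - l < x < l ->
  unif_cont l tau w -> bar l T w t x = w t x.
Proof.
move=> l0 tauT tt xl uc; have [t0 ttau] := andP tt.
have tT : 0 < t < T by rewrite t0 (lt_le_trans ttau).
have tt' : 0 <= t < tau by rewrite ltW.
have xl' : - l <= x <= l by case/andP: xl => /ltW -> /ltW ->.
(* With [t] itself as centre, time stays fixed along the path and only [x] moves. *)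
apply: (cvg_unique _ (bar_path l0 tauT tT tt' xl' uc)) => //.
apply/cvgrPdist_le => eps eps0; have [eta eta0 H] := uc _ eps0.
have x_cvg : inward 0 x th @[th --> 0^'+] --> x := @inward_cvg 0 x.
have x_near : \forall th \near 0^'+, `|x - inward 0 x th| < eta.
  by move/cvgrPdist_lt : x_cvg; apply.
have l00 : - l < 0 < l by rewrite oppr_lt0; move: xl; clear; lra.
near=> th; have th1 : 0 < th < 1 by near: th; exact: near_unit.
have -> : inward t t th = t by rewrite /inward subrr mulr0 addr0.
apply: H => //; first exact: inward_in l00 xl' th1.
  by rewrite subrr normr0.
by near: th.
Unshelve. all: by end_near. Qed.

Lemma MVT_dist (f g : R -> R) (a b p q C : R) :
  (forall z, p < z < q -> is_derive z 1 f (g z)) -> p < a < q -> p < b < q ->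
  (forall z, p < z < q -> `|z - a| <= `|b - a| -> `|g z| <= C) ->
  `|f b - f a| <= C * `|b - a|.
Proof.
move=> df aI bI gC.
have mvt x y : p < x < q -> p < y < q -> x <= y ->
    (forall z, x < z < y -> `|g z| <= C) -> `|f y - f x| <= C * (y - x).
  move=> /andP[px xq] /andP[py yq] xy gz.
  have sub z : x <= z <= y -> p < z < q.
    by move=> /andP[xz zy]; rewrite (lt_le_trans px xz) (le_lt_trans zy yq).
  apply: (@MVT_le _ f g) => // [|z /andP[xz zy]].
    apply: continuous_in_subspaceT => z; rewrite inE/= in_itv/= => /sub zI.
    exact: is_derive_continuous (df _ zI).
  by apply: df; apply: sub; rewrite !ltW.
have [ab|ba] := leP a b.
  rewrite [X in _ * X]ger0_norm ?subr_ge0//; apply: mvt => // z /andP[az zb].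
  apply: gC; first by case/andP: aI => h _; case/andP: bI => _ h'; rewrite (lt_trans h) ?(lt_trans zb).
  by rewrite !ger0_norm; clear -az zb ab; lra.
have ba0 : 0 <= a - b by rewrite subr_ge0 ltW.
rewrite distrC [X in _ * X]distrC [X in _ * X](ger0_norm ba0).
apply: mvt => //; first exact: ltW.
move=> z /andP[bz za].
apply: gC; first by case/andP: bI => h _; case/andP: aI => _ h'; rewrite (lt_trans h) ?(lt_trans za).
by rewrite !ler0_norm; clear -bz za ba; lra.
Qed.

Definition cyl_derivable l (tau : R) u := forall t x, 0 < t < tau -> - l < x < l ->
  [/\ is_derive t 1 (fun s => u s x) (d_t u t x),
      is_derive x 1 (u t) (d_x u t x) & is_derive x 1 (d_x u t) (d_xx u t x)].

Lemma unif_cont_holder l (tau : R) w (C a b : R) : 0 < a -> 0 < b -> 0 <= C ->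
  (forall t s x, 0 < t < tau -> 0 < s < tau -> - l < x < l ->
    `|w t x - w s x| <= C * `|t - s| `^ a) ->
  (forall t x y, 0 < t < tau -> - l < x < l -> - l < y < l ->
    `|w t x - w t y| <= C * `|x - y| `^ b) ->
  unif_cont l tau w.
Proof.
move=> a0 b0 C0 ht hx eps eps0.
have C1 : 0 < 2 * C + 1 by clear -C0; lra.
pose r := eps / (2 * C + 1).
have r0 : 0 < r by rewrite divr_gt0.
exists (Num.min (r `^ a^-1) (r `^ b^-1)); first by rewrite lt_min !powR_gt0.
move=> t s x y tt ss xl yl; rewrite !lt_min => /andP[ts _] /andP[_ xy].
have pw (k z : R) : 0 < k -> 0 <= z -> z < r `^ k^-1 -> z `^ k <= r.
  move=> k0 z0 zr; have -> : r = (r `^ k^-1) `^ k.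
    by rewrite -powRrM mulVf ?gt_eqF// powRr1// ltW.
  by apply: ge0_ler_powR; rewrite ?nnegrE ?powR_ge0// ltW.
have h1 := ht t s x tt ss xl; have h2 := hx s x y ss xl yl.
have h3 := ler_wpM2l C0 (pw _ _ a0 (normr_ge0 _) ts).
have h4 := ler_wpM2l C0 (pw _ _ b0 (normr_ge0 _) xy).
have -> : w t x - w s y = (w t x - w s x) + (w s x - w s y) by ring.
apply: le_trans (ler_normD _ _) _.
have : (2 * C + 1) * r = eps by rewrite mulrC divfK// gt_eqF.
by clear -h1 h2 h3 h4 r0; lra.
Qed.

Section Interior.
Variables (l tau al C : R) (u : R -> R -> R).
Hypotheses (al01 : 0 < al < 1) (C0 : 0 <= C).
Hypothesis du : cyl_derivable l tau u.
Hypothesis hb : holder_bounds al l `]0, tau[ u C.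

Let it t : 0 < t < tau -> `]0, tau[%classic t. Proof. by rewrite /= in_itv. Qed.
Let ix x : - l < x < l -> Omega l x. Proof. by rewrite /Omega/= in_itv. Qed.

Lemma cyl_lip_t t s x : 0 < t < tau -> 0 < s < tau -> - l < x < l ->
  `|u t x - u s x| <= C * `|t - s|.
Proof.
move=> tt ss xl.
apply: (@MVT_dist (fun s => u s x) (fun s => d_t u s x) s t 0 tau) => //.
  by move=> z zz; have [] := du zz xl.
by move=> z /it zz _; exact: (hb_t hb zz (ix xl)).
Qed.

Lemma cyl_lip_x t x y : 0 < t < tau -> - l < x < l -> - l < y < l ->
  `|u t x - u t y| <= C * `|x - y|.
Proof.
move=> tt xl yl.
apply: (@MVT_dist (u t) (d_x u t) y x (- l) l) => //.
  by move=> z zz; have [] := du tt zz.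
by move=> z /ix zz _; exact: (hb_x hb (it tt) zz).
Qed.

Lemma cyl_lip_dx t x y : 0 < t < tau -> - l < x < l -> - l < y < l ->
  `|d_x u t x - d_x u t y| <= C * `|x - y|.
Proof.
move=> tt xl yl.
have dd z : - l < z < l -> is_derive z 1 (d_x u t) (d_xx u t z).
  by move=> zz; have [] := du tt zz.
have bd z : - l < z < l -> `|z - y| <= `|x - y| -> `|d_xx u t z| <= C.
  by move=> /ix zz _; exact: (hb_xx hb (it tt) zz).
exact: (MVT_dist dd yl xl bd).
Qed.

Lemma unif_cont_u : unif_cont l tau u.
Proof.
apply: (@unif_cont_holder l tau u C 1 1) => // t s x *.
  by rewrite powRr1//; exact: cyl_lip_t.
by rewrite powRr1//; exact: cyl_lip_x.
Qed.

Lemma unif_cont_dx : unif_cont l tau (d_x u).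
Proof.
have /andP[al0 al1] := al01.
apply: (@unif_cont_holder l tau _ C ((1 + al) / 2) 1) => //.
- by rewrite divr_gt0// addr_gt0.
- by move=> t s x /it tt /it ss /ix xl; exact: (hb_x_t hb).
- by move=> t x y *; rewrite powRr1//; exact: cyl_lip_dx.
Qed.

Lemma unif_cont_dxx : unif_cont l tau (d_xx u).
Proof.
have /andP[al0 al1] := al01.
apply: (@unif_cont_holder l tau _ C (al / 2) al) => //.
- by rewrite divr_gt0.
- by move=> t s x /it tt /it ss /ix xl; exact: (hb_xx_t hb).
- by move=> t x y /it tt /ix xl /ix yl; exact: (hb_xx_x hb).
Qed.

Lemma unif_cont_dt : unif_cont l tau (d_t u).
Proof.
have /andP[al0 al1] := al01.
apply: (@unif_cont_holder l tau _ C (al / 2) al) => //.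
- by rewrite divr_gt0.
- by move=> t s x /it tt /it ss /ix xl; exact: (hb_t_t hb).
- by move=> t x y /it tt /ix xl /ix yl; exact: (hb_t_x hb).
Qed.

(** The radius [eta] is uniform over the cylinder. This is what lets the expansion survive the
    passage to boundary points. *)
Lemma cyl_taylor_t eps : 0 < eps -> exists2 eta, 0 < eta & forall t s x,
  0 < t < tau -> 0 < s < tau -> - l < x < l -> `|s - t| < eta ->
  `|u s x - u t x - d_t u t x * (s - t)| <= eps * `|s - t|.
Proof.
move=> eps0; have [eta eta0 H] := unif_cont_dt eps0; exists eta => // t s x tt ss xl st.
have -> : u s x - u t x - d_t u t x * (s - t) =
  (u s x - d_t u t x * (s - t)) - (u t x - d_t u t x * (t - t)) by ring.
apply: (@MVT_dist (fun z => u z x - d_t u t x * (z - t))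
  (fun z => d_t u z x - d_t u t x) t s 0 tau) => //.
  move=> z zz; have [dz _ _] := du zz xl.
  rewrite (_ : (fun _ => _) = (fun z => u z x) - (d_t u t x) *: (id - cst t)); last exact/funext.
  by apply: is_derive_eq; rewrite /GRing.scale/= subr0 mulr1.
move=> z zz zt; apply: H => //; last by rewrite subrr normr0.
exact: le_lt_trans st.
Qed.

Lemma cyl_taylor_x eps : 0 < eps -> exists2 eta, 0 < eta & forall t x y,
  0 < t < tau -> - l < x < l -> - l < y < l -> `|y - x| < eta ->
  `|u t y - u t x - d_x u t x * (y - x) - d_xx u t x / 2 * (y - x) ^+ 2| <= eps * (y - x) ^+ 2.
Proof.
move=> eps0; have [eta eta0 H] := unif_cont_dxx eps0; exists eta => // t x y tt xl yl xy.
have inner z : - l < z < l -> `|z - x| <= `|y - x| ->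
    `|d_x u t z - d_x u t x - d_xx u t x * (z - x)| <= eps * `|z - x|.
  move=> zl zx; have -> : d_x u t z - d_x u t x - d_xx u t x * (z - x) =
    (d_x u t z - d_xx u t x * (z - x)) - (d_x u t x - d_xx u t x * (x - x)) by ring.
  apply: (@MVT_dist (fun r => d_x u t r - d_xx u t x * (r - x))
    (fun r => d_xx u t r - d_xx u t x) x z (- l) l) => //.
    move=> r rl; have [_ _ dr] := du tt rl.
    rewrite (_ : (fun _ => _) = d_x u t - (d_xx u t x) *: (id - cst x)); last exact/funext.
    by apply: is_derive_eq; rewrite /GRing.scale/= subr0 mulr1.
  move=> r rl rx; apply: H => //; first by rewrite subrr normr0.
  exact: le_lt_trans (le_trans rx zx) xy.
pose phi r := u t r - d_x u t x * (r - x) - d_xx u t x / 2 * (r - x) ^+ 2.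
have -> : u t y - u t x - d_x u t x * (y - x) - d_xx u t x / 2 * (y - x) ^+ 2 =
  phi y - phi x by rewrite /phi; ring.
rewrite -[X in _ <= _ * X]real_normK ?num_real// expr2 mulrA.
apply: (@MVT_dist phi (fun r => d_x u t r - d_x u t x - d_xx u t x * (r - x)) x y (- l) l) => //.
  move=> r rl; have [_ dr _] := du tt rl.
  rewrite (_ : phi = u t - (d_x u t x) *: (id - cst x) - (d_xx u t x / 2) *: (id - cst x) ^+ 2).
    apply: is_derive_eq.
    rewrite /GRing.scale/= !(mulr1, expr1, subr0).
    have -> : (id - cst x) r = r - x by [].
    by field.
  by apply/funext => v; rewrite /phi !fctE.
move=> r rl rx; apply: le_trans (inner _ rl rx) _.
by rewrite ler_wpM2l// ltW.
Qed.

End Interior.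

End Extension.

(** * Regularity of the extension up to the lateral boundary *)

Section BarClassical.
Context {R : realType}.
Variables (l T tau al C : R) (u : R -> R -> R).
Hypotheses (l0 : 0 < l) (tauT : tau <= T) (tau0 : 0 < tau) (al01 : 0 < al < 1) (C0 : 0 <= C).
Hypothesis du : cyl_derivable l tau u.
Hypothesis hb : holder_bounds al l `]0, tau[ u C.

Let c := tau / 2.
Let cT : 0 < c < T.
Proof. by move: tau0 tauT; rewrite /c => h1 h2; lra. Qed.
Let ctau : 0 < c < tau.
Proof. by move: tau0 tauT; rewrite /c => h1 h2; lra. Qed.
Let c0 : - l < 0 < l.
Proof. by rewrite oppr_lt0 l0. Qed.
Let tin (t th : R) : 0 <= t < tau -> 0 < th < 1 -> 0 < inward c t th < tau.
Proof. by move=> /andP[t0 t1]; apply: inward_in => //; rewrite t0 ltW. Qed.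
Let xin (x th : R) : - l <= x <= l -> 0 < th < 1 -> - l < inward 0 x th < l.
Proof. exact: inward_in. Qed.

Lemma bar_norm_le w (B t x : R) : unif_cont l tau w ->
  (forall t x, 0 < t < tau -> - l < x < l -> `|w t x| <= B) ->
  0 <= t < tau -> - l <= x <= l -> `|bar l T w t x| <= B.
Proof.
move=> uc wB tt xl.
apply: (cvgr_to_le (cvg_norm (bar_path l0 tauT cT tt xl uc))).
near=> th; have th1 : 0 < th < 1 by near: th; exact: near_unit.
by apply: wB; [exact: tin|exact: xin].
Unshelve. all: by end_near. Qed.

(** Both points are moved inwards with the same [th], so that their distance does not increase on
    the way. *)
Lemma bar_dist_le w (B t s x y : R) : unif_cont l tau w ->
  (forall th, 0 < th < 1 -> `|w (inward c t th) (inward 0 x th) -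
     w (inward c s th) (inward 0 y th)| <= B) ->
  0 <= t < tau -> 0 <= s < tau -> - l <= x <= l -> - l <= y <= l ->
  `|bar l T w t x - bar l T w s y| <= B.
Proof.
move=> uc wB tt ss xl yl.
apply: (cvgr_to_le (cvg_norm (cvgB (bar_path l0 tauT cT tt xl uc)
  (bar_path l0 tauT cT ss yl uc)))).
near=> th; apply: wB; near: th; exact: near_unit.
Unshelve. all: by end_near. Qed.

Lemma bar_lip (ta tau1 : R) : 0 <= ta -> tau1 < tau -> lip2 l ta tau1 (bar l T u) C.
Proof.
move=> ta0 t1tau t s x y tt ss xl yl.
have sub z : ta <= z <= tau1 -> 0 <= z < tau.
  by move=> /andP[z1 z2]; rewrite (le_trans ta0 z1) (le_lt_trans z2).
apply: (bar_dist_le _ _ (sub _ tt) (sub _ ss) xl yl); first exact: unif_cont_u C0 du hb.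
move=> th th1.
have t1 := tin (sub _ tt) th1; have s1 := tin (sub _ ss) th1.
have x1 := xin xl th1; have y1 := xin yl th1.
have h1 := cyl_lip_t du hb t1 s1 x1; have h2 := cyl_lip_x du hb s1 x1 y1.
have h3 := ler_wpM2l C0 (inward_dist c t s th1).
have h4 := ler_wpM2l C0 (inward_dist 0 x y th1).
have -> : u (inward c t th) (inward 0 x th) - u (inward c s th) (inward 0 y th) =
  (u (inward c t th) (inward 0 x th) - u (inward c s th) (inward 0 x th)) +
  (u (inward c s th) (inward 0 x th) - u (inward c s th) (inward 0 y th)) by ring.
apply: le_trans (ler_normD _ _) _.
lra.
Qed.

Lemma bar_dt_holder_x (t x y : R) : 0 <= t < tau -> - l <= x <= l -> - l <= y <= l ->
  `|bar l T (d_t u) t x - bar l T (d_t u) t y| <= C * `|x - y| `^ al.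
Proof.
have /andP[al0 _] := al01; move=> tt xl yl.
apply: bar_dist_le => //; first exact: unif_cont_dt al01 C0 hb.
move=> th th1; have t1 := tin tt th1; have x1 := xin xl th1; have y1 := xin yl th1.
apply: (le_trans (hb_t_x hb _ _ _)); rewrite /= /Omega/= ?in_itv//=.
apply: ler_wpM2l => //; apply: ge0_ler_powR; rewrite ?nnegrE//; first exact: ltW.
exact: inward_dist.
Qed.

Lemma bar_taylor_t (t x : R) : 0 <= t < tau -> - l <= x <= l ->
  taylor1 `[0, tau[ ((bar l T u) ^~ x) t (bar l T (d_t u) t x).
Proof.
move=> tt xl eps eps0; have [eta eta0 H] := cyl_taylor_t al01 C0 du hb eps0.
exists eta => // s; rewrite /= in_itv/= => ss st.
have ucu := unif_cont_u C0 du hb; have uct := unif_cont_dt al01 C0 hb.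
have lim : `|u (inward c s th) (inward 0 x th) - u (inward c t th) (inward 0 x th) -
    d_t u (inward c t th) (inward 0 x th) * (inward c s th - inward c t th)|
    @[th --> 0^'+] -->
    `|bar l T u s x - bar l T u t x - bar l T (d_t u) t x * (s - t)|.
  exact: (cvg_norm (cvgB (cvgB (bar_path l0 tauT cT ss xl ucu)
    (bar_path l0 tauT cT tt xl ucu)) (cvgM (bar_path l0 tauT cT tt xl uct)
    (cvgB (@inward_cvg _ c s) (@inward_cvg _ c t))))).
apply: (cvgr_to_le lim).
near=> th; have th1 : 0 < th < 1 by near: th; exact: near_unit.
have sth := inward_dist c s t th1.
apply: (le_trans (H _ _ _ (tin tt th1) (tin ss th1) (xin xl th1) (le_lt_trans sth st))).
by rewrite ler_wpM2l// ltW.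
Unshelve. all: by end_near. Qed.

Lemma bar_taylor_x (t x : R) : 0 <= t < tau -> - l <= x <= l ->
  taylor2 `[- l, l] (bar l T u t) x (bar l T (d_x u) t x) (bar l T (d_xx u) t x).
Proof.
move=> tt xl eps eps0; have [eta eta0 H] := cyl_taylor_x al01 C0 du hb eps0.
exists eta => // y; rewrite /= in_itv/= => yl yx.
have ucu := unif_cont_u C0 du hb; have ucx := unif_cont_dx al01 C0 du hb.
have ucxx := unif_cont_dxx al01 C0 hb.
have dyx : inward 0 y th - inward 0 x th @[th --> 0^'+] --> y - x.
  exact: (cvgB (@inward_cvg _ 0 y) (@inward_cvg _ 0 x)).
have sq : (inward 0 y th - inward 0 x th) ^+ 2 @[th --> 0^'+] --> (y - x) ^+ 2.
  exact: (cvg_comp _ _ dyx (@exprn_continuous _ 2 (y - x))).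
have half : d_xx u (inward c t th) (inward 0 x th) / 2 @[th --> 0^'+] -->
    bar l T (d_xx u) t x / 2.
  by apply: cvgMl; exact: (bar_path l0 tauT cT tt xl ucxx).
have lim : `|u (inward c t th) (inward 0 y th) - u (inward c t th) (inward 0 x th) -
    d_x u (inward c t th) (inward 0 x th) * (inward 0 y th - inward 0 x th) -
    d_xx u (inward c t th) (inward 0 x th) / 2 * (inward 0 y th - inward 0 x th) ^+ 2|
    @[th --> 0^'+] -->
    `|bar l T u t y - bar l T u t x - bar l T (d_x u) t x * (y - x) -
      bar l T (d_xx u) t x / 2 * (y - x) ^+ 2|.
  exact: (cvg_norm (cvgB (cvgB (cvgB (bar_path l0 tauT cT tt yl ucu)
    (bar_path l0 tauT cT tt xl ucu)) (cvgM (bar_path l0 tauT cT tt xl ucx) dyx))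
    (cvgM half sq))).
apply: (cvgr_to_le lim).
near=> th; have th1 : 0 < th < 1 by near: th; exact: near_unit.
have yth := inward_dist 0 y x th1.
apply: (le_trans (H _ _ _ (tin tt th1) (xin xl th1) (xin yl th1) (le_lt_trans yth yx))).
apply: ler_wpM2l; first exact: ltW.
by rewrite -real_normK ?num_real// -[leRHS]real_normK ?num_real// ler_sqr ?nnegrE.
Unshelve. all: by end_near. Qed.

Lemma bar_classical (ta tau1 : R) : 0 <= ta -> tau1 < tau ->
  classical l ta tau1 (bar l T u) (bar l T (d_t u)) (bar l T (d_x u)) (bar l T (d_xx u)).
Proof.
move=> ta0 t1tau.
have sub (z : R) : ta < z <= tau1 -> 0 <= z < tau.
  by move=> /andP[z1 z2]; rewrite (le_trans ta0 (ltW z1)) (le_lt_trans z2).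
split.
- by exists C => //; exact: bar_lip.
- move=> t x /sub tt xl; apply: taylor1_sub (bar_taylor_t tt xl) => z.
  by rewrite /= !in_itv/= => /andP[z1 z2]; rewrite (le_trans ta0 z1) (le_lt_trans z2).
- by move=> t x /sub tt xl; apply: taylor2_taylor1 (bar_taylor_x tt xl).
- by move=> t x /sub tt xl; apply: bar_taylor_x => //; case/andP: xl => /ltW -> /ltW ->.
Qed.

End BarClassical.

(** * Coefficients on compact sets *)

Section Coefficients.
Context {R : realType}.
Implicit Types (l t x z p : R).

Lemma is_derive_along (V : normedModType R) (h : V -> R) (psi : R -> R) (y v : V) (s : R) :
  derivable h y v -> (forall e : R, psi (e + s) = h (e *: v + y)) ->
  is_derive s 1 psi ('D_v h y).
Proof.
move=> dh E.
have E0 : psi s = h y by have := E 0; rewrite scale0r !add0r.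
have F : (fun e : R => e^-1 *: ((psi \o shift s) (e *: (1 : R)) - psi s)) =
    (fun e : R => e^-1 *: ((h \o shift y) (e *: v) - h y)).
  by apply/funext => e /=; rewrite E0 -E /GRing.scale/= mulr1.
by split; rewrite /derivable /derive F.
Qed.

(** In the interior the derivative agrees with a function continuous on all of [S], which is bounded
    on the compact [K] even where [K] meets the boundary of [S]. *)
Lemma class_C_derive_bound (V : normedModType R) (S K : set V) (h : V -> R) (v : V) :
  compact K -> K `<=` S -> class_C 2 S h ->
  exists2 C : R, 0 <= C & forall y, K y -> S° y ->
    derivable h y v /\ `|'D_v h y| <= C.
Proof.
move=> cK KS [_ [_ /(_ v) [dh [[k ck hk] _]]]].
have ckK : {within K, continuous k} by exact: continuous_subspaceW ck.
have [M [_ HM]] := compact_bounded (continuous_compact ckK cK).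
have M1 : M < `|M| + 1 by have := ler_norm M; lra.
exists (`|M| + 1) => [|y Ky Sy]; first by have := normr_ge0 M; lra.
split; first exact: dh.
by rewrite hk//; apply: (HM _ M1); exists y.
Qed.

Lemma within_continuous_bound (V : normedModType R) (S K : set V) (h : V -> R) :
  compact K -> K `<=` S -> {within S, continuous h} ->
  exists2 C : R, 0 <= C & forall y, K y -> `|h y| <= C.
Proof.
move=> cK KS ck.
have ckK : {within K, continuous h} by exact: continuous_subspaceW ck.
have [M [_ HM]] := compact_bounded (continuous_compact ckK cK).
have M1 : M < `|M| + 1 by have := ler_norm M; lra.
exists (`|M| + 1) => [|y Ky]; first by have := normr_ge0 M; lra.
by apply: (HM _ M1); exists y.
Qed.

Section FourVariables.
Variables (l T M N : R) (h : R -> R -> R -> R -> R).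
Hypotheses (l0 : 0 < l) (T0 : 0 < T) (M0 : 0 <= M) (N0 : 0 <= N).
Hypothesis hC : class_C 2 (coef_domain l T) (uncurry4 h).

(** The margin 1 puts $[-M,M]$ and $[-N,N]$ inside open intervals on which the mean value theorem
    applies. *)
Let K : set (R * R * R * R) := `[0, T] `*` `[- l, l] `*` `[- (M + 1), M + 1] `*`
  `[- (N + 1), N + 1].

Let cK : compact K.
Proof.
exact: (compact_setX (compact_setX (compact_setX (@segment_compact _ _ _)
    (@segment_compact _ _ _)) (@segment_compact _ _ _)) (@segment_compact _ _ _)).
Qed.

Let KS : K `<=` coef_domain l T.
Proof. by move=> q [[[q1 q2] _] _]; split. Qed.

Lemma coef_domain_interior t x z p : 0 < t < T -> - l < x < l ->
  (coef_domain l T)° (t, x, z, p).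
Proof.
move=> tT xl.
have nb (a b y : R) : a < y < b -> nbhs y `[a, b]%classic.
  move=> ayb; have yI : y \in `]a, b[%R by rewrite in_itv.
  apply: filterS (near_in_itvoo yI) => w.
  by rewrite /= !in_itv/= => /andP[/ltW -> /ltW ->].
exists (`[0, T] `*` `[- l, l] `*` setT, setT); last by move=> q [/= q1 q2]; split.
split=> /=; last exact: filterT.
exists (`[0, T] `*` `[- l, l], setT); last by move=> q [/= q1 q2]; split.
split=> /=; last exact: filterT.
by exists (`[0, T]%classic, `[- l, l]%classic) => //; split; exact: nb.
Qed.

(** Inside the domain the variables are changed one at a time, with bounded partial derivatives. The
    derivatives exist only there, so the faces $t\in\{0,T\}$ and $x=\pm l$ are reached by continuity
    along [inward] paths. *)
Lemma coef_lipschitz : exists2 C : R, 0 <= C & forall t x z p t' x' z' p',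
  0 <= t <= T -> 0 <= t' <= T -> - l <= x <= l -> - l <= x' <= l ->
  - M <= z <= M -> - M <= z' <= M -> - N <= p <= N -> - N <= p' <= N ->
  `|h t x z p - h t' x' z' p'| <= C * (`|t - t'| + `|x - x'| + `|z - z'| + `|p - p'|).
Proof.
pose e1 : R * R * R * R := (1, 0, 0, 0); pose e2 : R * R * R * R := (0, 1, 0, 0).
pose e3 : R * R * R * R := (0, 0, 1, 0); pose e4 : R * R * R * R := (0, 0, 0, 1).
have [C1 C10 H1] := class_C_derive_bound e1 cK KS hC.
have [C2 C20 H2] := class_C_derive_bound e2 cK KS hC.
have [C3 C30 H3] := class_C_derive_bound e3 cK KS hC.
have [C4 C40 H4] := class_C_derive_bound e4 cK KS hC.
pose C := C1 + C2 + C3 + C4.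
have C0 : 0 <= C by rewrite !addr_ge0.
have zM z : - M <= z <= M -> - (M + 1) < z < M + 1 by lra.
have pN p : - N <= p <= N -> - (N + 1) < p < N + 1 by lra.
have inK t x z p : 0 < t < T -> - l < x < l -> - (M + 1) < z < M + 1 ->
    - (N + 1) < p < N + 1 -> K (t, x, z, p) /\ (coef_domain l T)° (t, x, z, p).
  move=> tT xl zl pl; split; last exact: coef_domain_interior.
  by rewrite /K/= !in_itv/=; do !split; rewrite /= ?in_itv/=; apply/andP; split; apply: ltW;
     [case/andP: tT|case/andP: tT|case/andP: xl|case/andP: xl|case/andP: zl|case/andP: zl
     |case/andP: pl|case/andP: pl].
have I1 t t' x z p : 0 < t < T -> 0 < t' < T -> - l < x < l -> - (M + 1) < z < M + 1 ->
    - (N + 1) < p < N + 1 -> `|h t x z p - h t' x z p| <= C1 * `|t - t'|.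
  move=> tT tT' xl zl pl.
  apply: (@MVT_dist _ (fun s => h s x z p) (fun s => 'D_e1 (uncurry4 h) (s, x, z, p)) t' t 0 T) => //.
    move=> s sT; have [k1 k2] := inK s x z p sT xl zl pl; have [k3 _] := H1 _ k1 k2.
    apply: (is_derive_along k3) => e; rewrite /uncurry4/= /GRing.scale/=.
    by rewrite !mulr0 !add0r mulr1.
  by move=> s sT _; have [k1 k2] := inK s x z p sT xl zl pl; have [_] := H1 _ k1 k2.
have I2 t x x' z p : 0 < t < T -> - l < x < l -> - l < x' < l -> - (M + 1) < z < M + 1 ->
    - (N + 1) < p < N + 1 -> `|h t x z p - h t x' z p| <= C2 * `|x - x'|.
  move=> tT xl xl' zl pl.
  apply: (@MVT_dist _ (fun s => h t s z p) (fun s => 'D_e2 (uncurry4 h) (t, s, z, p)) x' x (- l) l) => //.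
    move=> s sl; have [k1 k2] := inK t s z p tT sl zl pl; have [k3 _] := H2 _ k1 k2.
    apply: (is_derive_along k3) => e; rewrite /uncurry4/= /GRing.scale/=.
    by rewrite !mulr0 !add0r mulr1.
  by move=> s sl _; have [k1 k2] := inK t s z p tT sl zl pl; have [_] := H2 _ k1 k2.
have I3 t x z z' p : 0 < t < T -> - l < x < l -> - (M + 1) < z < M + 1 ->
    - (M + 1) < z' < M + 1 ->
    - (N + 1) < p < N + 1 -> `|h t x z p - h t x z' p| <= C3 * `|z - z'|.
  move=> tT xl zl zl' pl.
  apply: (@MVT_dist _ (fun s => h t x s p) (fun s => 'D_e3 (uncurry4 h) (t, x, s, p)) z' z
     (- (M + 1)) (M + 1)) => //.
    move=> s sl; have [k1 k2] := inK t x s p tT xl sl pl; have [k3 _] := H3 _ k1 k2.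
    apply: (is_derive_along k3) => e; rewrite /uncurry4/= /GRing.scale/=.
    by rewrite !mulr0 !add0r mulr1.
  by move=> s sl _; have [k1 k2] := inK t x s p tT xl sl pl; have [_] := H3 _ k1 k2.
have I4 t x z p p' : 0 < t < T -> - l < x < l -> - (M + 1) < z < M + 1 ->
    - (N + 1) < p < N + 1 -> - (N + 1) < p' < N + 1 ->
    `|h t x z p - h t x z p'| <= C4 * `|p - p'|.
  move=> tT xl zl pl pl'.
  apply: (@MVT_dist _ (fun s => h t x z s) (fun s => 'D_e4 (uncurry4 h) (t, x, z, s)) p' p
     (- (N + 1)) (N + 1)) => //.
    move=> s sl; have [k1 k2] := inK t x z s tT xl zl sl; have [k3 _] := H4 _ k1 k2.
    apply: (is_derive_along k3) => e; rewrite /uncurry4/= /GRing.scale/=.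
    by rewrite !mulr0 !add0r mulr1.
  by move=> s sl _; have [k1 k2] := inK t x z s tT xl zl sl; have [_] := H4 _ k1 k2.
have int t x z p t' x' z' p' : 0 < t < T -> 0 < t' < T -> - l < x < l -> - l < x' < l ->
    - M <= z <= M -> - M <= z' <= M -> - N <= p <= N -> - N <= p' <= N ->
    `|h t x z p - h t' x' z' p'| <= C * (`|t - t'| + `|x - x'| + `|z - z'| + `|p - p'|).
  move=> tT tT' xl xl' /zM zl /zM zl' /pN pl /pN pl'.
  have h1 := I1 t t' x z p tT tT' xl zl pl; have h2 := I2 t' x x' z p tT' xl xl' zl pl.
  have h3 := I3 t' x' z z' p tT' xl' zl zl' pl; have h4 := I4 t' x' z' p p' tT' xl' zl' pl pl'.
  have -> : h t x z p - h t' x' z' p' = (h t x z p - h t' x z p) +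
    (h t' x z p - h t' x' z p) + (h t' x' z p - h t' x' z' p) +
    (h t' x' z' p - h t' x' z' p') by ring.
  apply: le_trans (ler_normD _ _) _; apply: le_trans (lerD (ler_normD _ _) (lexx _)) _.
  apply: le_trans (lerD (lerD (ler_normD _ _) (lexx _)) (lexx _)) _.
  have m1 : C1 * `|t - t'| <= C * `|t - t'|.
    by rewrite ler_wpM2r// /C -!addrA lerDl !addr_ge0.
  have m2 : C2 * `|x - x'| <= C * `|x - x'|.
    by rewrite ler_wpM2r// /C (addrC C1) -!addrA lerDl !addr_ge0.
  have m3 : C3 * `|z - z'| <= C * `|z - z'|.
    by rewrite ler_wpM2r// /C [_ + C3]addrC -!addrA lerDl !addr_ge0.
  have m4 : C4 * `|p - p'| <= C * `|p - p'|.
    by rewrite ler_wpM2r// /C lerDr !addr_ge0.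
  by rewrite !mulrDr !lerD// (le_trans h1 m1, le_trans h2 m2, le_trans h3 m3, le_trans h4 m4).
exists C => // t x z p t' x' z' p' tT tT' xl xl' zl zl' pl pl'.
have c0 : 0 < T / 2 < T by move: T0 => T00; lra.
have l00 : - l < 0 < l by rewrite oppr_lt0 l0.
have path a y : 0 <= a <= T -> - l <= y <= l -> forall w q,
   h (inward (T / 2) a th) (inward 0 y th) w q @[th --> 0^'+] --> h a y w q.
  move=> aT yl w q; have [ch _] := hC; move/subspace_continuousP: ch.
  have S : coef_domain l T (a, y, w, q) by rewrite /coef_domain/= !in_itv/=.
  move=> /(_ _ S) ch.
  have lim : (inward (T / 2) a th, inward 0 y th, w, q) @[th --> (0:R)^'+] -->
      within (coef_domain l T) (nbhs (a, y, w, q)).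
    move=> A [[P Q] [/= [[P1 P2] [/= [[P3 P4] [/= P3N P4N] P34] P2N] P12] QN] PQ].
    have cP3 : \forall th \near (0:R)^'+, P3 (inward (T / 2) a th) := @inward_cvg _ _ _ _ P3N.
    have cP4 : \forall th \near (0:R)^'+, P4 (inward 0 y th) := @inward_cvg _ _ _ _ P4N.
    have : \forall th \near (0:R)^'+, A (inward (T / 2) a th, inward 0 y th, w, q); last by [].
    near=> th; have th1 : 0 < th < 1 by near: th; exact: near_unit.
    apply: PQ.
      split; last exact: nbhs_singleton QN.
      apply: P12; split; last exact: nbhs_singleton P2N.
      by apply: P34; split; near: th.
    have /andP[/ltW i1 /ltW i2] := inward_in c0 aT th1.
    have /andP[/ltW i3 /ltW i4] := inward_in l00 yl th1.
    by rewrite /coef_domain/= !in_itv/= i1 i2 i3 i4.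
  exact: (cvg_comp _ _ lim ch).
apply: (cvgr_to_le (cvg_norm (cvgB (path t x tT xl z p) (path t' x' tT' xl' z' p')))).
near=> th; have th1 : 0 < th < 1 by near: th; exact: near_unit.
apply: le_trans (int _ _ _ _ _ _ _ _ (inward_in c0 tT th1) (inward_in c0 tT' th1)
  (inward_in l00 xl th1) (inward_in l00 xl' th1) zl zl' pl pl') _.
by apply: ler_wpM2l => //; rewrite !lerD// inward_dist.
Unshelve. all: by end_near. Qed.

Lemma coef_bound : exists2 C : R, 0 <= C & forall t x z p,
  0 <= t <= T -> - l <= x <= l -> - M <= z <= M -> - N <= p <= N -> `|h t x z p| <= C.
Proof.
have [C C0 H] := within_continuous_bound cK KS (proj1 hC); exists C => // t x z p tT xl zl pl.
by apply: (H (t, x, z, p)); rewrite /K/= !in_itv/=; do !split; rewrite ?tT ?xl//; lra.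
Qed.

Lemma coef_lower_bound :
  (forall t x z p, 0 <= t <= T -> - l <= x <= l -> 0 < h t x z p) ->
  exists2 c : R, 0 < c & forall t x z p,
  0 <= t <= T -> - l <= x <= l -> - M <= z <= M -> - N <= p <= N -> c <= h t x z p.
Proof.
move=> hpos.
have K0 : K !=set0.
  by exists (0, 0, 0, 0); rewrite /K/= !in_itv/=; do !split; move: l0 T0 M0 N0 => *; lra.
have ch : {within K, continuous (uncurry4 h)}.
  exact: continuous_subspaceW (proj1 hC).
have [[[[t0 x0] z0] p0]] := compact_EVT_min K0 cK ch.
rewrite inE => -[[[/= t0K x0K] _] _] Hm; rewrite !in_itv/= in t0K x0K.
exists (h t0 x0 z0 p0) => [|t x z p tT xl zl pl]; first exact: hpos.
apply: (Hm (t, x, z, p)); rewrite inE /K/= !in_itv/=; do !split; rewrite ?tT ?xl//; lra.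
Qed.

End FourVariables.

Section TwoVariables.
Variables (T M : R) (h : R -> R -> R).
Hypotheses (T0 : 0 < T) (M0 : 0 <= M).
Hypothesis hC : class_C 2 (bdry_domain T) (fun q : R * R => h q.1 q.2).

Let K : set (R * R) := `[0, T] `*` `[- (M + 1), M + 1].

Let cK : compact K.
Proof. exact: (compact_setX (@segment_compact _ _ _) (@segment_compact _ _ _)). Qed.

Let KS : K `<=` bdry_domain T.
Proof. by move=> q [q1 _]; split. Qed.

Lemma bdry_lipschitz : exists2 C : R, 0 <= C & forall t z t' z',
  0 <= t <= T -> 0 <= t' <= T -> - M <= z <= M -> - M <= z' <= M ->
  `|h t z - h t' z'| <= C * (`|t - t'| + `|z - z'|).
Proof.
pose e1 : R * R := (1, 0); pose e2 : R * R := (0, 1).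
have [C1 C10 H1] := class_C_derive_bound e1 cK KS hC.
have [C2 C20 H2] := class_C_derive_bound e2 cK KS hC.
pose C := C1 + C2.
have C0 : 0 <= C by rewrite !addr_ge0.
have zM z : - M <= z <= M -> - (M + 1) < z < M + 1 by lra.
have inK t z : 0 < t < T -> - (M + 1) < z < M + 1 ->
    K (t, z) /\ (bdry_domain T)° (t, z).
  move=> tT zl; split.
    by rewrite /K/= !in_itv/=; do !split; rewrite /= ?in_itv/=; apply/andP; split; apply: ltW;
     [case/andP: tT|case/andP: tT|case/andP: zl|case/andP: zl].
  have tI : t \in `]0, T[%R by rewrite in_itv.
  exists (`[0, T]%classic, setT); last by move=> q [/= q1 q2]; split.
  split=> /=; last exact: filterT.
  by apply: filterS (near_in_itvoo tI) => w; rewrite /= !in_itv/= => /andP[/ltW -> /ltW ->].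
have I1 t t' z : 0 < t < T -> 0 < t' < T -> - (M + 1) < z < M + 1 ->
    `|h t z - h t' z| <= C1 * `|t - t'|.
  move=> tT tT' zl.
  apply: (@MVT_dist _ (fun s => h s z) (fun s => 'D_e1 (fun q => h q.1 q.2) (s, z)) t' t 0 T) => //.
    move=> s sT; have [k1 k2] := inK s z sT zl; have [k3 _] := H1 _ k1 k2.
    apply: (is_derive_along k3) => e; rewrite /= /GRing.scale/=.
    by rewrite !mulr0 !add0r mulr1.
  by move=> s sT _; have [k1 k2] := inK s z sT zl; have [_] := H1 _ k1 k2.
have I2 t z z' : 0 < t < T -> - (M + 1) < z < M + 1 -> - (M + 1) < z' < M + 1 ->
    `|h t z - h t z'| <= C2 * `|z - z'|.
  move=> tT zl zl'.
  apply: (@MVT_dist _ (fun s => h t s) (fun s => 'D_e2 (fun q => h q.1 q.2) (t, s)) z' z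
     (- (M + 1)) (M + 1)) => //.
    move=> s sl; have [k1 k2] := inK t s tT sl; have [k3 _] := H2 _ k1 k2.
    apply: (is_derive_along k3) => e; rewrite /= /GRing.scale/=.
    by rewrite !mulr0 !add0r mulr1.
  by move=> s sl _; have [k1 k2] := inK t s tT sl; have [_] := H2 _ k1 k2.
have int t z t' z' : 0 < t < T -> 0 < t' < T -> - M <= z <= M -> - M <= z' <= M ->
    `|h t z - h t' z'| <= C * (`|t - t'| + `|z - z'|).
  move=> tT tT' /zM zl /zM zl'.
  have h1 := I1 t t' z tT tT' zl; have h2 := I2 t' z z' tT' zl zl'.
  have -> : h t z - h t' z' = (h t z - h t' z) + (h t' z - h t' z') by ring.
  apply: le_trans (ler_normD _ _) _.
  have m1 : C1 * `|t - t'| <= C * `|t - t'| by rewrite ler_wpM2r// /C lerDl.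
  have m2 : C2 * `|z - z'| <= C * `|z - z'| by rewrite ler_wpM2r// /C lerDr.
  by rewrite !mulrDr !lerD// (le_trans h1 m1, le_trans h2 m2).
exists C => // t z t' z' tT tT' zl zl'.
have c0 : 0 < T / 2 < T by move: T0 => T00; lra.
have path a : 0 <= a <= T -> forall w,
   h (inward (T / 2) a th) w @[th --> 0^'+] --> h a w.
  move=> aT w; have [ch _] := hC; move/subspace_continuousP: ch.
  have S : bdry_domain T (a, w) by rewrite /bdry_domain/= !in_itv/=.
  move=> /(_ _ S) ch.
  have lim : (inward (T / 2) a th, w) @[th --> (0:R)^'+] -->
      within (bdry_domain T) (nbhs (a, w)).
    move=> A [[P Q] [/= PN QN] PQ].
    have cP : \forall th \near (0:R)^'+, P (inward (T / 2) a th) := @inward_cvg _ _ _ _ PN.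
    have : \forall th \near (0:R)^'+, A (inward (T / 2) a th, w); last by [].
    near=> th; have th1 : 0 < th < 1 by near: th; exact: near_unit.
    apply: PQ; first by split; [near: th|exact: nbhs_singleton QN].
    have /andP[/ltW i1 /ltW i2] := inward_in c0 aT th1.
    by rewrite /bdry_domain/= !in_itv/= i1 i2.
  exact: (cvg_comp _ _ lim ch).
apply: (cvgr_to_le (cvg_norm (cvgB (path t tT z) (path t' tT' z')))).
near=> th; have th1 : 0 < th < 1 by near: th; exact: near_unit.
apply: le_trans (int _ _ _ _ (inward_in c0 tT th1) (inward_in c0 tT' th1) zl zl') _.
by apply: ler_wpM2l => //; rewrite !lerD// inward_dist.
Unshelve. all: by end_near. Qed.

Lemma bdry_bound : exists2 C : R, 0 <= C & forall t z,
  0 <= t <= T -> - M <= z <= M -> `|h t z| <= C.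
Proof.
have [C C0 H] := within_continuous_bound cK KS (proj1 hC); exists C => // t z tT zl.
by apply: (H (t, z)); rewrite /K/= !in_itv/=; do !split; rewrite ?tT//; lra.
Qed.

Lemma bdry_lower_bound : (forall t z, 0 <= t <= T -> 0 < h t z) ->
  exists2 c : R, 0 < c & forall t z, 0 <= t <= T -> - M <= z <= M -> c <= h t z.
Proof.
move=> hpos.
have K0 : K !=set0.
  by exists (0, 0); rewrite /K/= !in_itv/=; do !split; move: T0 M0 => *; lra.
have ch : {within K, continuous (fun q : R * R => h q.1 q.2)}.
  exact: continuous_subspaceW (proj1 hC).
have [[t0 z0]] := compact_EVT_min K0 cK ch.
rewrite inE => -[/= t0K _] Hm; rewrite !in_itv/= in t0K.
exists (h t0 z0) => [|t z tT zl]; first exact: hpos.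
by apply: (Hm (t, z)); rewrite inE /K/= !in_itv/=; do !split; rewrite ?tT//; lra.
Qed.

End TwoVariables.

End Coefficients.

(** * Gradient bound *)

Section GradientBarrier.
Context {R : realType}.
Implicit Types (A x y s d : R).

Lemma antiderivative (f : R -> R) A : continuous f ->
  exists F : R -> R, forall x, A < x -> is_derive x 1 F (f x).
Proof.
move=> cf; exists (fun x => (\int[lebesgue_measure]_(t in `[A, x]) (f t))%R) => x Ax.
have int : lebesgue_measure.-integrable `[A, x + 1] (EFin \o f).
  apply: continuous_compact_integrable; first exact: segment_compact.
  exact: continuous_subspaceT.
have x1 : x < x + 1 by rewrite ltrDl.
have [dF F'] := continuous_FTC1_closed x1 int Ax (cf x).
by apply: DeriveDef => //; rewrite -derive1E.
Qed.

(** Otherwise the nondecreasing [F] is bounded on $[q_0,\infty)$ and converges, and the improper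
    integral, being the limit minus $F(q_0)$, is at most [m]. *)
Lemma integral_exceeds (f F : R -> R) (A q0 m : R) : A < q0 -> continuous f ->
  (forall x, A < x -> is_derive x 1 F (f x)) -> (forall x, q0 <= x -> 0 <= f x) ->
  (m%:E < \int[lebesgue_measure]_(x in `[q0, +oo[) (f x)%:E)%E ->
  exists2 q1, q0 <= q1 & m < F q1 - F q0.
Proof.
move=> Aq cf dF f0 mlt; apply: contrapT => H.
have bd x : q0 <= x -> F x - F q0 <= m.
  by move=> qx; rewrite leNgt; apply/negP => h; apply: H; exists x.
have mono x y : q0 <= x -> x <= y -> F x <= F y.
  move=> qx; rewrite le_eqVlt => /predU1P[->//|xy].
  have cF : {within `[x, y], continuous F}.
    apply: continuous_in_subspaceT => z; rewrite inE/= in_itv/= => /andP[xz _].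
    by apply: is_derive_continuous (dF _ _); rewrite (lt_le_trans Aq)// (le_trans qx).
  have dF' z : z \in `]x, y[%R -> is_derive z 1 F (f z).
    by rewrite in_itv/= => /andP[xz _]; apply: dF; rewrite (lt_trans Aq)// (le_lt_trans qx).
  have [z zxy E] := MVT xy dF' cF.
  rewrite -subr_ge0 E mulr_ge0//; last by rewrite subr_ge0 ltW.
  by move: zxy; rewrite in_itv/= => /andP[xz _]; apply: f0; rewrite (le_trans qx)// ltW.
(* [F] is monotone only from [q0] on; freezing it before makes it monotone on the line without
   changing its limit. *)
pose G x := F (Num.max q0 x).
have qmax x : q0 <= Num.max q0 x by rewrite le_max lexx.
have ndG : {homo G : x y / x <= y}.
  move=> x y xy; apply: mono => //.
  by rewrite ge_max !le_max lexx xy orbT.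
have ubG y : range G y -> y <= F q0 + m.
  by move=> [x _ <-]; rewrite -lerBlDl; exact: bd.
have hubG : has_ubound (range G) by exists (F q0 + m).
have cG := nondecreasing_cvgr ndG hubG.
have supG : sup (range G) <= F q0 + m.
  by apply: ge_sup => //; exists (G 0), 0.
have cF : F x @[x --> +oo] --> sup (range G).
  apply: cvg_trans cG; apply: near_eq_cvg; near=> x.
  rewrite /G max_r//; near: x; exact: nbhs_pinfty_ge.
have cFq : F x @[x --> q0^'+] --> F q0.
  exact: cvg_at_right_filter (is_derive_continuous (dF _ Aq)).
have E := @ge0_continuous_FTC2y R f F q0 _ f0 (continuous_subspaceT cf) cF _ cFq _.
move: mlt; rewrite E.
- by rewrite -EFinD lte_fin ltNge lerBlDl supG.
- by move=> x qx; have [] := dF x (lt_trans Aq qx).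
- move=> x; rewrite in_itv/= andbT => qx; rewrite derive1E.
  by have [_ ->] := dF x (lt_trans Aq qx).
Unshelve. all: by end_near. Qed.

(* The barrier solves [om'' = - psi (om')]: it is obtained by inverting
   [s = int_q^q1 1 / psi], along which [om = int_q^q1 rho / psi] and [om' = q]. *)
Lemma gradient_barrier (psi : R -> R) (q0 m : R) : 0 <= q0 -> 0 < m ->
  {within `[0, +oo[, continuous psi} -> (forall x, 0 <= x -> 1 <= psi x) ->
  (m%:E < \int[lebesgue_measure]_(x in `[q0, +oo[) (x / psi x)%:E)%E ->
  exists (q1 d0 : R) (om om1 : R -> R), [/\ 0 < d0, om 0 = 0,
    {within `[0, d0], continuous om},
    m <= om d0 &
    (forall d, 0 <= d <= d0 -> om d <= q1 * d) /\
    (forall d, 0 <= d <= d0 -> q0 * d <= om d) /\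
    (forall d, 0 < d < d0 -> q0 <= om1 d /\
       taylor2 `[0, d0] om d (om1 d) (- psi (om1 d)))].
Proof.
move=> q00 m0 cpsi psi1 mlt.
(* [psi] is continuous on the half-line only; the constant extension to the left is continuous
   everywhere. *)
pose Psi x := psi (Num.max 0 x).
have Psi1 x : 1 <= Psi x by apply: psi1; rewrite le_max lexx.
have Psi0 x : 0 < Psi x by exact: lt_le_trans (Psi1 x).
have PsiE x : 0 <= x -> Psi x = psi x by move=> x0; rewrite /Psi max_r.
have cPsi : continuous Psi.
  move=> x; move/subspace_continuousP: cpsi => cp.
  have i y : `[0, +oo[%classic (Num.max 0 y) by rewrite /= in_itv/= le_max lexx.
  have lim : Num.max 0 y @[y --> x] --> within `[0, +oo[ (nbhs (Num.max 0 x)).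
    move=> B HB.
    have {HB} /nbhs_ballP[e e0 He] :
      \forall y \near Num.max 0 x, `[0, +oo[%classic y -> B y by exact: HB.
    apply/nbhs_ballP; exists e => // y; rewrite /ball/= => xy; apply: He => //.
    rewrite /ball/=; apply: le_lt_trans xy; rewrite maxEle maxEle.
    have := ler_norm (x - y); have := ler_norm (y - x); rewrite distrC => n1 n2.
    by case: ifP => a; case: ifP => b; rewrite ler_norml; apply/andP; split; move: a b n1 n2; lra.
  exact: (cvg_comp _ _ lim (cp _ (i x))).
pose f1 x := (Psi x)^-1; pose f2 x := x / Psi x.
have cf1 : continuous f1 by move=> x; apply: cvgV; [rewrite gt_eqF|exact: cPsi].
have cf2 : continuous f2 by move=> x; apply: cvgM; [exact: cvg_id|exact: cf1].
(* Room to the left of [q0], so that derivatives at [q0] are two-sided. *)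
pose A := q0 - 1.
have Aq : A < q0 by rewrite /A ltrBlDr ltrDl.
have [F1 dF1] := antiderivative A cf1; have [F2 dF2] := antiderivative A cf2.
have [q1 q01 mF2] : exists2 q1, q0 <= q1 & m < F2 q1 - F2 q0.
  apply: (@integral_exceeds f2 F2 A q0 m Aq cf2 dF2).
    by move=> x qx; apply: divr_ge0; [exact: le_trans qx|exact: ltW].
  apply: lt_le_trans mlt _; rewrite le_eqVlt; apply/orP; left; apply/eqP.
  apply: eq_integral => x.
  by rewrite inE/= in_itv/= andbT => qx; rewrite /f2 PsiE// (le_trans q00).
have q0q1 : q0 < q1.
  rewrite lt_neqAle q01 andbT; apply/eqP => E; move: mF2.
  by rewrite E subrr ltNge ltW.
have f1pos x : 0 < f1 x by rewrite invr_gt0.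
have F1inc x y : A < x -> x < y -> F1 x < F1 y.
  move=> Ax xy.
  have cF : {within `[x, y], continuous F1}.
    apply: continuous_in_subspaceT => z; rewrite inE/= in_itv/= => /andP[xz _].
    by apply: is_derive_continuous (dF1 _ _); exact: lt_le_trans xz.
  have dF' z : z \in `]x, y[%R -> is_derive z 1 F1 (f1 z).
    by rewrite in_itv/= => /andP[xz _]; apply: dF1; exact: lt_trans xz.
  have [z zxy E] := MVT xy dF' cF.
  by rewrite -subr_gt0 E mulr_gt0// subr_gt0.
have F1inj x y : A < x -> A < y -> F1 x = F1 y -> x = y.
  move=> Ax Ay E; apply/eqP; rewrite eq_le !leNgt; apply/andP; split; apply/negP.
    by move/(F1inc _ _ Ay); rewrite E ltxx.
  by move/(F1inc _ _ Ax); rewrite E ltxx.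
pose g y := xget 0 [set x | A < x /\ F1 x = y].
have gK x : A < x -> g (F1 x) = x.
  move=> Ax; rewrite /g; case: xgetP => [z _ [Az /F1inj]|/(_ x)]; first exact.
  by move=> /=; tauto.
pose om1 s := g (F1 q1 - s).
pose om s := F2 q1 - F2 (om1 s).
(* The slope [om1] decreases from [q1] at 0 to [q0] at [d0]; hence $q_0\le om'\le q_1$ on the whole
   interval, and $om(d_0)=F_2(q_1)-F_2(q_0)$ exceeds [m]. *)
pose d0 := F1 q1 - F1 q0.
have d00 : 0 < d0 by rewrite subr_gt0 F1inc.
have AF x : q0 <= x -> A < x by exact: lt_le_trans.
have param s : 0 <= s <= d0 -> exists2 x, q0 <= x <= q1 & F1 q1 - s = F1 x.
  move=> /andP[s0 sd].
  have cF : {within `[q0, q1], continuous F1}.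
    apply: continuous_in_subspaceT => z; rewrite inE/= in_itv/= => /andP[qz _].
    exact: is_derive_continuous (dF1 _ (AF _ qz)).
  have mm : Num.min (F1 q0) (F1 q1) <= F1 q1 - s <= Num.max (F1 q0) (F1 q1).
    have F01 := F1inc _ _ Aq q0q1.
    by rewrite min_l ?(ltW F01)// max_r ?(ltW F01)//; apply/andP; split;
      move: s0 sd; rewrite /d0; clear; lra.
  have [x xq E] := IVT q01 cF mm.
  by exists x; rewrite -?E//; move: xq; rewrite in_itv.
have om1P s x : q0 <= x -> F1 q1 - s = F1 x -> om1 s = x.
  by move=> qx E; rewrite /om1 E gK// AF.
have dom1 s x : q0 <= x -> F1 q1 - s = F1 x -> is_derive s 1 om1 (- Psi x).
  move=> qx E; have Ax := AF _ qx.
  have dg : is_derive (F1 x) 1 g (f1 x)^-1.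
    apply: is_derive_inverse; last by rewrite gt_eqF.
    - near=> z; apply: gK; near: z; exact: lt_nbhsr.
    - near=> z; apply: is_derive_continuous (dF1 z _); near: z; exact: lt_nbhsr.
    - exact: dF1.
  have dl : is_derive s 1 (fun s => F1 q1 - s) (-1).
    rewrite (_ : (fun _ => _) = cst (F1 q1) - id); last exact/funext.
    by apply: is_derive_eq; rewrite sub0r.
  rewrite -E in dg.
  have := @is_derive1_comp R g (fun s => F1 q1 - s) s _ _ dg dl; rewrite /f1 invrK mulrN1; exact.
have dom s x : q0 <= x -> F1 q1 - s = F1 x -> is_derive s 1 om x.
  move=> qx E; have Ax := AF _ qx.
  have d2 : is_derive (om1 s) 1 F2 (f2 x) by rewrite (om1P _ _ qx E); exact: dF2.
  have dc := is_derive1_comp d2 (dom1 s x qx E).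
  rewrite (_ : om = cst (F2 q1) - (F2 \o om1)); last exact/funext.
  by apply: is_derive_eq; rewrite sub0r mulrN opprK /f2 divfK// gt_eqF.
have om0 : om 0 = 0.
  by rewrite /om (om1P 0 q1) ?subrr// subr0.
have com : {within `[0, d0], continuous om}.
  apply: continuous_in_subspaceT => s; rewrite inE/= in_itv/= => /param[x /andP[qx _] E].
  exact: is_derive_continuous (dom s x qx E).
have mvt d : 0 <= d <= d0 -> q0 * d <= om d <= q1 * d.
  move=> /andP[]; rewrite le_eqVlt => /predU1P[<-|d_gt0 dd].
    by rewrite om0 !mulr0 lexx.
  have [||s sd] := @MVT R om om1 0 d d_gt0.
  - move=> s; rewrite in_itv/= => /andP[/ltW s1 s2].
    have sd0 : 0 <= s <= d0 by rewrite s1 (le_trans (ltW s2)).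
    by have [x /andP[qx _] E] := param s sd0; rewrite (om1P _ _ qx E); exact: dom.
  - by apply: continuous_subspaceW com; apply: subset_itvl; rewrite bnd_simp.
  rewrite om0 !subr0 => ->; move: sd; rewrite in_itv/= => /andP[/ltW s1 s2].
  have sd0 : 0 <= s <= d0 by rewrite s1 (le_trans (ltW s2)).
  have [x /andP[qx xq] E] := param s sd0; rewrite (om1P _ _ qx E).
  by rewrite !ler_wpM2r// ltW.
exists q1, d0, om, om1; split => //.
  rewrite /om (om1P d0 q0) ?lexx// ?ltW//.
  by rewrite /d0; ring.
split; first by move=> d /mvt /andP[].
split; first by move=> d /mvt /andP[].
move=> d /andP[d_gt0 dd].
have dI : 0 <= d <= d0 by rewrite !ltW.
have [x /andP[qx xq] E] := param d dI; rewrite (om1P _ _ qx E); split => //.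
rewrite -PsiE ?(le_trans q00)//.
have r0 : 0 < Num.min d (d0 - d) by rewrite lt_min d_gt0 subr_gt0.
rewrite -{1}(om1P _ _ qx E).
apply: (@is_derive_taylor2 _ _ om om1 d (- Psi x) _ r0 _ (dom1 d x qx E)) => y.
rewrite lt_min !ltr_norml => /andP[/andP[y1 _] /andP[_ y2]].
have yI : 0 <= y <= d0 by apply/andP; split; move: y1 y2; clear; lra.
by have [z /andP[qz _] Ez] := param y yI; rewrite (om1P _ _ qz Ez); exact: dom.
Unshelve. all: by end_near. Qed.

End GradientBarrier.

(** * Application of the barrier to the spatial increments *)

Section GradientEstimate.
Context {R : realType}.
Implicit Types (s t x y p : R) (U Ut Ux Uxx : R -> R -> R).

(** Up to distance [d0] the barrier is at most $q_1d$, and beyond it the oscillation $2M$ is at most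
    $(2M/d_0)d$, whence [N]. Initially $K\le q_0\le om'$ places the data below the barrier. The
    equation and the boundary conditions are reduced to bounds on absolute values, which are
    invariant under $U\mapsto-U$. *)
Lemma gradient_estimate (l Tm M K q0 : R) (psi : R -> R) U Ut Ux Uxx :
  0 < l -> 0 < M -> 0 <= q0 -> K <= q0 ->
  {within `[0, +oo[, continuous psi} -> (forall x, 0 <= x -> 1 <= psi x) ->
  ((2 * M)%:E < \int[lebesgue_measure]_(x in `[q0, +oo[) (x / psi x)%:E)%E ->
  (forall tau, 0 <= tau < Tm -> classical l 0 tau U Ut Ux Uxx) ->
  (forall t x, 0 <= t < Tm -> - l <= x <= l -> `|U t x| <= M) ->
  (forall x y, - l <= x <= l -> - l <= y <= l -> `|U 0 x - U 0 y| <= K * `|x - y|) ->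
  (forall t x, 0 < t < Tm -> - l < x < l ->
    exists2 A, 0 < A & `|Ut t x - A * Uxx t x| <= A * psi `|Ux t x|) ->
  (forall t, 0 < t < Tm ->
    exists2 b, 0 < b & forall p, q0 <= p -> `|Ut t l + b * Ux t l| <= b * p) ->
  (forall t, 0 < t < Tm ->
    exists2 b, 0 < b & forall p, q0 <= p -> `|Ut t (- l) - b * Ux t (- l)| <= b * p) ->
  exists2 N, 0 <= N & forall t x y, 0 <= t < Tm -> - l <= x <= l -> - l <= y <= l ->
    `|U t x - U t y| <= N * `|x - y|.
Proof.
move=> l0 M0 q00 Kq cpsi psi1 mlt.
have m0 : 0 < 2 * M by rewrite mulr_gt0.
have [q1 [d0 [om [om1 [d00 om0 com omd [omq [omq0 omP]]]]]]] :=
  gradient_barrier q00 m0 cpsi psi1 mlt.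
pose N := Num.max q1 (2 * M / d0).
have [N1 N2] : q1 <= N /\ 2 * M / d0 <= N by rewrite /N !le_max !lexx orbT.
have N0 : 0 <= N by apply: le_trans N2; rewrite divr_ge0 ?ltW.
(* one-sided estimate, to be applied to [U] and [-U] *)
have up (w wt wx wxx : R -> R -> R) :
  (forall tau, 0 <= tau < Tm -> classical l 0 tau w wt wx wxx) ->
  (forall t x, 0 <= t < Tm -> - l <= x <= l -> `|w t x| <= M) ->
  (forall x y, - l <= x <= l -> - l <= y <= l -> `|w 0 x - w 0 y| <= K * `|x - y|) ->
  (forall t x, 0 < t < Tm -> - l < x < l ->
    exists2 A, 0 < A & `|wt t x - A * wxx t x| <= A * psi `|wx t x|) ->
  (forall t, 0 < t < Tm ->
    exists2 b, 0 < b & forall p, q0 <= p -> `|wt t l + b * wx t l| <= b * p) ->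
  (forall t, 0 < t < Tm ->
    exists2 b, 0 < b & forall p, q0 <= p -> `|wt t (- l) - b * wx t (- l)| <= b * p) ->
  forall t x y, 0 <= t < Tm -> - l <= x <= l -> - l <= y <= l -> y <= x ->
    w t x - w t y <= N * (x - y).
  move=> cl wM w0 int bdr bdl t x y tT xl yl yx.
  have far s : 0 <= s < Tm -> w s x - w s y <= 2 * M.
    move=> sT; have := wM s x sT xl; have := wM s y sT yl; rewrite !ler_norml.
    by clear; lra.
  have [dxy|xyd] := leP d0 (x - y).
    apply: le_trans (far t tT) _; rewrite ler_pdivrMr// in N2.
    by apply: le_trans N2 _; rewrite ler_wpM2l.
  have xy0 : 0 <= x - y <= d0 by rewrite subr_ge0 yx ltW.
  apply: (@le_trans _ _ (om (x - y))); last first.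
    by apply: le_trans (omq _ xy0) _; rewrite ler_wpM2r// subr_ge0.
  have t0 : 0 <= t by case/andP: tT.
  have sub s : 0 <= s <= t -> 0 <= s < Tm.
    by move=> /andP[-> st]; rewrite (le_lt_trans st)//; case/andP: tT.
  have sub' s : 0 < s <= t -> 0 < s < Tm.
    by move=> /andP[-> st]; rewrite (le_lt_trans st)//; case/andP: tT.
  apply: (@two_point_comparison _ l 0 t d0 w wt wx wxx om om1 (fun d => - psi (om1 d))) => //.
  - exact: cl.
  - by rewrite om0.
  - by move=> d /omP[].
  - move=> x' y' xl' yl' xy'; apply: le_trans (omq0 _ xy').
    apply: le_trans (ler_norm _) _; apply: le_trans (w0 _ _ xl' yl') _.
    have h0 : 0 <= x' - y' by case/andP: xy'.
    by rewrite (ger0_norm h0) ler_wpM2r.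
  - move=> s x' y' /sub sT xl' yl' _; apply: le_trans omd.
    have := wM s x' sT xl'; have := wM s y' sT yl'; rewrite !ler_norml.
    by clear; lra.
  - move=> s z d /sub' sT zl dd wxE wxxE; have [A A0] := int s z sT zl.
    have [qom _] := omP d dd; have om10 : 0 <= om1 d by exact: le_trans qom.
    rewrite wxE (ger0_norm om10) ler_norml => /andP[_ I].
    have := ler_wpM2l (ltW A0) wxxE; move: I; clear; lra.
  - move=> s z d /sub' sT zl dd wxE; rewrite opprK => wxxE; have [A A0] := int s z sT zl.
    have [qom _] := omP d dd; have om10 : 0 <= om1 d by exact: le_trans qom.
    rewrite wxE (ger0_norm om10) ler_norml => /andP[I _].
    have := ler_wpM2l (ltW A0) wxxE; move: I; clear; lra.
  - move=> s d /sub' sT dd wxE; have [b b0 bp] := bdr s sT.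
    have [qom _] := omP d dd; have := bp _ qom; rewrite ler_norml => /andP[_ I].
    have := ler_wpM2l (ltW b0) wxE; move: I; clear; lra.
  - move=> s d /sub' sT dd wxE; have [b b0 bp] := bdl s sT.
    have [qom _] := omP d dd; have := bp _ qom; rewrite ler_norml => /andP[I _].
    have := ler_wpM2l (ltW b0) wxE; move: I; clear; lra.
  - by rewrite t0 lexx.
move=> cl UM U0 int bdr bdl; exists N => // t x y tT.
have E (p q : R) : - p - - q = - (p - q) by ring.
have upN := up (fun t x => - U t x) (fun t x => - Ut t x) (fun t x => - Ux t x)
  (fun t x => - Uxx t x).
have {}upN : forall x y, - l <= x <= l -> - l <= y <= l -> y <= x ->
    - U t x - - U t y <= N * (x - y).
  move=> x' y'; apply: upN => //.
  - by move=> tau tauT; apply: classicalN; exact: cl.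
  - by move=> s z *; rewrite normrN; exact: UM.
  - by move=> *; rewrite E normrN; exact: U0.
  - move=> s z sT zl; have [A A0 H] := int s z sT zl; exists A => //.
    by rewrite mulrN E !normrN.
  - move=> s sT; have [b b0 H] := bdr s sT; exists b => // p /H.
    by rewrite mulrN -opprD normrN.
  - move=> s sT; have [b b0 H] := bdl s sT; exists b => // p /H.
    by rewrite mulrN E normrN.
wlog yx : x y / y <= x.
  move=> W; have [|/ltW xy xl yl] := leP y x; first exact: W.
  by rewrite distrC [`|x - y|]distrC; exact: W.
move=> xl yl; have := up _ _ _ _ cl UM U0 int bdr bdl t x y tT xl yl yx.
have := upN x y xl yl yx.
by rewrite [`|x - y|]ger0_norm ?subr_ge0// ler_norml; clear; lra.
Qed.

End GradientEstimate.

(** * A priori estimates for the nonlinear evolution *)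

Section Evolution.
Context {R : realType}.
Implicit Types (s t x y e : R) (U Ut Ux Uxx A F : R -> R -> R).

Lemma taylor1_is_derive (f : R -> R) (a b x p : R) : a < x < b ->
  taylor1 `[a, b] f x p -> is_derive x 1 f p.
Proof.
move=> /andP[ax xb] T.
have lim : (fun h : R => h^-1 *: ((f \o shift x) (h *: (1 : R)) - f x)) @ 0^' --> p.
  apply/cvgrPdist_le => e e0; have [d d0 H] := T e e0.
  rewrite near_withinE; apply/nbhs_ballP.
  exists (Num.min d (Num.min (x - a) (b - x))).
    by rewrite /= !lt_min d0 !subr_gt0 ax xb.
  move=> h; rewrite /ball/= sub0r normrN !lt_min => /andP[hd /andP[h1 h2]] h0.
  rewrite /GRing.scale/= mulr1.
  have hI : `[a, b]%classic (h + x).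
    by move: h1 h2; rewrite /= in_itv/= !ltr_norml; clear; lra.
  have := H _ hI; rewrite addrK => /(_ hd) K.
  have -> : p - h^-1 * (f (h + x) - f x) = - (h^-1 * (f (h + x) - f x - p * h)) by field.
  by rewrite normrN normrM normfV mulrC ler_pdivrMr ?normr_gt0.
have df : derivable f x 1 by apply/cvg_ex; exists p.
by apply: DeriveDef => //; exact: cvg_lim lim.
Qed.

(** The accumulation hypothesis excludes an isolated [x], at which [taylor1] would hold for every
    [p]. *)
Lemma taylor1_slope (D : set R) (f : R -> R) (x p C : R) :
  taylor1 D f x p -> (forall d, 0 < d -> exists y, [/\ D y, y != x & `|y - x| < d]) ->
  (forall y, D y -> `|f y - f x| <= C * `|y - x|) -> `|p| <= C.
Proof.
move=> T Dx fC; apply/ler_addgt0Pr => e e0; have [d d0 H] := T e e0.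
have [y [Dy yx yd]] := Dx d d0.
have n0 : 0 < `|y - x| by rewrite normr_gt0 subr_eq0.
rewrite -(ler_pM2r n0) -normrM.
have h1 := H y Dy yd; have h2 := fC y Dy.
have -> : p * (y - x) = (f y - f x) - (f y - f x - p * (y - x)) by ring.
by apply: le_trans (ler_normB _ _) _; move: h1 h2; clear; lra.
Qed.

(* [U], [Ut], [Ux], [Uxx] are the solution and its derivatives extended to the closed interval,
   and [A], [F], [br], [gr], [bl], [gl] the coefficients evaluated along them.  The last two
   fields hold for free before the final time and start the a priori estimates. *)
Record evolution (l Tm al c Q : R) U Ut Ux Uxx A F (br bl gr gl : R -> R) : Prop :=
  Evolution {
  ev_l : 0 < l ; ev_Tm : 0 < Tm ; ev_al : 0 < al < 1 ; ev_c : 0 < c ; ev_Q : 0 <= Q ;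
  ev_cl : forall ta tau, 0 <= ta -> tau < Tm -> classical l ta tau U Ut Ux Uxx ;
  ev_U : forall t x, 0 <= t < Tm -> - l <= x <= l -> `|U t x| <= Q ;
  ev_slope : forall t x y, 0 <= t < Tm -> - l <= x <= l -> - l <= y <= l ->
    `|U t x - U t y| <= Q * `|x - y| ;
  ev_Ux : forall t x, 0 < t < Tm -> - l <= x <= l -> `|Ux t x| <= Q ;
  ev_pde : forall t x, 0 < t < Tm -> - l < x < l -> Ut t x = A t x * Uxx t x + F t x ;
  ev_A : forall t x, 0 < t < Tm -> - l < x < l -> c <= A t x <= Q ;
  ev_F : forall t x, 0 < t < Tm -> - l < x < l -> `|F t x| <= Q ;
  ev_lip : forall t s x y, 0 < t < Tm -> 0 < s < Tm -> - l < x < l -> - l < y < l ->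
    `|A t x - A s y| <= Q * (`|t - s| + `|x - y| + `|U t x - U s y| + `|Ux t x - Ux s y|) /\
    `|F t x - F s y| <= Q * (`|t - s| + `|x - y| + `|U t x - U s y| + `|Ux t x - Ux s y|) ;
  ev_bdr : forall t, 0 < t < Tm ->
    [/\ Ut t l + br t * Ux t l = gr t, c <= br t <= Q & `|gr t| <= Q] ;
  ev_bdl : forall t, 0 < t < Tm ->
    [/\ Ut t (- l) - bl t * Ux t (- l) = gl t, c <= bl t <= Q & `|gl t| <= Q] ;
  ev_blip : forall t s, 0 < t < Tm -> 0 < s < Tm ->
    [/\ `|br t - br s| <= Q * (`|t - s| + `|U t l - U s l|),
        `|gr t - gr s| <= Q * (`|t - s| + `|U t l - U s l|),
        `|bl t - bl s| <= Q * (`|t - s| + `|U t (- l) - U s (- l)|) &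
        `|gl t - gl s| <= Q * (`|t - s| + `|U t (- l) - U s (- l)|)] ;
  ev_dt : forall t x, 0 < t <= Tm * (3 / 4) -> - l <= x <= l -> `|Ut t x| <= Q ;
  ev_dt_holder : forall t x y, 0 < t <= Tm * (3 / 4) -> - l <= x <= l -> - l <= y <= l ->
    `|Ut t x - Ut t y| <= Q * `|x - y| `^ al }.

Lemma evolution_is_derive_t (l Tm al c Q : R) U Ut Ux Uxx A F br bl gr gl t x :
  evolution l Tm al c Q U Ut Ux Uxx A F br bl gr gl -> 0 < t < Tm -> - l <= x <= l ->
  is_derive t 1 (U ^~ x) (Ut t x).
Proof.
move=> ev /andP[t0 tT] xl.
have tau1 : (t + Tm) / 2 < Tm by clear -t0 tT; lra.
have [_ Ht _ _] := ev_cl ev (lexx 0) tau1.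
apply: (@taylor1_is_derive _ 0 ((t + Tm) / 2)); first by clear -t0 tT; lra.
by apply: Ht => //; clear -t0 tT; lra.
Qed.

Lemma evolution_time_lip (l Tm al c Q : R) U Ut Ux Uxx A F br bl gr gl (tau C : R) x t s :
  evolution l Tm al c Q U Ut Ux Uxx A F br bl gr gl -> tau <= Tm -> - l <= x <= l ->
  (forall t, 0 < t < tau -> `|Ut t x| <= C) -> 0 < t < tau -> 0 < s < tau ->
  `|U t x - U s x| <= C * `|t - s|.
Proof.
move=> ev tauT xl UtC tt ss.
apply: (@MVT_dist _ (U ^~ x) (Ut ^~ x) s t 0 tau) => //.
  move=> z /andP[z0 ztau]; apply: (evolution_is_derive_t ev) => //.
  by rewrite z0 (lt_le_trans ztau).
by move=> z zz _; exact: UtC.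
Qed.

(** With $ta=Tm/8$, $del=Tm/4$ and $t_1=Tm/2$ the shifted times stay above [ta], and the initial
    Lipschitz bound up to $t_1$ follows from [ev_dt]. The lateral constant $Q+Q^2$ bounds
    $|g|+b|U_x|$. *)
Lemma evolution_doubling (l Tm al c Q : R) U Ut Ux Uxx A F br bl gr gl (tau : R) :
  evolution l Tm al c Q U Ut Ux Uxx A F br bl gr gl ->
  Tm * (1 / 2) <= tau < Tm ->
  doubling_data l (Tm * (1 / 8)) (Tm * (1 / 2)) tau (Tm * (1 / 4)) Q Q (Q + Q * Q) Q
    Q Q Q U Ut Ux Uxx A F.
Proof.
move=> ev /andP[tau1 tau2].
have [l0 Tm0 al01 c0 Q0] := And5 (ev_l ev) (ev_Tm ev) (ev_al ev) (ev_c ev) (ev_Q ev).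
have sub t : Tm * (1 / 8) <= t <= tau -> 0 < t < Tm by clear -Tm0 tau2; lra.
have sub' t : Tm * (1 / 8) < t <= tau -> 0 < t < Tm by clear -Tm0 tau2; lra.
have le0 t : 0 < t < Tm -> 0 <= t < Tm by clear; lra.
have cl x : - l < x < l -> - l <= x <= l by clear; lra.
have ll : - l <= l <= l by clear -l0; lra.
have ll' : - l <= - l <= l by clear -l0; lra.
split => //.
- by clear -Tm0; lra.
- by rewrite tau1 andbT; clear -Tm0; lra.
- by apply: (ev_cl ev) => //; clear -Tm0; lra.
- by move=> t x /sub /le0; exact: (ev_U ev).
- by move=> t x y /sub /le0; exact: (ev_slope ev).
- by move=> t x /sub' tt /cl; exact: (ev_Ux ev).
- move=> s t /sub ss /sub tt; split; apply: (evolution_time_lip ev (lexx Tm)) => // z zz.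
  + have [E /andP[b1 b2] gQ] := ev_bdr ev zz.
    have -> : Ut z l = gr z - br z * Ux z l by rewrite -E addrK.
    apply: le_trans (ler_normB _ _) _; apply: lerD => //.
    rewrite normrM; apply: ler_pM => //; last exact: (ev_Ux ev).
    by rewrite ger0_norm// (le_trans (ltW c0)).
  + have [E /andP[b1 b2] gQ] := ev_bdl ev zz.
    have -> : Ut z (- l) = gl z + bl z * Ux z (- l) by rewrite -E subrK.
    apply: le_trans (ler_normD _ _) _; apply: lerD => //.
    rewrite normrM; apply: ler_pM => //; last exact: (ev_Ux ev).
    by rewrite ger0_norm// (le_trans (ltW c0)).
- move=> s t x ss tt xl; apply: (@evolution_time_lip _ _ _ _ _ _ _ _ _ _ _ _ _ _ _ (Tm * (3 / 4)) _ _ _ _ ev) => //.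
  + by clear -Tm0; lra.
  + by move=> z /andP[z0 /ltW z1]; apply: (ev_dt ev) => //; rewrite z0.
  + by clear -ss Tm0; lra.
  + by clear -tt Tm0; lra.
- move=> t x /sub' tt xl; split; [exact: (ev_pde ev)| |exact: (ev_F ev)].
  by have /andP[cA ->] := ev_A ev tt xl; rewrite (lt_le_trans c0).
- move=> t s x y /sub' tt /sub' ss xl yl Uxe.
  by have := ev_lip ev tt ss xl yl; rewrite Uxe subrr normr0 addr0.
Qed.

Lemma doubling_dataN (l ta t1 tau del N M Cb C0 Lam AM FM : R) U Ut Ux Uxx A F :
  doubling_data l ta t1 tau del N M Cb C0 Lam AM FM U Ut Ux Uxx A F ->
  doubling_data l ta t1 tau del N M Cb C0 Lam AM FM (fun t x => - U t x)
    (fun t x => - Ut t x) (fun t x => - Ux t x) (fun t x => - Uxx t x) A (fun t x => - F t x).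
Proof.
case=> h1 h2 h3 h4 h5 h6 h7 h8 h9 h10 h11 h12 h13.
have E (p q : R) : - p - - q = - (p - q) by ring.
split => //.
- exact: classicalN.
- by move=> *; rewrite normrN; exact: h7.
- by move=> *; rewrite E normrN; exact: h8.
- by move=> *; rewrite normrN; exact: h9.
- by move=> s t ss tt; rewrite !E !normrN; exact: h10.
- by move=> *; rewrite E normrN; exact: h11.
- move=> t x tt xl; have [e1 e2 e3] := h12 t x tt xl; split=> //.
    by rewrite e1; ring.
  by rewrite normrN.
- move=> t s x y tt ss xl yl /oppr_inj e; rewrite !E !normrN.
  exact: h13.
Qed.

(** For $t>\frac34Tm$ the doubling argument is run with final time [t] itself, for [U] and for [-U],
    and bounds the backward slopes at [t]; [L] is fixed before [t]. *)
Lemma evolution_dt_bound (l Tm al c Q : R) U Ut Ux Uxx A F br bl gr gl :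
  evolution l Tm al c Q U Ut Ux Uxx A F br bl gr gl ->
  exists2 L, 0 <= L & forall t x, 0 < t < Tm -> - l <= x <= l -> `|Ut t x| <= L.
Proof.
move=> ev; have [Tm0 Q0] := (ev_Tm ev, ev_Q ev).
pose lam := 12 * Q + 1.
have lam0 : 0 < lam by rewrite /lam; clear -Q0; lra.
(* A sum large enough for every lower bound on [L] in [time_lipschitz_above]. *)
pose L := 2 * (Q + Q * Q + lam * Q ^+ 2 + lam * Q + 1) + 2 * Q / (Tm * (1 / 4)) + 2 * lam * Q ^+ 2 + 2 * Q.
have q1 : 0 <= lam * Q ^+ 2 by rewrite mulr_ge0 ?sqr_ge0// ltW.
have q2 : 0 <= lam * Q by rewrite mulr_ge0// ltW.
have q3 : 0 <= Q * Q by rewrite mulr_ge0.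
have T4 : 0 < Tm * (1 / 4) by clear -Tm0; lra.
have q4 : 0 <= 2 * Q / (Tm * (1 / 4)) by rewrite divr_ge0// ?mulr_ge0// ltW.
have L0 : 0 < L by rewrite /L; clear -q1 q2 q3 q4 Q0; lra.
have QL : Q <= L by rewrite /L; clear -q1 q2 q3 q4 Q0; lra.
exists L => [|t x tt xl]; first exact: ltW.
have [t34|t34] := leP t (Tm * (3 / 4)).
  by apply: le_trans QL; apply: (ev_dt ev) => //; rewrite t34; case/andP: tt => ->.
have tau1 : Tm * (1 / 2) <= t < Tm by case/andP: tt => _ ->; rewrite andbT; clear -t34 Tm0; lra.
have dd := evolution_doubling ev tau1.
have LM : 2 * Q <= L * (Tm * (1 / 4)).
  rewrite -ler_pdivrMr// /L; clear -q1 q2 q3 q4 Q0; lra.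
have c1 : 12 * Q < lam by rewrite /lam ltrDl.
have c2 : Q + Q * Q + lam * Q ^+ 2 <= L by rewrite /L; clear -q1 q2 q3 q4 Q0; lra.
have c3 : Q + lam * Q ^+ 2 <= L by rewrite /L; clear -q1 q2 q3 q4 Q0; lra.
have c4 : 2 + 2 * lam * Q + lam * Q ^+ 2 <= L by rewrite /L; clear -q1 q2 q3 q4 Q0; lra.
have c5 : lam * Q ^+ 2 + Q <= L / 2 by rewrite /L; clear -q1 q2 q3 q4 Q0; lra.
have up := time_lipschitz_above dd c1 L0 c2 c3 LM c4 c5 QL.
have dn := time_lipschitz_above (doubling_dataN dd) c1 L0 c2 c3 LM c4 c5 QL.
have tI : Tm * (1 / 2) <= t <= t by rewrite lexx andbT; case/andP: tau1.
have [_ Ht _ _] : classical l 0 t U Ut Ux Uxx.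
  by apply: (ev_cl ev) => //; case/andP: tt.
have tI' : 0 < t <= t by rewrite lexx andbT; case/andP: tt.
have T := Ht t x tI' xl.
apply: (@taylor1_slope `[t - Tm * (1 / 4), t] _ _ _ _ (taylor1_sub _ T)).
- by move=> z; rewrite /= !in_itv/= => /andP[z1 ->]; rewrite andbT; clear -z1 t34 Tm0; lra.
- move=> d d0; pose r := Num.min (d / 2) (Tm * (1 / 4)).
  have r0 : 0 < r by rewrite lt_min divr_gt0.
  have [rd rT] : r <= d / 2 /\ r <= Tm * (1 / 4) by rewrite /r !ge_min !lexx orbT.
  exists (t - r); split.
  + by rewrite /= in_itv/=; clear -rT r0; lra.
  + by rewrite lt_eqF// ltrBlDr ltrDl.
  + by rewrite addrAC subrr sub0r normrN gtr0_norm//; clear -rd d0; lra.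
- move=> z; rewrite /= in_itv/= => /andP[z1]; rewrite le_eqVlt => /predU1P[->|zt].
    by rewrite !subrr normr0 mulr0.
  have hh : 0 < t - z <= Tm * (1 / 4) by clear -z1 zt; lra.
  have := up t (t - z) x tI hh xl; have := dn t (t - z) x tI hh xl.
  have -> : t - (t - z) = z by ring.
  have -> : `|z - t| = t - z by rewrite distrC gtr0_norm ?subr_gt0.
  by rewrite ler_norml; clear; lra.
Qed.

End Evolution.

(** * Difference quotients in time and Hoelder continuity of the time derivative *)

Section DifferenceQuotient.
Context {R : realType}.
Implicit Types (k s t x y e : R) (U Ut Ux Uxx A F : R -> R -> R).

Lemma classical_shift l (ta tb k : R) U Ut Ux Uxx : classical l (ta + k) (tb + k) U Ut Ux Uxx ->
  classical l ta tb (fun t x => U (t + k) x) (fun t x => Ut (t + k) x)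
    (fun t x => Ux (t + k) x) (fun t x => Uxx (t + k) x).
Proof.
case=> -[C C0 UC] Ht Hx Hxx.
have sub t : ta <= t <= tb -> ta + k <= t + k <= tb + k by rewrite !lerD2r.
have sub' t : ta < t <= tb -> ta + k < t + k <= tb + k by rewrite ltrD2r lerD2r.
split.
- exists C => // t s x y /sub tt /sub ss xl yl.
  by have := UC _ _ _ _ tt ss xl yl; rewrite opprD addrACA subrr addr0.
- move=> t x /sub' tt xl.
  have := @taylor1_reparam _ `[ta + k, tb + k]%classic `[ta, tb]%classic (U ^~ x) t (Ut (t + k) x) 1 k.
  rewrite !mul1r => H; apply: taylor1_eq (H _ _ (Ht _ _ tt xl)).
  + by move=> y _; rewrite mul1r.
  + by rewrite /= in_itv/=; move: tt; rewrite ltrD2r lerD2r => /andP[/ltW -> ->].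
  + by rewrite expr1n.
  + by move=> y; rewrite /= !in_itv/= mul1r; exact: sub.
- by move=> t x /sub' tt; exact: Hx.
- by move=> t x /sub' tt; exact: Hxx.
Qed.

Lemma classical_lin l (ta tb p q : R) U Ut Ux Uxx V Vt Vx Vxx :
  classical l ta tb U Ut Ux Uxx -> classical l ta tb V Vt Vx Vxx ->
  classical l ta tb (fun t x => p * U t x + q * V t x) (fun t x => p * Ut t x + q * Vt t x)
    (fun t x => p * Ux t x + q * Vx t x) (fun t x => p * Uxx t x + q * Vxx t x).
Proof.
case=> -[C C0 UC] Ut1 Ux1 Uxx1 [[D D0 VD] Vt1 Vx1 Vxx1]; split.
- exists (`|p| * C + `|q| * D); first by rewrite addr_ge0// mulr_ge0.
  move=> t s x y tt ss xl yl.
  have -> : p * U t x + q * V t x - (p * U s y + q * V s y) =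
    p * (U t x - U s y) + q * (V t x - V s y) by ring.
  apply: le_trans (ler_normD _ _) _; rewrite !normrM mulrDl -!mulrA.
  by apply: lerD; apply: ler_wpM2l => //; [exact: UC|exact: VD].
- by move=> t x tt xl; apply: taylor1D; apply: taylor1Z; [exact: Ut1|exact: Vt1].
- by move=> t x tt xl; apply: taylor1D; apply: taylor1Z; [exact: Ux1|exact: Vx1].
- by move=> t x tt xl; apply: taylor2D; apply: taylor2Z; [exact: Uxx1|exact: Vxx1].
Qed.

(** Written as a linear combination so that [classical_lin] applies as it stands. *)
Definition quot k U t x : R := k^-1 * U (t + k) x + - k^-1 * U t x.

Lemma quotE k U t x : quot k U t x = (U (t + k) x - U t x) / k.
Proof. by rewrite /quot mulNr -mulrBr mulrC. Qed.

Lemma evolution_dxx_bound (l Tm al c Q L : R) U Ut Ux Uxx A F br bl gr gl :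
  evolution l Tm al c Q U Ut Ux Uxx A F br bl gr gl ->
  (forall t x, 0 < t < Tm -> - l <= x <= l -> `|Ut t x| <= L) ->
  forall t x, 0 < t < Tm -> - l < x < l -> `|Uxx t x| <= (L + Q) / c.
Proof.
move=> ev UtL t x tt xl; have c0 := ev_c ev.
have /andP[cA AQ] := ev_A ev tt xl.
have A0 : 0 < A t x by exact: lt_le_trans cA.
have xl' : - l <= x <= l by clear -xl; lra.
have E : A t x * Uxx t x = Ut t x - F t x by rewrite (ev_pde ev tt xl) addrK.
rewrite ler_pdivlMr// mulrC; apply: (@le_trans _ _ (`|A t x| * `|Uxx t x|)).
  by rewrite ler_wpM2r// (gtr0_norm A0).
rewrite -normrM E; apply: le_trans (ler_normB _ _) _.
by apply: lerD; [exact: UtL|exact: (ev_F ev)].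
Qed.

(** By the discrete product rule the increment of $AU_{xx}$ is $A(t+k)$ times the increment of
    $U_{xx}$, plus the increment of $A$ times $U_{xx}(t)$. The latter is now a lower-order term,
    $U_{xx}$ being bounded by $(L+Q)/c$, and grows at most linearly in the quotient of $U_x$. The
    constants do not depend on [k]. *)
Lemma quot_linear_evolution (l Tm al c Q L : R) U Ut Ux Uxx A F br bl gr gl (t0 tau k : R) :
  evolution l Tm al c Q U Ut Ux Uxx A F br bl gr gl -> 0 <= L ->
  (forall t x, 0 < t < Tm -> - l <= x <= l -> `|Ut t x| <= L) ->
  0 < t0 <= tau -> 0 < k -> tau + k < Tm ->
  linear_evolution l t0 tau c Q (Q * (1 + L) * ((L + Q) / c + Q + 1)) L
    (quot k U) (quot k Ut) (quot k Ux) (quot k Uxx).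
Proof.
move=> ev L0 UtL /andP[t00 t0tau] k0 tauk.
have [l0 c0 Q0] := And3 (ev_l ev) (ev_c ev) (ev_Q ev).
have k0' : k != 0 by rewrite gt_eqF.
have ki0 : 0 < k^-1 by rewrite invr_gt0.
have tin t : t0 <= t <= tau -> 0 < t < Tm by clear -t00 k0 tauk; lra.
have tkin t : t0 <= t <= tau -> 0 < t + k < Tm by clear -t00 k0 tauk; lra.
have lt_le t : t0 < t <= tau -> t0 <= t <= tau by move=> /andP[/ltW -> ->].
have cl x : - l < x < l -> - l <= x <= l by clear; lra.
have ll : - l <= l <= l by clear -l0; lra.
have ll' : - l <= - l <= l by clear -l0; lra.
pose X := (L + Q) / c.
have X0 : 0 <= X by rewrite divr_ge0 ?addr_ge0// ltW.
have kE : `|k| = k by rewrite gtr0_norm.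
have dU t x : t0 <= t <= tau -> - l <= x <= l -> `|U (t + k) x - U t x| <= L * k.
  move=> tt xl; have := @evolution_time_lip _ _ _ _ _ _ _ _ _ _ _ _ _ _ _ _ Tm L x (t + k) t ev (lexx Tm) xl.
  rewrite (addrC t k) addrK kE => H; apply: H; [|by rewrite addrC; exact: tkin|exact: tin].
  by move=> z zz; exact: UtL.
have dd t : t + k - t = k by rewrite addrC addKr.
have vbd t x : t0 <= t <= tau -> - l <= x <= l -> `|quot k U t x| <= L.
  by move=> tt xl; rewrite quotE normrM normfV kE ler_pdivrMr//; exact: dU.
have B1 : Q * (1 + L) * Q + Q * (1 + L) <= Q * (1 + L) * (X + Q + 1).
  have : 0 <= Q * (1 + L) * X by apply: mulr_ge0 => //; rewrite mulr_ge0 ?addr_ge0.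
  by clear; lra.
(* No sign of [b] is assumed, so the left end is covered with [- bl]. *)
have bdry b b' g g' ux (v' ut ut' ux' : R) : ut + b * ux = g -> ut' + b' * ux' = g' ->
    `|ux| <= Q -> `|v'| <= L * k -> `|b' - b| <= Q * (k + `|v'|) -> `|g' - g| <= Q * (k + `|v'|) ->
    `|(ut' - ut) / k + b' * ((ux' - ux) / k)| <= Q * (1 + L) * (X + Q + 1).
  move=> e1 e2 uxQ vL bL gL.
  have -> : (ut' - ut) / k + b' * ((ux' - ux) / k) = ((g' - g) - (b' - b) * ux) / k.
    by rewrite -e1 -e2; field.
  rewrite normrM normfV kE ler_pdivrMr//; apply: le_trans (ler_normB _ _) _.
  have i1 : Q * (k + `|v'|) <= Q * (1 + L) * k.
    by rewrite -mulrA ler_wpM2l//; move: vL; clear; lra.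
  have i2 : `|(b' - b) * ux| <= Q * (1 + L) * k * Q.
    by rewrite normrM; apply: ler_pM => //; exact: le_trans bL i1.
  have := ler_wpM2r (ltW k0) B1; move: (le_trans gL i1) i2; clear; lra.
split.
- apply: classical_lin; last first.
    by apply: (ev_cl ev); [exact: ltW|move: tauk k0; clear; lra].
  by apply: classical_shift; apply: (ev_cl ev) => //; rewrite addr_ge0// ltW.
- exact: vbd.
- move=> t x /lt_le tt xl; exists (A (t + k) x); first exact: (ev_A ev (tkin _ tt) xl).
  have [lA lF] := ev_lip ev (tkin _ tt) (tin _ tt) xl xl.
  rewrite dd kE subrr normr0 addr0 in lA lF.
  have e1 := ev_pde ev (tkin _ tt) xl; have e2 := ev_pde ev (tin _ tt) xl.
  have Xb := evolution_dxx_bound ev UtL (tin _ tt) xl.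
  rewrite !quotE e1 e2.
  have -> : (A (t + k) x * Uxx (t + k) x + F (t + k) x - (A t x * Uxx t x + F t x)) / k -
     A (t + k) x * ((Uxx (t + k) x - Uxx t x) / k) =
     ((A (t + k) x - A t x) * Uxx t x + (F (t + k) x - F t x)) / k by field.
  rewrite normrM normfV kE ler_pdivrMr//; apply: le_trans (ler_normD _ _) _.
  set q := Ux (t + k) x - Ux t x in lA lF *.
  have i1 : k + `|U (t + k) x - U t x| + `|q| <= (1 + L) * (1 + `|q / k|) * k.
    have dUk := dU t x tt (cl _ xl).
    have qk : `|q| = `|q / k| * k by rewrite normrM normfV kE divfK.
    rewrite {1}qk; have : 0 <= L * `|q / k| * k by rewrite !mulr_ge0// ltW.
    by move: dUk; clear; lra.
  have i2 := ler_wpM2l Q0 i1.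
  have lA' := le_trans lA i2; have lF' := le_trans lF i2.
  have i3 : `|(A (t + k) x - A t x) * Uxx t x| <= Q * ((1 + L) * (1 + `|q / k|) * k) * X.
    by rewrite normrM; apply: ler_pM.
  apply: le_trans (lerD i3 lF') _.
  have z0 : 0 <= Q * (1 + L) * (1 + `|q / k|) * k * Q.
    by rewrite !mulr_ge0 ?addr_ge0// ltW.
  by rewrite -/X; move: z0; set P := 1 + `|q / k|; clearbody X P; clear; lra.
- move=> t /lt_le tt.
  have [e1 _ _] := ev_bdr ev (tin _ tt); have [e2 /andP[b2 _] _] := ev_bdr ev (tkin _ tt).
  exists (br (t + k)) => //; rewrite !quotE.
  have [lb lg _ _] := ev_blip ev (tkin _ tt) (tin _ tt); rewrite dd kE in lb lg.
  by apply: (bdry _ _ _ _ _ _ _ _ _ e1 e2 (ev_Ux ev (tin _ tt) ll) (dU _ _ tt ll) lb lg).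
- move=> t /lt_le tt.
  have [e1 _ _] := ev_bdl ev (tin _ tt); have [e2 /andP[b2 _] _] := ev_bdl ev (tkin _ tt).
  exists (bl (t + k)) => //; rewrite !quotE.
  have [_ _ lb lg] := ev_blip ev (tkin _ tt) (tin _ tt); rewrite dd kE in lb lg.
  rewrite -mulNr in e1; rewrite -mulNr in e2; rewrite -mulNr.
  apply: (bdry (- bl t) _ _ _ _ _ _ _ _ e1 e2 (ev_Ux ev (tin _ tt) ll') (dU _ _ tt ll')) => //.
  by rewrite -opprD normrN.
Qed.

Lemma quot_limit (l Tm al c Q : R) U Ut Ux Uxx A F br bl gr gl t x e :
  evolution l Tm al c Q U Ut Ux Uxx A F br bl gr gl -> 0 < t < Tm -> - l <= x <= l ->
  0 < e -> exists2 d, 0 < d & forall k, 0 < k < d -> `|quot k U t x - Ut t x| <= e.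
Proof.
move=> ev /andP[t0 tT] xl e0.
pose tau := (t + Tm) / 2.
have tau1 : tau < Tm by rewrite /tau; clear -t0 tT; lra.
have ttau : t < tau by rewrite /tau; clear -t0 tT; lra.
have [_ Ht _ _] := ev_cl ev (lexx 0) tau1.
have tI : 0 < t <= tau by rewrite t0 ltW.
have [d d0 H] := Ht t x tI xl e e0.
exists (Num.min d (tau - t)); first by rewrite lt_min d0 subr_gt0.
move=> k /andP[k0]; rewrite lt_min => /andP[kd kt].
have kE : t + k - t = k by rewrite addrC addKr.
have := H (t + k); rewrite kE (gtr0_norm k0) => /(_ _ kd) h.
have {}h : `|U (t + k) x - U t x - Ut t x * k| <= e * k.
  by apply: h; rewrite /= in_itv/=; move: t0 k0 kt; clear; lra.
rewrite quotE; have -> : (U (t + k) x - U t x) / k - Ut t x = (U (t + k) x - U t x - Ut t x * k) / k.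
  by field; rewrite gt_eqF.
by rewrite normrM normfV (gtr0_norm k0) ler_pdivrMr.
Qed.

(** The linear estimates hold for all quotients with the same constants, so they pass to [Ut] as [k]
    tends to 0. *)
Lemma evolution_dt_holder (l Tm al c Q : R) U Ut Ux Uxx A F br bl gr gl :
  evolution l Tm al c Q U Ut Ux Uxx A F br bl gr gl ->
  exists2 K, 0 <= K &
   (forall t x y, Tm * (1 / 2) <= t < Tm -> - l <= x <= l -> - l <= y <= l ->
     `|Ut t x - Ut t y| <= K * `|x - y| `^ al) /\
   (forall t s x, Tm * (1 / 2) <= t < Tm -> Tm * (1 / 2) <= s < Tm -> - l <= x <= l ->
     `|Ut t x - Ut s x| <= K * `|t - s| `^ (al / 2)).
Proof.
move=> ev; have [L L0 UtL] := evolution_dt_bound ev.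
have [l0 c0 Q0 al01 Tm0] := And5 (ev_l ev) (ev_c ev) (ev_Q ev) (ev_al ev) (ev_Tm ev).
pose B := Q * (1 + L) * ((L + Q) / c + Q + 1).
have B0 : 0 <= B.
  by rewrite /B !mulr_ge0 ?addr_ge0 ?divr_ge0 ?addr_ge0// ltW.
have [Kx Hx] := @space_holder _ l c Q B L Q al l0 c0 B0 al01.
have [Kt Ht] := @time_holder _ l c Q B L al Kx l0 c0 B0 al01.
have T2 : 0 < Tm * (1 / 2) by clear -Tm0; lra.
pose le tau k := @quot_linear_evolution l Tm al c Q L U Ut Ux Uxx A F br bl gr gl
  (Tm * (1 / 2)) tau k ev L0 UtL.
(* For $k\le Tm/4$ the quotient at $Tm/2$ averages [Ut] over times up to $\frac34Tm$, where
   [ev_dt_holder] applies. *)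
have init k x y : 0 < k <= Tm * (1 / 4) -> - l <= x <= l -> - l <= y <= l ->
    `|quot k U (Tm * (1 / 2)) x - quot k U (Tm * (1 / 2)) y| <= Q * `|x - y| `^ al.
  move=> /andP[k0 kT] xl yl; set t0 := Tm * (1 / 2) in T2 *.
  rewrite !quotE -mulrBl normrM normfV (gtr0_norm k0) ler_pdivrMr//.
  have -> : U (t0 + k) x - U t0 x - (U (t0 + k) y - U t0 y) =
    (U (t0 + k) x - U (t0 + k) y) - (U t0 x - U t0 y) by ring.
  have kE : `|t0 + k - t0| = k by rewrite addrC addKr gtr0_norm.
  rewrite -[X in _ <= _ * X]kE.
  apply: (@MVT_dist _ (fun z => U z x - U z y) (fun z => Ut z x - Ut z y) t0 (t0 + k) 0 Tm).
  - move=> z zz; have d1 := evolution_is_derive_t ev zz xl.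
    have d2 := evolution_is_derive_t ev zz yl.
    by rewrite (_ : (fun _ => _) = (U ^~ x) - (U ^~ y)); [exact: is_deriveB|exact/funext].
  - by rewrite /t0; clear -Tm0; lra.
  - by rewrite /t0; clear -Tm0 kT k0; lra.
  - move=> z /andP[z0 zT]; rewrite kE => zt; apply: (ev_dt_holder ev) => //.
    by rewrite z0; move: zt; rewrite ler_norml /t0; clear -kT; lra.
have Hq tau k : Tm * (1 / 2) <= tau -> 0 < k <= Tm * (1 / 4) -> tau + k < Tm ->
   (forall t x y, Tm * (1 / 2) <= t <= tau -> - l <= x <= l -> - l <= y <= l ->
     `|quot k U t x - quot k U t y| <= Kx * `|x - y| `^ al) /\
   (forall t s x, Tm * (1 / 2) <= t <= tau -> Tm * (1 / 2) <= s <= tau -> - l <= x <= l ->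
     `|quot k U t x - quot k U s x| <= Kt * `|t - s| `^ (al / 2)).
  move=> tau1 kk tauk; have /andP[k0 kT] := kk.
  have LE : linear_evolution l (Tm * (1 / 2)) tau c Q B L (quot k U) (quot k Ut) (quot k Ux) (quot k Uxx).
    by apply: le => //; rewrite T2.
  have X := Hx _ _ _ _ _ _ tau1 LE (fun x y => init k x y kk).
  by split; [exact: X|exact: (Ht _ _ _ _ _ _ tau1 LE X)].
pose K := Num.max 0 (Num.max Kx Kt).
have [K0 [K1 K2]] : 0 <= K /\ (Kx <= K /\ Kt <= K) by rewrite /K !le_max !lexx ?orbT.
exists K => //; split.
- move=> t x y tt xl yl; have t0 : 0 < t < Tm by case/andP: tt => h ->; rewrite (lt_le_trans T2).
  apply/ler_addgt0Pr => e e0; have e2 : 0 < e / 2 by rewrite divr_gt0.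
  have [d1 d10 h1] := quot_limit ev t0 xl e2; have [d2 d20 h2] := quot_limit ev t0 yl e2.
  pose k := Num.min (Num.min (d1 / 2) (d2 / 2)) (Num.min (Tm * (1 / 4)) ((Tm - t) / 2)).
  have k0 : 0 < k by rewrite /k !lt_min; move: d10 d20 Tm0 t0; clear; lra.
  have [[k1 k2] [k3 k4]] : (k <= d1 / 2 /\ k <= d2 / 2) /\ (k <= Tm * (1 / 4) /\ k <= (Tm - t) / 2).
    by rewrite /k !ge_min !lexx ?orbT.
  have [|||h3 _] := Hq t k; [by case/andP: tt|by rewrite k0|by move: k4 t0; clear; lra|].
  have tI : Tm * (1 / 2) <= t <= t by rewrite lexx andbT; case/andP: tt.
  have {}h3 := h3 t x y tI xl yl.
  have {}h1 : `|quot k U t x - Ut t x| <= e / 2 by apply: h1; rewrite k0; move: k1 d10; clear; lra.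
  have {}h2 : `|quot k U t y - Ut t y| <= e / 2 by apply: h2; rewrite k0; move: k2 d20; clear; lra.
  have h4 : Kx * `|x - y| `^ al <= K * `|x - y| `^ al by rewrite ler_wpM2r// powR_ge0.
  move: h1 h2 h3 h4; rewrite !ler_norml; clear; lra.
- move=> t s x tt ss xl; have t0 : 0 < t < Tm by case/andP: tt => h ->; rewrite (lt_le_trans T2).
  have s0 : 0 < s < Tm by case/andP: ss => h ->; rewrite (lt_le_trans T2).
  apply/ler_addgt0Pr => e e0; have e2 : 0 < e / 2 by rewrite divr_gt0.
  have [d1 d10 h1] := quot_limit ev t0 xl e2; have [d2 d20 h2] := quot_limit ev s0 xl e2.
  (* One cylinder, and then one step [k], must serve both times. *)
  pose tau := Num.max t s.
  have [tau1 tau2] : t <= tau /\ s <= tau by rewrite /tau !le_max !lexx orbT.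
  have tauT : tau < Tm by rewrite /tau gt_max; case/andP: t0 => _ ->; case/andP: s0.
  have tau0 : Tm * (1 / 2) <= tau by apply: le_trans tau1; case/andP: tt.
  pose k := Num.min (Num.min (d1 / 2) (d2 / 2)) (Num.min (Tm * (1 / 4)) ((Tm - tau) / 2)).
  have k0 : 0 < k by rewrite /k !lt_min; move: d10 d20 Tm0 tauT; clear; lra.
  have [[k1 k2] [k3 k4]] : (k <= d1 / 2 /\ k <= d2 / 2) /\ (k <= Tm * (1 / 4) /\ k <= (Tm - tau) / 2).
    by rewrite /k !ge_min !lexx ?orbT.
  have [|||_ h3] := Hq tau k => //; [by rewrite k0|by move: k4 tauT; clear; lra|].
  have tI : Tm * (1 / 2) <= t <= tau by rewrite tau1 andbT; case/andP: tt.
  have sI : Tm * (1 / 2) <= s <= tau by rewrite tau2 andbT; case/andP: ss.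
  have {}h3 := h3 t s x tI sI xl.
  have {}h1 : `|quot k U t x - Ut t x| <= e / 2 by apply: h1; rewrite k0; move: k1 d10; clear; lra.
  have {}h2 : `|quot k U s x - Ut s x| <= e / 2 by apply: h2; rewrite k0; move: k2 d20; clear; lra.
  have h4 : Kt * `|t - s| `^ (al / 2) <= K * `|t - s| `^ (al / 2) by rewrite ler_wpM2r// powR_ge0.
  move: h1 h2 h3 h4; rewrite !ler_norml; clear; lra.
Qed.

End DifferenceQuotient.

(** * Interpolation of the slope and the remaining Hoelder bounds *)

Section Interpolation.
Context {R : realType}.
Implicit Types (s t x y r : R) (U Ut Ux Uxx A F : R -> R -> R).

(** A Landau inequality: the slope at [x] differs from a difference quotient at distance [r] by at
    most [E * r]. *)
Lemma slope_interpolation (phi phi1 phi2 : R -> R) (l E P x r : R) : 0 <= E ->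
  (forall y, - l < y < l -> is_derive y 1 phi (phi1 y)) ->
  (forall y, - l < y < l -> is_derive y 1 phi1 (phi2 y)) ->
  (forall y, - l < y < l -> `|phi2 y| <= E) ->
  - l < x < l -> 0 < r < l ->
  (forall y, - l < y < l -> `|y - x| = r -> `|phi y - phi x| <= P) ->
  `|phi1 x| <= P / r + E * r.
Proof.
move=> E0 d1 d2 bE xl /andP[r0 rl] bP.
(* Stepping towards the centre stays inside the interval because $r<l$. *)
have [y yl yx] : exists2 y, - l < y < l & `|y - x| = r.
  have [x0|x0] := leP x 0.
    exists (x + r); first by clear -xl x0 r0 rl; lra.
    by rewrite addrC addKr gtr0_norm.
  exists (x - r); first by clear -xl x0 r0 rl; lra.
  by rewrite addrC addKr normrN gtr0_norm.
have {}bP := bP y yl yx.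
have inner z : - l < z < l -> `|z - x| <= `|y - x| -> `|phi1 z - phi1 x| <= E * r.
  move=> zl zx; apply: le_trans (MVT_dist d2 xl zl (fun w wl _ => bE w wl)) _.
  by rewrite ler_wpM2l// -yx.
have d3 z : - l < z < l -> is_derive z 1 (fun w => phi w - phi1 x * w) (phi1 z - phi1 x).
  move=> zl; have D := d1 z zl.
  rewrite (_ : (fun _ => _) = phi - (phi1 x) *: id); last exact/funext.
  by apply: is_derive_eq; rewrite /GRing.scale/= mulr1.
have := MVT_dist d3 xl yl inner; rewrite yx => H.
have E1 : phi1 x * (y - x) = (phi y - phi x) -
   (phi y - phi1 x * y - (phi x - phi1 x * x)) by ring.
have : `|phi1 x| * r <= P + E * r * r.
  rewrite -{1}yx -normrM E1; apply: le_trans (ler_normB _ _) _.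
  exact: lerD.
rewrite -ler_pdivlMr// => /le_trans; apply.
rewrite (_ : (P + E * r * r) / r = P / r + E * r)//; field.
by rewrite gt_eqF.
Qed.

(** Lowers a Hoelder exponent on a bounded range; the factor $1+T$ covers both $z\le1$ and $z>1$. *)
Lemma powR_weaken (a b z T : R) : 0 <= b -> b <= a -> a <= 1 -> 0 <= z <= T -> 0 <= T ->
  z `^ a <= (1 + T) * z `^ b.
Proof.
move=> b0 ba a1 /andP[z0 zT] T0.
have [->|zN0] := eqVneq z 0.
  have [->|bN0] := eqVneq b 0; last first.
    have aN0 : a != 0 by rewrite gt_eqF// (lt_le_trans _ ba)// lt_neqAle eq_sym bN0.
    by rewrite !powR0// mulr0.
  rewrite powRr0 mulr1; have [->|aN0] := eqVneq a 0; first by rewrite powRr0 lerDl.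
  by rewrite powR0// addr_ge0.
have zp : 0 < z by rewrite lt_neqAle eq_sym zN0.
have [z1|z1] := leP z 1.
  apply: (@le_trans _ _ (z `^ b)); first by apply: ger_powR => //; rewrite zp.
  by rewrite ler_peMl ?powR_ge0// lerDl.
apply: (@le_trans _ _ z).
  by rewrite -[leRHS](powRr1 z0); apply: ler_powR; rewrite // ltW.
apply: (@le_trans _ _ (1 + T)); first by rewrite (le_trans zT)// lerDr.
rewrite ler_peMr ?addr_ge0//.
by rewrite -[leLHS](powRr0 z); apply: ler_powR; rewrite // ltW.
Qed.

(** Interpolation is used twice. A crude round, with [U] Lipschitz in time and [Uxx] bounded, makes
    [Ux] 1/2-Hoelder in time; then the coefficients are Hoelder, and the equation solved for [Uxx]
    gives its Hoelder bounds. A second round feeds these and the spatial Hoelder bound of [Ut] back,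
    and gains the factor $r^{al}$ that raises the exponent of [Ux] to $(1+al)/2$. *)
Lemma evolution_holder (l Tm al c Q : R) U Ut Ux Uxx A F br bl gr gl :
  evolution l Tm al c Q U Ut Ux Uxx A F br bl gr gl ->
  (forall t x, 0 < t < Tm -> - l < x < l -> is_derive x 1 (Ux t) (Uxx t x)) ->
  exists2 C, 0 <= C &
   [/\ forall t x, Tm * (1 / 2) <= t < Tm -> - l < x < l -> `|Ux t x| <= C,
       forall t x, Tm * (1 / 2) <= t < Tm -> - l < x < l -> `|Uxx t x| <= C &
       forall t x, Tm * (1 / 2) <= t < Tm -> - l < x < l -> `|Ut t x| <= C] /\
   [/\ forall t s x, Tm * (1 / 2) <= t < Tm -> Tm * (1 / 2) <= s < Tm -> - l < x < l ->
         `|Ut t x - Ut s x| <= C * `|t - s| `^ (al / 2),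
       forall t x y, Tm * (1 / 2) <= t < Tm -> - l < x < l -> - l < y < l ->
         `|Ut t x - Ut t y| <= C * `|x - y| `^ al,
       forall t s x, Tm * (1 / 2) <= t < Tm -> Tm * (1 / 2) <= s < Tm -> - l < x < l ->
         `|Uxx t x - Uxx s x| <= C * `|t - s| `^ (al / 2),
       forall t x y, Tm * (1 / 2) <= t < Tm -> - l < x < l -> - l < y < l ->
         `|Uxx t x - Uxx t y| <= C * `|x - y| `^ al &
       forall t s x, Tm * (1 / 2) <= t < Tm -> Tm * (1 / 2) <= s < Tm -> - l < x < l ->
         `|Ux t x - Ux s x| <= C * `|t - s| `^ ((1 + al) / 2)].
Proof.
move=> ev dUx.
have [L L0 UtL] := evolution_dt_bound ev.
have [K K0 [UtKx UtKt]] := evolution_dt_holder ev.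
have [l0 c0 Q0 al01 Tm0] := And5 (ev_l ev) (ev_c ev) (ev_Q ev) (ev_al ev) (ev_Tm ev).
have /andP[al0 al1] := al01.
have [X X0 UxxX] : exists2 X, 0 <= X & forall t x, 0 < t < Tm -> - l < x < l ->
    `|Uxx t x| <= X.
  exists ((L + Q) / c); first by rewrite divr_ge0 ?addr_ge0// ltW.
  exact: evolution_dxx_bound ev UtL.
have late t : Tm * (1 / 2) <= t < Tm -> 0 < t < Tm by clear -Tm0; lra.
have cl x : - l < x < l -> - l <= x <= l by clear; lra.
have dU t x : 0 < t < Tm -> - l < x < l -> is_derive x 1 (U t) (Ux t x).
  move=> /andP[t0 tT] xl; pose tau := (t + Tm) / 2.
  have tau1 : tau < Tm by rewrite /tau; clear -tT; lra.
  have [_ _ Hx _] := ev_cl ev (lexx 0) tau1.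
  apply: (@taylor1_is_derive _ _ (- l) l) => //; apply: Hx; last exact: cl.
  by rewrite t0 /tau; clear -t0 tT; lra.
have Ulip t s x : 0 < t < Tm -> 0 < s < Tm -> - l < x < l -> `|U t x - U s x| <= L * `|t - s|.
  move=> tt ss xl; apply: (evolution_time_lip ev (lexx Tm)) => //; first exact: cl.
  by move=> z zz; apply: UtL => //; exact: cl.
have dUD t s y : 0 < t < Tm -> 0 < s < Tm -> - l < y < l ->
    is_derive y 1 (fun y => U t y - U s y) (Ux t y - Ux s y).
  move=> tt ss yl; have h1 := dU t y tt yl; have h2 := dU s y ss yl.
  by rewrite (_ : (fun _ => _) = U t - U s); [exact: is_deriveB|exact/funext].
have dUxD t s y : 0 < t < Tm -> 0 < s < Tm -> - l < y < l ->
    is_derive y 1 (fun y => Ux t y - Ux s y) (Uxx t y - Uxx s y).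
  move=> tt ss yl; have h1 := dUx t y tt yl; have h2 := dUx s y ss yl.
  by rewrite (_ : (fun _ => _) = Ux t - Ux s); [exact: is_deriveB|exact/funext].
have dist0 t s : `|t - s| = Num.sqrt `|t - s| * Num.sqrt `|t - s|.
  by rewrite -expr2 sqr_sqrtr.
(* The choice $r=\sqrt{|t-s|}$ balances $L|t-s|/r$ against $Xr$; for $r\ge l$ the bound on [Ux] is
   enough. *)
have [H H0 UxH] : exists2 H, 0 <= H & forall t s x, 0 < t < Tm -> 0 < s < Tm ->
    - l < x < l -> `|Ux t x - Ux s x| <= H * Num.sqrt `|t - s|.
  exists (2 * L + 2 * X + 2 * Q / l).
    by rewrite !addr_ge0 ?mulr_ge0 ?invr_ge0// ltW.
  move=> t s x tt ss xl; set r := Num.sqrt _.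
  have r0 : 0 <= r by exact: sqrtr_ge0.
  have [rz|rN0] := eqVneq r 0.
    have : t = s by apply/eqP; rewrite -subr_eq0 -normr_eq0 dist0 -/r rz mulr0.
    by move=> ->; rewrite subrr normr0 mulr_ge0// !addr_ge0 ?mulr_ge0 ?invr_ge0// ltW.
  have rp : 0 < r by rewrite lt_neqAle eq_sym rN0.
  have [lr|rl] := leP l r.
    apply: (@le_trans _ _ (2 * Q / l * r)); last first.
      by rewrite ler_wpM2r// lerDr !addr_ge0 ?mulr_ge0.
    apply: (@le_trans _ _ (2 * Q)).
      have := ev_Ux ev tt (cl _ xl); have := ev_Ux ev ss (cl _ xl).
      by rewrite !ler_norml; clear; lra.
    by rewrite mulrAC ler_pdivlMr// ler_wpM2l// mulr_ge0.
  have rr : 0 < r < l by rewrite rp.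
  have E0 : 0 <= 2 * X by rewrite mulr_ge0.
  have := @slope_interpolation (fun y => U t y - U s y) (fun y => Ux t y - Ux s y)
    (fun y => Uxx t y - Uxx s y) l (2 * X) (2 * L * `|t - s|) x r E0
    (fun y => dUD t s y tt ss) (fun y => dUxD t s y tt ss) _ xl rr.
  move=> SI; have {}SI : `|Ux t x - Ux s x| <= 2 * L * `|t - s| / r + 2 * X * r.
    apply: SI => y yl => [|_].
      by have := UxxX t y tt yl; have := UxxX s y ss yl; rewrite !ler_norml; clear; lra.
    by have := Ulip t s y tt ss yl; have := Ulip t s x tt ss xl; rewrite !ler_norml; clear; lra.
  apply: le_trans SI _; rewrite dist0 -/r mulrA mulfK//.
  have : 0 <= 2 * Q / l * r by rewrite !mulr_ge0 ?invr_ge0// ltW.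
  by clear; lra.
have sqrt_holder t s : 0 < t < Tm -> 0 < s < Tm ->
    Num.sqrt `|t - s| <= (1 + Tm) * `|t - s| `^ (al / 2).
  move=> tt ss; rewrite -powR12_sqrt//; apply: powR_weaken.
  - by rewrite divr_ge0// ltW.
  - by clear -al1; lra.
  - by clear; lra.
  - by rewrite normr_ge0 ler_norml; clear -tt ss; lra.
  - exact: ltW.
have lin_holder t s : 0 < t < Tm -> 0 < s < Tm ->
    `|t - s| <= (1 + Tm) * `|t - s| `^ (al / 2).
  move=> tt ss; rewrite -[leLHS]powRr1//; apply: powR_weaken.
  - by rewrite divr_ge0// ltW.
  - by clear -al1; lra.
  - by [].
  - by rewrite normr_ge0 ler_norml; clear -tt ss; lra.
  - exact: ltW.
have lin_holder_x x y : - l < x < l -> - l < y < l ->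
    `|x - y| <= (1 + 2 * l) * `|x - y| `^ al.
  move=> xl yl; rewrite -[leLHS]powRr1//; apply: powR_weaken => //; try exact: ltW.
  - by rewrite normr_ge0 ler_norml; clear -xl yl; lra.
  - by rewrite ltW// mulr_gt0.
have Uxx_diff t s x y : 0 < t < Tm -> 0 < s < Tm -> - l < x < l -> - l < y < l ->
    `|Uxx t x - Uxx s y| <= (`|Ut t x - Ut s y| +
      (1 + X) * (Q * (`|t - s| + `|x - y| + `|U t x - U s y| + `|Ux t x - Ux s y|))) / c.
  move=> tt ss xl yl; have [lA lF] := ev_lip ev tt ss xl yl.
  set G := Q * _ in lA lF *.
  have /andP[cA _] := ev_A ev tt xl; have A0 : 0 < A t x by exact: lt_le_trans cA.
  have e1 := ev_pde ev tt xl; have e2 := ev_pde ev ss yl.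
  rewrite ler_pdivlMr// mulrC; apply: (@le_trans _ _ (`|A t x| * `|Uxx t x - Uxx s y|)).
    by rewrite ler_wpM2r// (gtr0_norm A0).
  rewrite -normrM; have -> : A t x * (Uxx t x - Uxx s y) =
    (Ut t x - Ut s y) - ((F t x - F s y) + (A t x - A s y) * Uxx s y).
    by rewrite e1 e2; ring.
  apply: le_trans (ler_normB _ _) _; apply: lerD => //.
  apply: le_trans (ler_normD _ _) _; rewrite [leRHS]mulrDl mul1r; apply: lerD => //.
  rewrite normrM [leLHS]mulrC; apply: ler_pM => //; exact: UxxX.
pose Ct := (K + (1 + X) * (Q * (1 + L + H)) * (1 + Tm)) / c.
pose Cx := (K + (1 + X) * (Q * (1 + Q + X)) * (1 + 2 * l)) / c.
have X1 : 0 <= 1 + X by rewrite addr_ge0.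
have T1 : 0 <= 1 + Tm by rewrite addr_ge0// ltW.
have l1 : 0 <= 1 + 2 * l by rewrite addr_ge0// mulr_ge0// ltW.
have Ct0 : 0 <= Ct.
  by rewrite divr_ge0 ?(ltW c0)// addr_ge0// !mulr_ge0// !addr_ge0.
have Cx0 : 0 <= Cx.
  by rewrite divr_ge0 ?(ltW c0)// addr_ge0// !mulr_ge0// !addr_ge0.
have Uxxt t s x : Tm * (1 / 2) <= t < Tm -> Tm * (1 / 2) <= s < Tm -> - l < x < l ->
    `|Uxx t x - Uxx s x| <= Ct * `|t - s| `^ (al / 2).
  move=> t2 s2 xl; have tt := late _ t2; have ss := late _ s2.
  apply: (le_trans (Uxx_diff t s x x tt ss xl xl)).
  rewrite /Ct mulrAC; apply: ler_wpM2r; first by rewrite invr_ge0 ltW.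
  rewrite [leRHS]mulrDl; apply: lerD; first by apply: UtKt => //; exact: cl.
  rewrite subrr normr0 addr0 -!mulrA; apply: ler_wpM2l; first by rewrite addr_ge0.
  apply: ler_wpM2l => //; have h1 := Ulip t s x tt ss xl; have h2 := UxH t s x tt ss xl.
  have h3 := lin_holder t s tt ss; have h4 := ler_wpM2l H0 (sqrt_holder t s tt ss).
  have h5 := ler_wpM2l L0 h3; move: h1 h2 h3 h4 h5; clear; lra.
have Uxxx t x y : Tm * (1 / 2) <= t < Tm -> - l < x < l -> - l < y < l ->
    `|Uxx t x - Uxx t y| <= Cx * `|x - y| `^ al.
  move=> t2 xl yl; have tt := late _ t2.
  apply: (le_trans (Uxx_diff t t x y tt tt xl yl)).
  rewrite /Cx mulrAC; apply: ler_wpM2r; first by rewrite invr_ge0 ltW.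
  rewrite [leRHS]mulrDl; apply: lerD; first by apply: UtKx => //; exact: cl.
  rewrite subrr normr0 add0r -!mulrA; apply: ler_wpM2l; first by rewrite addr_ge0.
  have t0 : 0 <= t < Tm by case/andP: tt => /ltW ->.
  apply: ler_wpM2l => //; have h1 := ev_slope ev t0 (cl _ xl) (cl _ yl).
  have h2 : `|Ux t x - Ux t y| <= X * `|x - y|.
    exact: MVT_dist (fun z zl => dUx t z tt zl) yl xl (fun z zl _ => UxxX t z tt zl).
  have h3 := lin_holder_x x y xl yl; have h4 := ler_wpM2l Q0 h3.
  have h5 := ler_wpM2l X0 h3; move: h1 h2 h3 h4 h5; clear; lra.
(* [K] is valid from $Tm/2$ on and [Q] up to $\frac34Tm$; the sum holds at all times, as needed for
   the mean value theorem on the whole time interval below. *)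
have UtK2 t x y : 0 < t < Tm -> - l < x < l -> - l < y < l ->
    `|Ut t x - Ut t y| <= (K + Q) * `|x - y| `^ al.
  move=> /andP[t0 tT] /cl xl /cl yl; rewrite mulrDl.
  have p0 : 0 <= `|x - y| `^ al by exact: powR_ge0.
  have [t34|t34] := leP t (Tm * (3 / 4)).
    apply: (@le_trans _ _ (Q * `|x - y| `^ al)); last by rewrite lerDr mulr_ge0.
    by apply: (ev_dt_holder ev); rewrite ?t0.
  apply: (@le_trans _ _ (K * `|x - y| `^ al)); last by rewrite lerDl mulr_ge0.
  by apply: UtKx; rewrite // tT andbT; clear -t34 Tm0; lra.
pose b := (1 + al) / 2.
pose Cxt := (K + Q) + Ct + 2 * Q / l `^ (1 + al).
have lal : 0 < l `^ (1 + al) by exact: powR_gt0.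
have Q20 : 0 <= 2 * Q by rewrite mulr_ge0.
have Cxt0 : 0 <= Cxt by rewrite /Cxt !addr_ge0// divr_ge0// ltW.
have UxHt t s x : Tm * (1 / 2) <= t < Tm -> Tm * (1 / 2) <= s < Tm -> - l < x < l ->
    `|Ux t x - Ux s x| <= Cxt * `|t - s| `^ b.
  move=> t2 s2 xl; have tt := late _ t2; have ss := late _ s2.
  pose r := Num.sqrt `|t - s|.
  have r0 : 0 <= r by exact: sqrtr_ge0.
  have pw0 : 0 <= `|t - s| `^ b by exact: powR_ge0.
  have [rz|rN0] := eqVneq r 0.
    have : t = s by apply/eqP; rewrite -subr_eq0 -normr_eq0 dist0 -/r rz mulr0.
    by move=> e; rewrite e subrr normr0 mulr_ge0// powR_ge0.
  have rp : 0 < r by rewrite lt_neqAle eq_sym rN0.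
  have rb a : r `^ a = `|t - s| `^ (a / 2).
    by rewrite /r -powR12_sqrt// -powRrM mulrC.
  have [lr|rl] := leP l r.
    apply: (@le_trans _ _ (2 * Q / l `^ (1 + al) * `|t - s| `^ b)); last first.
      by rewrite ler_wpM2r// lerDr !addr_ge0.
    apply: (@le_trans _ _ (2 * Q)).
      have := ev_Ux ev tt (cl _ xl); have := ev_Ux ev ss (cl _ xl).
      by rewrite !ler_norml; clear; lra.
    rewrite mulrAC ler_pdivlMr//; apply: ler_wpM2l => //; rewrite /b -rb.
    by apply: ge0_ler_powR; rewrite ?nnegrE ?addr_ge0// ltW.
  have rr : 0 < r < l by rewrite rp.
  have E0 : 0 <= Ct * r `^ al by rewrite mulr_ge0// powR_ge0.
  have := @slope_interpolation (fun y => U t y - U s y) (fun y => Ux t y - Ux s y)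
    (fun y => Uxx t y - Uxx s y) l (Ct * r `^ al) ((K + Q) * r `^ al * `|t - s|) x r E0
    (fun y => dUD t s y tt ss) (fun y => dUxD t s y tt ss) _ xl rr.
  move=> SI; have {}SI : `|Ux t x - Ux s x| <= (K + Q) * r `^ al * `|t - s| / r + Ct * r `^ al * r.
    apply: SI => y yl => [|yx]; first by rewrite rb; exact: Uxxt.
    (* Read as an increment in time of $U(\cdot,y)-U(\cdot,x)$, this is at most $|t-s|$ times the
       spatial oscillation of [Ut], which is where the additional $r^{al}$ comes from. *)
    rewrite -[X in `|X|](_ : (U t y - U t x) - (U s y - U s x) = _); last by ring.
    apply: (@MVT_dist _ (fun z => U z y - U z x) (fun z => Ut z y - Ut z x) s t 0 Tm) => //.
      move=> z zz; have e1 := evolution_is_derive_t ev zz (cl _ yl).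
      have e2 := evolution_is_derive_t ev zz (cl _ xl).
      by rewrite (_ : (fun _ => _) = (U ^~ y) - (U ^~ x)); [exact: is_deriveB|exact/funext].
    by move=> z zz zs; rewrite -yx; exact: UtK2.
  apply: le_trans SI _.
  have -> : (K + Q) * r `^ al * `|t - s| / r = (K + Q) * r `^ al * r.
    by rewrite dist0 -/r mulrA mulfK.
  have -> : `|t - s| `^ b = r `^ al * r.
    rewrite /b -rb addrC powRD; first by rewrite powRr1.
    by rewrite rN0 implybT.
  have : 0 <= 2 * Q / l `^ (1 + al) * (r `^ al * r).
    by rewrite !mulr_ge0 ?invr_ge0 ?powR_ge0// ltW.
  rewrite /Cxt; clear; lra.
pose C := Q + L + K + X + Ct + Cx + Cxt.
have [C1 [C2 C3]] : Q <= C /\ X <= C /\ L <= C.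
  by rewrite /C; move: Q0 L0 K0 X0 Ct0 Cx0 Cxt0; clear; lra.
have [C4 [C5 [C6 C7]]] : K <= C /\ Ct <= C /\ Cx <= C /\ Cxt <= C.
  by rewrite /C; move: Q0 L0 K0 X0 Ct0 Cx0 Cxt0; clear; lra.
have C0 : 0 <= C by exact: le_trans C1.
have up (k z a : R) : k <= C -> k * z `^ a <= C * z `^ a.
  by move=> kC; rewrite ler_wpM2r// powR_ge0.
exists C => //; split; split.
- by move=> t x /late tt /cl xl; apply: le_trans C1; exact: (ev_Ux ev).
- by move=> t x /late tt xl; apply: le_trans C2; exact: UxxX.
- by move=> t x /late tt /cl xl; apply: le_trans C3; exact: UtL.
- by move=> t s x tt ss /cl xl; apply: le_trans (up _ _ _ C4); exact: UtKt.
- by move=> t x y tt /cl xl /cl yl; apply: le_trans (up _ _ _ C4); exact: UtKx.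
- by move=> t s x tt ss xl; apply: le_trans (up _ _ _ C5); exact: Uxxt.
- by move=> t x y tt xl yl; apply: le_trans (up _ _ _ C6); exact: Uxxx.
- by move=> t s x tt ss xl; apply: le_trans (up _ _ _ C7); exact: UxHt.
Qed.

End Interpolation.

(** * The maximal solution *)

Section MaximalSolution.
Context {R : realType}.
Implicit Types (s t x y p tau : R) (u : R -> R -> R).

Lemma parabolic_holder_cyl (al l tau : R) u :
  parabolic_holder al l tau u -> cyl_derivable l tau u.
Proof.
move=> [du _] t x tt xl.
have [|d1 d2 d3] := du t x; first by split; rewrite /= /Omega/= in_itv.
have D (f : R -> R) (y : R) : derivable f y 1 -> is_derive y 1 f (derive1 f y).
  by move=> df; apply: DeriveDef => //; rewrite derive1E.
by split; [exact: D d1|exact: D d2|exact: D d3].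
Qed.

Lemma parabolic_holder_bounds (al l tau : R) u : 0 < al < 1 -> 0 < l -> 0 < tau ->
  parabolic_holder al l tau u -> exists2 C, 0 <= C & holder_bounds al l `]0, tau[ u C.
Proof. by move=> al01 l0 tau0 [_]; exact: parabolic_norm_bounds. Qed.

Section Bars.
Variables (al l Tm : R) (u : R -> R -> R).
Hypotheses (al01 : 0 < al < 1) (l0 : 0 < l).
Hypothesis ph : forall tau, 0 < tau < Tm -> parabolic_holder al l tau u.

(** Regularity is available only on cylinders of height below [Tm]; whatever concerns time [t] is
    read off on a slightly taller one. *)
Lemma later_time t : 0 <= t < Tm -> exists2 tau, t < tau & 0 < tau < Tm.
Proof.
by move=> /andP[t0 tT]; exists ((t + Tm) / 2); lra.
Qed.

Lemma bars_interior t x : 0 < t < Tm -> - l < x < l ->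
  [/\ bar l Tm u t x = u t x, bar l Tm (d_t u) t x = d_t u t x,
      bar l Tm (d_x u) t x = d_x u t x & bar l Tm (d_xx u) t x = d_xx u t x].
Proof.
move=> /andP[t0 tT] xl; have [|tau ttau /andP[tau0 tauT]] := @later_time t; first by rewrite ltW.
have pht := ph (introT andP (conj tau0 tauT)).
have du := parabolic_holder_cyl pht.
have [C C0 hb] := parabolic_holder_bounds al01 l0 tau0 pht.
have tt : 0 < t < tau by rewrite t0.
split; apply: (bar_interior l0 (ltW tauT) tt xl).
- exact: unif_cont_u C0 du hb.
- exact: unif_cont_dt al01 C0 hb.
- exact: unif_cont_dx al01 C0 du hb.
- exact: unif_cont_dxx al01 C0 hb.
Qed.

Lemma bars_classical (ta tb : R) : 0 <= ta -> tb < Tm -> 0 < Tm ->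
  classical l ta tb (bar l Tm u) (bar l Tm (d_t u)) (bar l Tm (d_x u)) (bar l Tm (d_xx u)).
Proof.
move=> ta0 tbT Tm0; pose t := Num.max 0 tb.
have [|tau ttau /andP[tau0 tauT]] := @later_time t.
  by rewrite /t le_max lexx gt_max Tm0.
have pht := ph (introT andP (conj tau0 tauT)).
have [C C0 hb] := parabolic_holder_bounds al01 l0 tau0 pht.
apply: (bar_classical l0 (ltW tauT) tau0 al01 C0 (parabolic_holder_cyl pht) hb ta0).
by apply: le_lt_trans ttau; rewrite /t le_max lexx orbT.
Qed.

Lemma bars_bound (M t x : R) :
  (forall tau, 0 < tau < Tm -> (sup_norm l tau u <= M%:E)%E) ->
  0 <= t < Tm -> - l <= x <= l -> `|bar l Tm u t x| <= M.
Proof.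
move=> uM tT xl; have [tau ttau /andP[tau0 tauT]] := later_time tT.
have tauI : 0 < tau < Tm by rewrite tau0.
have pht := ph tauI.
have [C C0 hb] := parabolic_holder_bounds al01 l0 tau0 pht.
apply: (bar_norm_le l0 (ltW tauT) tau0 (unif_cont_u C0 (parabolic_holder_cyl pht) hb) _ _ xl).
  exact/sup_norm_leP/uM.
by rewrite ttau andbT; case/andP: tT.
Qed.

(** No estimate is behind this: [C] is taken from the finite norm of [u] on the cylinder of height
    $\frac78Tm$. *)
Lemma bars_dt : 0 < Tm -> exists2 C, 0 <= C &
  (forall t x, 0 < t <= Tm * (3 / 4) -> - l <= x <= l -> `|bar l Tm (d_t u) t x| <= C) /\
  (forall t x y, 0 < t <= Tm * (3 / 4) -> - l <= x <= l -> - l <= y <= l ->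
    `|bar l Tm (d_t u) t x - bar l Tm (d_t u) t y| <= C * `|x - y| `^ al).
Proof.
move=> Tm0; pose tau := Tm * (7 / 8).
have tau0 : 0 < tau by rewrite /tau; lra.
have tauT : tau < Tm by rewrite /tau; lra.
have pht := ph (introT andP (conj tau0 tauT)).
have du := parabolic_holder_cyl pht.
have [C C0 hb] := parabolic_holder_bounds al01 l0 tau0 pht.
have sub t : 0 < t <= Tm * (3 / 4) -> 0 <= t < tau by rewrite /tau; lra.
have uct := unif_cont_dt al01 C0 hb.
exists C => //; split.
  move=> t x /sub tt xl; apply: (bar_norm_le l0 (ltW tauT) tau0 uct _ tt xl).
  by move=> s y ss yl; apply: (hb_t hb); rewrite /= /Omega/= in_itv.
move=> t x y /sub tt xl yl.
exact: (bar_dt_holder_x l0 (ltW tauT) tau0 al01 C0 hb).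
Qed.

Lemma bars_derive_xx t x : 0 < t < Tm -> - l < x < l ->
  is_derive x 1 (bar l Tm (d_x u) t) (bar l Tm (d_xx u) t x).
Proof.
move=> tT xl; have [_ _ _ ->] := bars_interior tT xl.
have [|tau ttau /andP[tau0 tauT]] := @later_time t.
  by case/andP: tT => /ltW ->.
have pht := ph (introT andP (conj tau0 tauT)).
have tt : 0 < t < tau by rewrite ttau andbT; case/andP: tT.
have [_ _ D] := parabolic_holder_cyl pht tt xl.
apply: (@taylor1_is_derive _ _ ((- l + x) / 2) ((x + l) / 2)); first by lra.
apply: taylor1_eq (is_derive_taylor1 _ D) => [y|]; rewrite /= in_itv/=; last by lra.
move=> yI.
have yl : - l < y < l by lra.
by have [_ _ -> _] := bars_interior tT yl.
Qed.

End Bars.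

(** The two time ranges overlap. A pair contained in neither has [t0] between its members, and both
    partial distances are at most the full one. *)
Lemma holder_glue (Tm beta C1 C2 t0 t1 : R) (w : R -> R) : 0 <= beta ->
  0 < t0 < t1 -> t0 < Tm -> 0 <= C1 -> 0 <= C2 ->
  (forall t s, 0 < t < t1 -> 0 < s < t1 -> `|w t - w s| <= C1 * `|t - s| `^ beta) ->
  (forall t s, t0 <= t < Tm -> t0 <= s < Tm -> `|w t - w s| <= C2 * `|t - s| `^ beta) ->
  forall t s, 0 < t < Tm -> 0 < s < Tm -> `|w t - w s| <= (C1 + C2) * `|t - s| `^ beta.
Proof.
move=> b0 /andP[t00 t01] t0T C10 C20 h1 h2 t s.
wlog ts : t s / t <= s.
  move=> W; have [|/ltW st tt ss] := leP t s; first exact: W.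
  by rewrite distrC [`|t - s|]distrC; exact: W.
move=> /andP[tp tT] /andP[sp sT].
have pw z : 0 <= z `^ beta by exact: powR_ge0.
have le1 : C1 * `|t - s| `^ beta <= (C1 + C2) * `|t - s| `^ beta by rewrite ler_wpM2r// lerDl.
have le2 : C2 * `|t - s| `^ beta <= (C1 + C2) * `|t - s| `^ beta by rewrite ler_wpM2r// lerDr.
have [s1|s1] := ltP s t1.
  by apply: le_trans le1; apply: h1; rewrite ?tp ?sp ?(le_lt_trans ts).
have [t0t|tt0] := leP t0 t.
  by apply: le_trans le2; apply: h2; rewrite ?t0t ?tT ?sT ?(le_trans t0t).
have a1 : `|w t - w t0| <= C1 * `|t - t0| `^ beta.
  by apply: h1; rewrite ?tp ?t00 ?(lt_trans tt0).
have t0s : t0 <= s by rewrite (le_trans (ltW t01)).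
have a2 : `|w t0 - w s| <= C2 * `|t0 - s| `^ beta.
  by apply: h2; rewrite ?lexx ?t0T ?t0s.
have n1 : `|t - t0| <= `|t - s|.
  by rewrite !ler0_norm ?subr_le0 ?(ltW tt0)//; clear -t0s; lra.
have n2 : `|t0 - s| <= `|t - s|.
  by rewrite !ler0_norm ?subr_le0//; clear -tt0; lra.
have p1 : `|t - t0| `^ beta <= `|t - s| `^ beta by apply: ge0_ler_powR; rewrite ?nnegrE.
have p2 : `|t0 - s| `^ beta <= `|t - s| `^ beta by apply: ge0_ler_powR; rewrite ?nnegrE.
have -> : w t - w s = (w t - w t0) + (w t0 - w s) by ring.
apply: le_trans (ler_normD _ _) _.
have := ler_wpM2l C10 p1; have := ler_wpM2l C20 p2; move: a1 a2; clear; lra.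
Qed.

End MaximalSolution.

(** * Bounds up to the maximal time and exclusion of blow-up *)

Section Conclusion.
Context {R : realType}.
Implicit Types (s t x y z p tau : R).

(** Before $\frac78Tm$ the norm is finite by hypothesis, after $Tm/2$ the a priori estimates apply;
    the overlap makes the Hoelder bounds in time glue. [C] is independent of [tau]. *)
Lemma uniform_holder_bounds (al l Tm c Q : R) (u A F : R -> R -> R) (br bl gr gl : R -> R) :
  (forall tau, 0 < tau < Tm -> parabolic_holder al l tau u) ->
  evolution l Tm al c Q (bar l Tm u) (bar l Tm (d_t u)) (bar l Tm (d_x u))
    (bar l Tm (d_xx u)) A F br bl gr gl ->
  exists2 C, 0 <= C & forall tau, 0 < tau < Tm -> holder_bounds al l `]0, tau[ u C.
Proof.
move=> ph ev.
have [l0 Tm0 al01 Q0] := And4 (ev_l ev) (ev_Tm ev) (ev_al ev) (ev_Q ev).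
have inn := bars_interior al01 l0 ph.
have [C2 C20 [[b1 b2 b3] [g1 g2 g3 g4 g5]]] := evolution_holder ev (bars_derive_xx al01 l0 ph).
pose t1 := Tm * (7 / 8).
have t1I : 0 < t1 < Tm by rewrite /t1; clear -Tm0; lra.
have [C1 C10 [h1 h2 h3 h4 h5 h6 h7 h8 h9]] :=
  parabolic_holder_bounds al01 l0 (proj1 (andP t1I)) (ph _ t1I).
pose C := C1 + C2 + Q.
have C0 : 0 <= C by rewrite !addr_ge0.
have leC : C1 + C2 <= C by rewrite lerDl.
have [le1 [le2 le3]] : C1 <= C /\ C2 <= C /\ Q <= C.
  by rewrite /C; move: C10 C20 Q0; clear; lra.
exists C => // tau /andP[tau0 tauT].
have it t : `]0, tau[%classic t -> 0 < t < Tm.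
  by rewrite /= in_itv/= => /andP[-> /lt_trans ->].
have ix x : Omega l x -> - l < x < l by rewrite /Omega/= in_itv.
have early t : 0 < t < t1 -> `]0, t1[%classic t by rewrite /= in_itv.
have xO x : - l < x < l -> Omega l x by rewrite /Omega/= in_itv.
have late t : 0 < t < Tm -> t1 <= t -> Tm * (1 / 2) <= t < Tm.
  by move=> /andP[_ ->]; rewrite andbT /t1; clear -Tm0; lra.
have half t : Tm * (1 / 2) <= t < Tm -> 0 < t < Tm by clear -Tm0; lra.
have split_bound (w W : R -> R -> R) : (forall t x, 0 < t < Tm -> - l < x < l -> W t x = w t x) ->
    (forall t x, `]0, t1[%classic t -> Omega l x -> `|w t x| <= C1) ->
    (forall t x, Tm * (1 / 2) <= t < Tm -> - l < x < l -> `|W t x| <= C2) ->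
    forall t x, `]0, tau[%classic t -> Omega l x -> `|w t x| <= C.
  move=> Ww e1 e2 t x /it tt /ix xl; have [tt1|t1t] := ltP t t1.
    by apply: le_trans le1; apply: e1; [apply: early; rewrite tt1 andbT; case/andP: tt|exact: xO].
  by apply: le_trans le2; rewrite -Ww//; apply: e2 => //; exact: late.
have split_x (w W : R -> R -> R) : (forall t x, 0 < t < Tm -> - l < x < l -> W t x = w t x) ->
    (forall t x y, `]0, t1[%classic t -> Omega l x -> Omega l y ->
      `|w t x - w t y| <= C1 * `|x - y| `^ al) ->
    (forall t x y, Tm * (1 / 2) <= t < Tm -> - l < x < l -> - l < y < l ->
      `|W t x - W t y| <= C2 * `|x - y| `^ al) ->
    forall t x y, `]0, tau[%classic t -> Omega l x -> Omega l y ->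
      `|w t x - w t y| <= C * `|x - y| `^ al.
  move=> Ww e1 e2 t x y /it tt /ix xl /ix yl; have [tt1|t1t] := ltP t t1.
    apply: (@le_trans _ _ (C1 * `|x - y| `^ al)); last by rewrite ler_wpM2r// powR_ge0.
    by apply: e1; [apply: early; rewrite tt1 andbT; case/andP: tt|exact: xO|exact: xO].
  apply: (@le_trans _ _ (C2 * `|x - y| `^ al)); last by rewrite ler_wpM2r// powR_ge0.
  by rewrite -!Ww//; apply: e2 => //; exact: late.
have split_t (w W : R -> R -> R) (beta : R) : 0 <= beta ->
    (forall t x, 0 < t < Tm -> - l < x < l -> W t x = w t x) ->
    (forall t s x, `]0, t1[%classic t -> `]0, t1[%classic s -> Omega l x ->
      `|w t x - w s x| <= C1 * `|t - s| `^ beta) ->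
    (forall t s x, Tm * (1 / 2) <= t < Tm -> Tm * (1 / 2) <= s < Tm -> - l < x < l ->
      `|W t x - W s x| <= C2 * `|t - s| `^ beta) ->
    forall t s x, `]0, tau[%classic t -> `]0, tau[%classic s -> Omega l x ->
      `|w t x - w s x| <= C * `|t - s| `^ beta.
  move=> b0 Ww e1 e2 t s x /it tt /it ss /ix xl.
  apply: (@le_trans _ _ ((C1 + C2) * `|t - s| `^ beta)).
    2: by rewrite ler_wpM2r// powR_ge0.
  apply: (@holder_glue _ Tm beta C1 C2 (Tm * (1 / 2)) t1 (w ^~ x)) => //.
  - by rewrite /t1; clear -Tm0; lra.
  - by clear -Tm0; lra.
  - by move=> t' s' /early tt' /early ss'; apply: e1 => //; exact: xO.
  - by move=> t' s' tt' ss'; rewrite -!Ww//; [exact: e2|exact: half|exact: half].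
have al2 : 0 <= al / 2 by case/andP: al01 => /ltW a _; rewrite divr_ge0.
have al3 : 0 <= (1 + al) / 2 by case/andP: al01 => /ltW a _; rewrite divr_ge0// addr_ge0.
split.
- move=> t x /it tt /ix xl; have [<- _ _ _] := inn t x tt xl.
  apply: le_trans le3; apply: (ev_U ev); first by case/andP: tt => /ltW -> ->.
  by case/andP: xl => /ltW -> /ltW ->.
- by apply: split_bound h2 b1 => t x tt xl; have [] := inn t x tt xl.
- by apply: split_bound h3 b2 => t x tt xl; have [] := inn t x tt xl.
- by apply: split_bound h4 b3 => t x tt xl; have [] := inn t x tt xl.
- by apply: split_t al2 _ h5 g1 => t x tt xl; have [] := inn t x tt xl.
- by apply: split_x h6 g2 => t x tt xl; have [] := inn t x tt xl.
- by apply: split_t al2 _ h7 g3 => t x tt xl; have [] := inn t x tt xl.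
- by apply: split_x h8 g4 => t x tt xl; have [] := inn t x tt xl.
- by apply: split_t al3 _ h9 g5 => t x tt xl; have [] := inn t x tt xl.
Qed.

Lemma bounded_norm_no_blowup (al l Tm C : R) (u : R -> R -> R) :
  0 < al < 1 -> 0 < Tm -> 0 <= C ->
  (forall tau, 0 < tau < Tm -> holder_bounds al l `]0, tau[ u C) ->
  ~ (parabolic_norm al l tau u @[tau --> Tm^'-] --> +oo%E).
Proof.
move=> al01 Tm0 C0 hb /cvgeyPge /(_ (9 * C + 1)) H.
have : \forall tau \near Tm^'-, False.
  near=> tau.
  have tauI : 0 < tau < Tm.
    apply/andP; split; last by near: tau; exact: nbhs_left_lt.
    by near: tau; exact: nbhs_left_gt.
  have h1 : ((9 * C + 1)%:E <= parabolic_norm al l tau u)%E by near: tau.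
  have := le_trans h1 (bounds_parabolic_norm al01 C0 (hb _ tauI)).
  by rewrite lee_fin; clear; lra.
by move/filter_ex => [].
Unshelve. all: by end_near. Qed.

End Conclusion.

(** * From the quasilinear problem to coefficients evaluated along the solution *)

Section SolutionEvolution.
Context {R : realType}.
Implicit Types (s t x y z p tau : R).

(** Once $|u|\le M$ and $|u_x|\le N$, the arguments of the coefficients stay in a compact box on
    which these are bounded, Lipschitz and, for [a] and [b], bounded away from 0, uniformly up to
    [Tm]. *)
Lemma solution_evolution (T l al M N Tm : R)
    (a f : R -> R -> R -> R -> R) (b g : R -> R -> R -> R) (u0 : R -> R) (u : R -> R -> R) :
  0 < T -> 0 < l -> 0 < al < 1 -> 0 < M -> 0 <= N -> 0 < Tm <= T ->
  class_C 2 (coef_domain l T) (uncurry4 a) ->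
  class_C 2 (coef_domain l T) (uncurry4 f) ->
  class_C 2 (bdry_domain T) (fun q : R * R => b q.1 l q.2) ->
  class_C 2 (bdry_domain T) (fun q : R * R => b q.1 (- l) q.2) ->
  class_C 2 (bdry_domain T) (fun q : R * R => g q.1 l q.2) ->
  class_C 2 (bdry_domain T) (fun q : R * R => g q.1 (- l) q.2) ->
  (forall t x z p, 0 <= t <= T -> - l <= x <= l -> 0 < a t x z p) ->
  (forall t z, 0 <= t <= T -> 0 < b t l z /\ 0 < b t (- l) z) ->
  (forall tau, 0 < tau < Tm -> parabolic_holder al l tau u) ->
  solves l a f b g u0 Tm u ->
  (forall t x, 0 <= t < Tm -> - l <= x <= l -> `|bar l Tm u t x| <= M) ->
  (forall t x y, 0 <= t < Tm -> - l <= x <= l -> - l <= y <= l ->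
    `|bar l Tm u t x - bar l Tm u t y| <= N * `|x - y|) ->
  exists c Q A F br bl gr gl, evolution l Tm al c Q (bar l Tm u) (bar l Tm (d_t u))
    (bar l Tm (d_x u)) (bar l Tm (d_xx u)) A F br bl gr gl.
Proof.
move=> T0 l0 al01 M0 N0 /andP[Tm0 TmT] ha hf hbr hbl hgr hgl apos bpos ph sol UM US.
have M0' := ltW M0.
have [La La0 lipa] := coef_lipschitz M N l0 T0 ha.
have [Lf Lf0 lipf] := coef_lipschitz M N l0 T0 hf.
have [Ba Ba0 bda] := coef_bound M N ha.
have [Bf Bf0 bdf] := coef_bound M N hf.
have [ca ca0 lowa] := coef_lower_bound l0 T0 M0' N0 ha apos.
have [L1 L10 lip1] := @bdry_lipschitz _ _ M (fun t z => b t l z) T0 hbr.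
have [L2 L20 lip2] := @bdry_lipschitz _ _ M (fun t z => b t (- l) z) T0 hbl.
have [L3 L30 lip3] := @bdry_lipschitz _ _ M (fun t z => g t l z) T0 hgr.
have [L4 L40 lip4] := @bdry_lipschitz _ _ M (fun t z => g t (- l) z) T0 hgl.
have [B1 B10 bd1] := @bdry_bound _ _ M (fun t z => b t l z) hbr.
have [B2 B20 bd2] := @bdry_bound _ _ M (fun t z => b t (- l) z) hbl.
have [B3 B30 bd3] := @bdry_bound _ _ M (fun t z => g t l z) hgr.
have [B4 B40 bd4] := @bdry_bound _ _ M (fun t z => g t (- l) z) hgl.
have [c1 c10 low1] := @bdry_lower_bound _ _ _ (fun t z => b t l z) T0 M0' hbr (fun t z tT => proj1 (bpos t z tT)).
have [c2 c20 low2] := @bdry_lower_bound _ _ _ (fun t z => b t (- l) z) T0 M0' hbl (fun t z tT => proj2 (bpos t z tT)).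
have [C C0 [dtC dtH]] := bars_dt al01 l0 ph Tm0.
set U := bar l Tm u in UM US *; set Ut := bar l Tm (d_t u) in dtC dtH *.
set Ux := bar l Tm (d_x u); set Uxx := bar l Tm (d_xx u).
pose c := Num.min ca (Num.min c1 c2).
have c0 : 0 < c by rewrite /c !lt_min ca0 c10.
have [cca [cc1 cc2]] : c <= ca /\ (c <= c1 /\ c <= c2) by rewrite /c !ge_min !lexx ?orbT.
pose Q := (M + N + C) + (La + Lf + Ba + Bf) + (L1 + L2 + L3 + L4) + (B1 + B2 + B3 + B4).
have [[q1 [q2 q3]] [[q4 q5] [q6 q7]]] :
    (M <= Q /\ N <= Q /\ C <= Q) /\ (La <= Q /\ Lf <= Q) /\ (Ba <= Q /\ Bf <= Q).
  rewrite /Q; move: M0' N0 C0 La0 Lf0 Ba0 Bf0 L10 L20 L30 L40 B10 B20 B30 B40.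
  by clear; do !split; lra.
have [[q8 [q9 [q10 q11]]] [q12 [q13 [q14 q15]]]] :
    (L1 <= Q /\ L2 <= Q /\ L3 <= Q /\ L4 <= Q) /\ (B1 <= Q /\ B2 <= Q /\ B3 <= Q /\ B4 <= Q).
  rewrite /Q; move: M0' N0 C0 La0 Lf0 Ba0 Bf0 L10 L20 L30 L40 B10 B20 B30 B40.
  by clear; do !split; lra.
have Q0 : 0 <= Q by exact: le_trans q1.
clearbody Q c; clear M0' La0 Lf0 Ba0 Bf0 L10 L20 L30 L40 B10 B20 B30 B40.
have tT t : 0 < t < Tm -> 0 <= t <= T.
  by move=> /andP[/ltW -> /ltW tt]; rewrite (le_trans tt).
have t0T t : 0 < t < Tm -> 0 <= t < Tm by move=> /andP[/ltW -> ->].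
have cl x : - l < x < l -> - l <= x <= l by move=> /andP[/ltW -> /ltW ->].
have UMz t x : 0 < t < Tm -> - l <= x <= l -> - M <= U t x <= M.
  by move=> /t0T tt xl; rewrite -ler_norml UM.
have ll : - l <= l <= l by clear -l0; lra.
have ll' : - l <= - l <= l by clear -l0; lra.
have cls ta tb : 0 <= ta -> tb < Tm -> classical l ta tb U Ut Ux Uxx.
  by move=> ta0 tbT; exact: (bars_classical al01 l0 ph ta0 tbT Tm0).
have UxN t x : 0 < t < Tm -> - l <= x <= l -> `|Ux t x| <= N.
  move=> tt xl; have [tau ttau /andP[tau0 tauT]] := later_time (t0T _ tt).
  have [_ _ Hx _] := cls 0 tau (lexx 0) tauT.
  have t_in : 0 < t <= tau by rewrite (ltW ttau) andbT; case/andP: tt.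
  apply: (taylor1_slope (Hx t x t_in xl)) => [d d0|y]; last first.
    by rewrite /= in_itv/= => yl; exact: US (t0T _ tt) yl xl.
  (* A nearby point on the side of the centre, so that it stays in the interval even when [x] is an
     endpoint. *)
  pose r := Num.min (d / 2) l.
  have r0 : 0 < r by rewrite lt_min divr_gt0.
  have [rd rl] : r <= d / 2 /\ r <= l by rewrite /r !ge_min !lexx orbT.
  have [x0|x0] := leP x 0.
    exists (x + r); split; first by rewrite /= in_itv/=; clear -xl x0 r0 rl; lra.
      by rewrite gt_eqF// ltrDl.
    by rewrite addrC addKr gtr0_norm//; clear -rd d0; lra.
  exists (x - r); split; first by rewrite /= in_itv/=; clear -xl x0 r0 rl; lra.
    by rewrite lt_eqF// ltrBlDr ltrDl.
  by rewrite addrC addKr normrN gtr0_norm//; clear -rd d0; lra.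
have UxNz t x : 0 < t < Tm -> - l <= x <= l -> - N <= Ux t x <= N.
  by move=> tt xl; rewrite -ler_norml UxN.
have [pde bc_r bc_l _] := sol.
have {}bc_r t : 0 < t < Tm -> Ut t l + b t l (U t l) * Ux t l = g t l (U t l) := bc_r t.
have {}bc_l t : 0 < t < Tm -> Ut t (- l) - b t (- l) (U t (- l)) * Ux t (- l) = g t (- l) (U t (- l))
  := bc_l t.
exists c, Q, (fun t x => a t x (U t x) (Ux t x)), (fun t x => f t x (U t x) (Ux t x)),
  (fun t => b t l (U t l)), (fun t => b t (- l) (U t (- l))),
  (fun t => g t l (U t l)), (fun t => g t (- l) (U t (- l))).
have lift (L z w : R) : L <= Q -> 0 <= w -> z <= L * w -> z <= Q * w.
  by move=> LQ w0 /le_trans; apply; rewrite ler_wpM2r.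
split => //.
- by move=> t x tt xl; apply: le_trans q1; exact: UM.
- by move=> t x y tt xl yl; apply: (lift N) => //; exact: US.
- by move=> t x tt xl; apply: le_trans q2; exact: UxN.
- move=> t x tt xl; have [u1 u2 u3 u4] := bars_interior al01 l0 ph tt xl.
  rewrite /U /Ut /Ux /Uxx u1 u2 u3 u4; have := pde t x tt xl.
  by move=> <-; rewrite addrC subrK.
- move=> t x tt /cl xl; have tt' := tT _ tt; apply/andP; split.
    by apply: le_trans cca _; apply: lowa => //; [exact: UMz|exact: UxNz].
  apply: le_trans (ler_norm _) _; apply: le_trans q6.
  by apply: bda => //; [exact: UMz|exact: UxNz].
- move=> t x tt /cl xl; have tt' := tT _ tt; apply: le_trans q7.
  by apply: bdf => //; [exact: UMz|exact: UxNz].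
- move=> t s x y tt ss /cl xl /cl yl; have tt' := tT _ tt; have ss' := tT _ ss.
  split; [apply: (lift La) => //|apply: (lift Lf) => //].
  + by apply: lipa => //; [exact: UMz|exact: UMz|exact: UxNz|exact: UxNz].
  + by apply: lipf => //; [exact: UMz|exact: UMz|exact: UxNz|exact: UxNz].
- move=> t tt; have tt' := tT _ tt; have Ul := UMz _ _ tt ll; split; first exact: bc_r.
    apply/andP; split; first by apply: le_trans cc1 _; exact: low1.
    by apply: le_trans (ler_norm _) _; apply: le_trans q12; exact: bd1.
  by apply: le_trans q14; exact: bd3.
- move=> t tt; have tt' := tT _ tt; have Ul := UMz _ _ tt ll'; split; first exact: bc_l.
    apply/andP; split; first by apply: le_trans cc2 _; exact: low2.
    by apply: le_trans (ler_norm _) _; apply: le_trans q13; exact: bd2.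
  by apply: le_trans q15; exact: bd4.
- move=> t s tt ss; have tt' := tT _ tt; have ss' := tT _ ss.
  have Ul := UMz _ _ tt ll; have Ul' := UMz _ _ tt ll'.
  have Us := UMz _ _ ss ll; have Us' := UMz _ _ ss ll'.
  split.
  + by apply: (lift L1) => //; exact: lip1.
  + by apply: (lift L3) => //; exact: lip3.
  + by apply: (lift L2) => //; exact: lip2.
  + by apply: (lift L4) => //; exact: lip4.
- by move=> t x tt xl; apply: le_trans q3; exact: dtC.
- move=> t x y tt xl yl; apply: (lift C) => //.
  exact: dtH.
Qed.

End SolutionEvolution.

Theorem corollary3p5 (R : realType) (T l alpha : R)
  (hT : 0 < T) (hl : 0 < l) (halpha : 0 < alpha < 1)
  (a f : R -> R -> R -> R -> R) (b g : R -> R -> R -> R)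
  (ha : class_C 2 (coef_domain l T) (uncurry4 a))
  (hf : class_C 2 (coef_domain l T) (uncurry4 f))
  (hb_r : class_C 2 (bdry_domain T) (fun q : R * R => b q.1 l q.2))
  (hb_l : class_C 2 (bdry_domain T) (fun q : R * R => b q.1 (- l) q.2))
  (hg_r : class_C 2 (bdry_domain T) (fun q : R * R => g q.1 l q.2))
  (hg_l : class_C 2 (bdry_domain T) (fun q : R * R => g q.1 (- l) q.2))
  (a_gt0 : forall t x z p : R, 0 <= t <= T -> - l <= x <= l -> 0 < a t x z p)
  (b_gt0 : forall t z : R, 0 <= t <= T -> 0 < b t l z /\ 0 < b t (- l) z)
  (u0 : R -> R) (hu0 : class_C2_holder alpha `[- l, l] u0)
  (hcompat : compatibility l a f b g u0)
  (K : R)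
  (hK : forall x y : R, - l <= x <= l -> - l <= y <= l ->
     `|u0 x - u0 y| <= K * `|x - y|)
  (M : R) (hM : 0 < M) (q0 : R) (hq0 : K <= q0)
  (psi : R -> R) (hpsi : class_C 1 (`[0, +oo[ : set R) psi)
  (psi_ge1 : forall rho : R, 0 <= rho -> 1 <= psi rho)
  (hint : ((2 * M)%:E <
     \int[lebesgue_measure]_(rho in `[q0, +oo[) (rho / psi rho)%:E)%E)
  (hfa : forall t x z p : R, 0 <= t <= T -> - l <= x <= l -> - M <= z <= M ->
     `|f t x z p| <= a t x z p * psi `|p|)
  (hgb : forall t z p : R, 0 < t <= T -> - M <= z <= M -> q0 <= p ->
     [/\ g t l z <= b t l z * p, - g t l z <= b t l z * p,
         - g t (- l) z <= b t (- l) z * p & g t (- l) z <= b t (- l) z * p])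
  (tau_inf : R) (u : R -> R -> R)
  (hu : maximal_solution alpha l T a f b g u0 tau_inf u)
  (hbound : forall tau : R, 0 < tau < tau_inf ->
     (sup_norm l tau u <= M%:E)%E) :
  tau_inf = T /\ parabolic_holder alpha l T u.
Proof.
(* The second alternative of [maximal_solution] is the conclusion itself, so it remains to refute
   blow-up. *)
have [/andP[tau0 tauT] ph sol [blow|//]] := hu; exfalso.
have ll : - l <= l <= l by clear -hl; lra.
have ll' : - l <= - l <= l by clear -hl; lra.
(* Read off from [hK] at the two ends; it yields $q_0\ge0$, which [gradient_estimate] requires. *)
have K0 : 0 <= K.
  have := le_trans (normr_ge0 _) (hK l (- l) ll ll').
  by rewrite pmulr_lge0// normr_gt0 opprK gt_eqF// addr_gt0.
have q00 : 0 <= q0 by exact: le_trans hq0.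
have UM := bars_bound halpha hl ph hbound.
have inn := bars_interior halpha hl ph.
have [pde bc_r bc_l ini] := sol.
pose U := bar l tau_inf u; pose Ut := bar l tau_inf (d_t u).
pose Ux := bar l tau_inf (d_x u); pose Uxx := bar l tau_inf (d_xx u).
have UMz t x : 0 < t < tau_inf -> - l <= x <= l -> - M <= U t x <= M.
  by move=> /andP[/ltW t0 tt] xl; rewrite -ler_norml UM// t0.
have in_T t : 0 < t < tau_inf -> 0 < t <= T.
  by move=> /andP[-> /ltW tt]; exact: le_trans tauT.
have [N N0 US] : exists2 N, 0 <= N & forall t x y, 0 <= t < tau_inf ->
    - l <= x <= l -> - l <= y <= l -> `|U t x - U t y| <= N * `|x - y|.
  apply: (gradient_estimate (Ut := Ut) (Ux := Ux) (Uxx := Uxx) hl hM q00 hq0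
    (proj1 hpsi) psi_ge1 hint).
  - by move=> tau /andP[_ tt]; exact: (bars_classical halpha hl ph (lexx 0) tt tau0).
  - by move=> t x tt xl; exact: UM.
  - move=> x y xl yl; have -> : U 0 x = u0 x := ini x xl.
    by have -> : U 0 y = u0 y := ini y yl; exact: hK.
  - move=> t x tt xl; have [u1 u2 u3 u4] := inn t x tt xl.
    have xl' : - l <= x <= l by case/andP: xl => /ltW -> /ltW ->.
    have Uz := UMz _ _ tt xl'; have /andP[/ltW t0 tT] := in_T _ tt.
    exists (a t x (u t x) (d_x u t x)); first by apply: a_gt0; rewrite ?t0.
    rewrite /Ut /Ux /Uxx u2 u3 u4 pde//; apply: hfa; rewrite ?t0//.
    by rewrite -u1.
  - move=> t tt; have tT := in_T _ tt; have Uz := UMz _ _ tt ll.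
    exists (b t l (U t l)) => [|p qp].
      by have /andP[/ltW t0 tT'] := tT; have [] := b_gt0 t (U t l); rewrite ?t0.
    have -> : Ut t l + b t l (U t l) * Ux t l = g t l (U t l) := bc_r t tt.
    by have [g1 g2 _ _] := hgb t _ p tT Uz qp; rewrite ler_norml lerNl g1 g2.
  - move=> t tt; have tT := in_T _ tt; have Uz := UMz _ _ tt ll'.
    exists (b t (- l) (U t (- l))) => [|p qp].
      by have /andP[/ltW t0 tT'] := tT; have [] := b_gt0 t (U t (- l)); rewrite ?t0.
    have -> : Ut t (- l) - b t (- l) (U t (- l)) * Ux t (- l) = g t (- l) (U t (- l)) :=
      bc_l t tt.
    by have [_ _ g1 g2] := hgb t _ p tT Uz qp; rewrite ler_norml lerNl g1 g2.
have tauI : 0 < tau_inf <= T by rewrite tau0.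
have [c [Q [A [F [br [bl [gr [gl ev]]]]]]]] :=
  solution_evolution hT hl halpha hM N0 tauI ha hf hb_r hb_l hg_r hg_l a_gt0 b_gt0 ph sol UM US.
have [C C0 hC] := uniform_holder_bounds ph ev.
exact: (bounded_norm_no_blowup halpha tau0 C0 hC blow).
Qed.
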